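(* Let $\Gamma$ be a $Gr'(1/6)$-labelled graph whose components are finite, labelled by a finite set $\mathcal S$. Then: - every infinite order element of $G(\Gamma)$ has rational translation length; - the translation lengths of infinite order elements of $G(\Gamma)$ are bounded away from zero.
   Context: Graphical small cancellation. An $\mathcal S$-labelled graph $\Gamma$ is a directed graph with edges labelled by elements of $\mathcal S$; paths may traverse edges backwards, reading inverse labels. The labelling is assumed reduced: no vertex has two outgoing edges with the same label, and no vertex has two incoming edges with the same label. $G(\Gamma)=\langle\mathcal S\mid\mathcal R\rangle$, where $\mathcal R$ is the set of words read on simple cycles of $\Gamma$. A piece is a labelled path graph $p$ with two label-preserving maps $\phi_1,\phi_2\colon p\to\Gamma$ such that no label-preserving automorphism $\psi$ of $\Gamma$ has $\phi_2=\psi\circ\phi_1$. $\Gamma$ is $Gr'(1/6)$-labelled if every piece $p$ contained in a simple cycle $c$ has $|p|<|c|/6$. Translation length. Let $|\cdot|$ denote the word length in $G(\Gamma)$ with respect to $\mathcal S$. The translation length of $g$ is $\tau(g)=\lim_{n\to\infty}|g^n|/n$. *)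

(* Defs.v *)
From Stdlib Require Import Reals Classical ClassicalEpsilon.
From Stdlib Require List.
From mathcomp Require Import all_boot.

Set Implicit Arguments.
Unset Strict Implicit.
Unset Printing Implicit Defensive.

Record lgraph (S : Type) := LGraph {
  vert : Type;
  edge : Type;
  src  : edge -> vert;
  tgt  : edge -> vert;
  lab  : edge -> S }.

Section Graphs.
Variables (S : Type) (G : lgraph S).

Definition oedge := (edge G * bool)%type.
Definition ostart (oe : oedge) : vert G :=
  if oe.2 then src oe.1 else tgt oe.1.
Definition oend (oe : oedge) : vert G :=
  if oe.2 then tgt oe.1 else src oe.1.
(* letter read: (s, true) = s, (s, false) = s^-1 *)
Definition olab (oe : oedge) : S * bool := (lab oe.1, oe.2).

(* a path = start vertex + sequence of consecutive oriented edges;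
   equivalently a label-preserving map from a labelled path graph *)
Fixpoint is_path (v : vert G) (p : seq oedge) : Prop :=
  match p with
  | [::] => True
  | oe :: p' => ostart oe = v /\ is_path (oend oe) p'
  end.
Definition path_end (v : vert G) (p : seq oedge) : vert G := last v (map oend p).
Definition path_word (p : seq oedge) : seq (S * bool) := map olab p.

Definition reduced_labelling : Prop :=
  (forall e1 e2 : edge G, src e1 = src e2 -> lab e1 = lab e2 -> e1 = e2) /\
  (forall e1 e2 : edge G, tgt e1 = tgt e2 -> lab e1 = lab e2 -> e1 = e2).

Definition connected (v w : vert G) : Prop :=
  exists p, is_path v p /\ path_end v p = w.
Definition finite_components : Prop :=
  forall v : vert G, exists l : seq (vert G),
    forall w, connected v w -> List.In w l.

Definition simple_cycle (v : vert G) (p : seq oedge) : Prop :=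
  is_path v p /\ (0 < size p)%N /\ path_end v p = v /\
  List.NoDup (map ostart p) /\ List.NoDup (map fst p).

Definition is_lab_aut (fv : vert G -> vert G) (fe : edge G -> edge G) : Prop :=
  bijective fv /\ bijective fe /\
  forall e, src (fe e) = fv (src e) /\ tgt (fe e) = fv (tgt e) /\ lab (fe e) = lab e.

(* a piece: two label-preserving maps phi1 = (v1,p1), phi2 = (v2,p2) of the
   same labelled path graph into G, not differing by a label-preserving
   automorphism (psi o phi1 = phi2 on vertices and edges). *)
Definition is_piece (v1 : vert G) (p1 : seq oedge) (v2 : vert G) (p2 : seq oedge) : Prop :=
  is_path v1 p1 /\ is_path v2 p2 /\ path_word p1 = path_word p2 /\
  ~ (exists fv fe, is_lab_aut fv fe /\ fv v1 = v2 /\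
        map (fun oe : oedge => (fe oe.1, oe.2)) p1 = p2).

(* the piece phi1 = (v1,p1) is contained in the cycle (v,p): it is a subpath of
   the subgraph c, i.e. it uses each edge at most once and only edges of c *)
Definition contained_in (v1 : vert G) (p1 : seq oedge) (v : vert G) (p : seq oedge) : Prop :=
  List.NoDup (map fst p1) /\ forall oe, List.In oe p1 -> List.In oe.1 (map fst p).

Definition Gr'16 : Prop :=
  forall v p v1 p1 v2 p2, simple_cycle v p -> is_piece v1 p1 v2 p2 ->
    contained_in v1 p1 v p -> (6 * size p1 < size p)%N.

Definition relator (w : seq (S * bool)) : Prop :=
  exists v p, simple_cycle v p /\ w = path_word p.

End Graphs.

(* The group G(Gamma) = < S | R > : words over S^{+-1} modulo the      *)
(* congruence generated by free reduction and the relators.            *)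
Definition linv (S : Type) (x : S * bool) : S * bool := (x.1, ~~ x.2).

Inductive geq (S : Type) (Rel : seq (S * bool) -> Prop) :
    seq (S * bool) -> seq (S * bool) -> Prop :=
| geq_refl w : geq Rel w w
| geq_sym w1 w2 : geq Rel w1 w2 -> geq Rel w2 w1
| geq_trans w1 w2 w3 : geq Rel w1 w2 -> geq Rel w2 w3 -> geq Rel w1 w3
| geq_free u v x : geq Rel (u ++ x :: linv x :: v) (u ++ v)
| geq_rel u v r : Rel r -> geq Rel (u ++ r ++ v) (u ++ v).

Definition wpow (S : Type) (w : seq (S * bool)) (n : nat) : seq (S * bool) :=
  flatten (nseq n w).

Definition infinite_order (S : Type) (Rel : seq (S * bool) -> Prop) (w : seq (S * bool)) : Prop :=
  forall n, (0 < n)%N -> ~ geq Rel (wpow w n) [::].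

Lemma least_nat_ex (P : nat -> Prop) n : P n ->
  exists k, P k /\ forall m, P m -> (k <= m)%N.
Proof.
elim/ltn_ind: n => n IH Pn.
case: (classic (exists m, (m < n)%N /\ P m)) => [[m [lt Pm]]|H].
  exact: IH m lt Pm.
exists n; split => // m Pm; rewrite leqNgt; apply/negP => lt; apply: H; eauto.
Qed.

Lemma wordlen_ex (S : Type) (Rel : seq (S * bool) -> Prop) (w : seq (S * bool)) :
  exists k, (exists w', geq Rel w w' /\ size w' = k) /\
            forall m, (exists w', geq Rel w w' /\ size w' = m) -> (k <= m)%N.
Proof. apply: (@least_nat_ex _ (size w)); exists w; split => //; exact: geq_refl. Qed.

Definition wordlen (S : Type) (Rel : seq (S * bool) -> Prop) (w : seq (S * bool)) : nat :=
  proj1_sig (constructive_indefinite_description _ (wordlen_ex Rel w)).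

(* the sequence |g^n| / n  (n >= 1); tau(g) is its limit *)
Definition tl_seq (S : Type) (Rel : seq (S * bool) -> Prop) (w : seq (S * bool)) (n : nat) : R :=
  Rdiv (INR (wordlen Rel (wpow w n.+1))) (INR n.+1).

(* Main.v *)
Require Import Defs.
From Stdlib Require Import Reals ZArith Lra Lia Classical ClassicalEpsilon FinFun.
From Stdlib Require List.
From mathcomp Require Import all_boot zify.

Set Implicit Arguments.
Unset Strict Implicit.
Unset Printing Implicit Defensive.

(* Call a word locally geodesic if each of its subwords labels only geodesic paths of the graph.
   The theorem rests on a description of equality in the group without planar diagrams: two equal
   locally geodesic words bound a strip, that is, a chain of cells, each contained in a copy of a
   component of the graph, in which consecutive cells are separated by a piece. The point is that
   strips compose. Glue two strips along a common word: where two cells of different copies overlap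
   along it, the overlap is a piece. A cell whose outer side is geodesic (at most half of any simple
   cycle) and whose remaining boundary consists of three pieces (each less than a sixth) cannot
   exist; hence two overlapping cells, once one of them is left for a third copy, can never both be
   completed, and otherwise the two strips merge into one. So right multiplication by a letter is
   well defined on classes of locally geodesic words, and the relators act trivially.

   In a strip the two sides are comparable: each is at most three times as long as the other.
   Let w be a shortest conjugate of an element of infinite order. Either all powers of w are locally
   geodesic, or w is read across a component that overlaps its translate by w; in that case the
   shortest words from 1 to w^n through the chain of translates of this component are locally
   geodesic and have length at least n. In both cases the length of w^n is at least n/3. Moreover
   a cell of a strip along this axis meets it in more than a sixth of a simple cycle, hence is
   determined by that intersection, and modulo w there are only finitely many such cells. As the
   components are finite, geodesics from 1 to w^n stay in a set that is finite modulo w, and by the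
   pigeonhole principle the translation length is the least ratio of length to exponent among
   finitely many loops in this set. *)

(** * Words and free reduction *)

(** All counting is in sixths of a simple cycle: a geodesic side weighs three, a piece weighs one,
    strictly. A closed path whose sides weigh at most six, at least one of them a piece, is freely
    trivial, for otherwise it would contain a simple cycle too long for its sides. One geodesic
    against three pieces is the borderline case, and it is exactly what gluing strips demands. The
    factor 3 has the same origin: in a simple cell one side is at most half and the two pieces
    together are less than a third of the boundary, so the other side exceeds a sixth. As
    conjugation changes the length of a power only by a bounded amount, the bound 1/3 holds for all
    elements of infinite order.

    Local geodesicity constrains only subwords that can be read in the graph. Unlike geodesicity in
    the group, it can be restored letter by letter before anything is known about equality in the
    group. Geodesic words of the group have it, and so do the words running along an axis; strips
    can therefore compare the two. *)

Section Words.
Variable S : finType.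
Notation letter := (S * bool)%type.
Notation word := (seq letter).

Lemma linvK : involutive (@linv S).
Proof. by case=> s b; rewrite /linv /= negbK. Qed.

Lemma linv_neq (a : letter) : linv a != a.
Proof. by case: a => s b; rewrite /linv xpair_eqE /= negb_and; case: b; rewrite orbT. Qed.

Definition winv (w : word) : word := rev (map (@linv S) w).

Lemma winvK : involutive winv.
Proof. by move=> w; rewrite /winv map_rev revK mapK //; apply: linvK. Qed.

Lemma winv_cat u v : winv (u ++ v) = winv v ++ winv u.
Proof. by rewrite /winv map_cat rev_cat. Qed.

Lemma winv_cons a w : winv (a :: w) = rcons (winv w) (linv a).
Proof. by rewrite /winv /= rev_cons. Qed.

Lemma winv_rcons a w : winv (rcons w a) = linv a :: winv w.
Proof. by rewrite /winv map_rcons rev_rcons. Qed.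

Lemma size_winv w : size (winv w) = size w.
Proof. by rewrite size_rev size_map. Qed.

Definition noncan (a b : letter) : bool := b != linv a.
Definition reduced (w : word) : bool := sorted noncan w.

Lemma ncan_linv a b : noncan (linv b) (linv a) = noncan a b.
Proof.
by rewrite /noncan linvK; apply/idP/idP => /eqP h; apply/eqP => e; apply: h; rewrite e ?linvK.
Qed.

Lemma reduced_winv w : reduced (winv w) = reduced w.
Proof.
rewrite /reduced /winv rev_sorted sorted_map; apply: eq_sorted => a b /=.
by rewrite /relpre /= ncan_linv.
Qed.

Lemma reduced_catP u v :
  reduced (u ++ v) -> reduced u /\ reduced v.
Proof.
move=> h; split.
  by have := take_sorted (size u) h; rewrite take_size_cat.
by have := drop_sorted (size u) h; rewrite drop_size_cat.
Qed.

Lemma reduced_catl u v : reduced (u ++ v) -> reduced u. Proof. by case/reduced_catP. Qed.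
Lemma reduced_catr u v : reduced (u ++ v) -> reduced v. Proof. by case/reduced_catP. Qed.

Lemma reduced_infix u v w : reduced (u ++ v ++ w) -> reduced v.
Proof. by move=> /reduced_catr/reduced_catl. Qed.

Lemma reduced_cat_cons u a b v :
  reduced (rcons u a ++ b :: v) = [&& reduced (rcons u a), noncan a b & reduced (b :: v)].
Proof.
case: u => [|c u]; first by [].
by rewrite /reduced /= cat_path /= last_rcons andbA.
Qed.

Lemma reduced_overlap u v w : v <> [::] -> reduced (u ++ v) -> reduced (v ++ w) ->
  reduced (u ++ v ++ w).
Proof.
case/lastP: v => // v b _; elim: u => //= a u IH h hv.
have := IH (reduced_catr (u := [:: a]) h) hv.
case: u h {IH} => [|c u] /=.
  case: v hv => [|d v] /= hv; first by case/andP=> -> _.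
  by case/andP=> ->.
by case/andP=> ->.
Qed.

Definition push (a : letter) (r : word) : word :=
  if r is b :: r' then if b == linv a then r' else a :: r else [:: a].
Definition reduce (w : word) : word := foldr push [::] w.

Lemma reduced_push a r : reduced r -> reduced (push a r).
Proof.
case: r => //= b r; case: eqP => [_|/eqP h]; first exact: path_sorted.
by rewrite /= /noncan h.
Qed.

Lemma reduced_reduce w : reduced (reduce w).
Proof. by elim: w => //= a w; apply: reduced_push. Qed.

Lemma reduce_id w : reduced w -> reduce w = w.
Proof.
elim: w => //= a w IH h; rewrite IH; last exact: path_sorted h.
by case: w h {IH} => //= b w; rewrite /noncan => /andP[/negbTE ->].
Qed.

(** Letters act on reduced words by [push], and inverse letters act by inverse maps. This makes
    [reduce] invariant under free cancellation, with no confluence argument. *)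
Lemma pushK a r : reduced r -> push a (push (linv a) r) = r.
Proof.
case: r => [|b r] /=; first by rewrite eqxx.
case: eqP => [->|_] h; last by rewrite /= eqxx.
rewrite linvK; case: r h => //= c r; rewrite linvK /noncan.
by case/andP=> /negbTE ->.
Qed.

Lemma reduced_foldr u r : reduced r -> reduced (foldr push r u).
Proof. by move=> h; elim: u => //= a u; apply: reduced_push. Qed.

Lemma foldr_fred u r : reduced r -> foldr push r (reduce u) = foldr push r u.
Proof.
move=> h; elim: u => //= a u <-; case: (reduce u) => //= b s.
case: eqP => [->|//]; rewrite pushK //; exact: reduced_foldr.
Qed.

Lemma reduce_cat u v : reduce (u ++ v) = foldr push (reduce v) u.
Proof. by rewrite /reduce foldr_cat. Qed.

Lemma reduceK w : reduce (reduce w) = reduce w.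
Proof. exact/reduce_id/reduced_reduce. Qed.

Lemma reduce_catl u v : reduce (reduce u ++ v) = reduce (u ++ v).
Proof. by rewrite !reduce_cat foldr_fred ?reduced_reduce. Qed.

Lemma reduce_catr u v : reduce (u ++ reduce v) = reduce (u ++ v).
Proof. by rewrite !reduce_cat reduceK. Qed.

Lemma reduce_congl u u' v : reduce u = reduce u' -> reduce (u ++ v) = reduce (u' ++ v).
Proof. by rewrite -reduce_catl => ->; rewrite reduce_catl. Qed.

Lemma reduce_congr u v v' : reduce v = reduce v' -> reduce (u ++ v) = reduce (u ++ v').
Proof. by rewrite -reduce_catr => ->; rewrite reduce_catr. Qed.

Lemma reduce_invr w : reduce (w ++ winv w) = [::].
Proof.
elim: w => // a w IH; rewrite winv_cons -cats1 catA.
by rewrite -[_ ++ [:: _]]/(a :: _) -[LHS]/(push a (reduce _)) -reduce_catl IH /= eqxx.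
Qed.

Lemma reduce_invl w : reduce (winv w ++ w) = [::].
Proof. by rewrite -{2}(winvK w) reduce_invr. Qed.

Lemma reduce_cancell c u v : reduce (c ++ u) = reduce (c ++ v) -> reduce u = reduce v.
Proof.
move=> /(reduce_congr (winv c)); rewrite !catA -(reduce_catl _ u) -(reduce_catl _ v).
by rewrite reduce_invl.
Qed.

Lemma reduce_cancelr c u v : reduce (u ++ c) = reduce (v ++ c) -> reduce u = reduce v.
Proof.
move=> /(reduce_congl (winv c)); rewrite -!catA -(reduce_catr u) -(reduce_catr v).
by rewrite reduce_invr !cats0.
Qed.

Lemma reduce_mover u v w : reduce (u ++ v) = reduce w -> reduce u = reduce (w ++ winv v).
Proof.
move=> h; apply: (reduce_cancelr (c := v)); rewrite h -catA.
by rewrite -(reduce_catr w) reduce_invl cats0.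
Qed.

Lemma reduce_movel u v w : reduce (u ++ v) = reduce w -> reduce v = reduce (winv u ++ w).
Proof.
move=> h; apply: (reduce_cancell (c := u)); rewrite h catA.
by rewrite -(reduce_catl _ w) reduce_invr.
Qed.

Lemma reduce_triv u v : reduce (u ++ winv v) = [::] <-> reduce u = reduce v.
Proof.
split=> [h|h]; last by rewrite (reduce_congl _ h) reduce_invr.
by rewrite -[v in RHS]winvK; apply: (reduce_mover (w := [::])).
Qed.

Lemma nreducedP w : ~~ reduced w -> exists u a v, w = u ++ a :: linv a :: v.
Proof.
elim: w => //= a [|b w] IH //=; rewrite negb_and negbK.
case: eqP => [-> _|_ /= /IH [u [c [v ->]]]]; first by exists [::], a, w.
by exists (a :: u), c, v.
Qed.

Lemma reduce_cancel u a v : reduce (u ++ a :: linv a :: v) = reduce (u ++ v).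
Proof. by rewrite !reduce_cat /= pushK ?reduced_reduce. Qed.

Lemma nreduced_junction u v : reduced u -> reduced v -> ~~ reduced (u ++ v) ->
  exists u' a v', u = rcons u' a /\ v = linv a :: v'.
Proof.
case/lastP: u => [|u a]; first by move=> _ ->.
case: v => [|b v]; first by rewrite cats0 => ->.
move=> hu hv; rewrite reduced_cat_cons hu hv andbT /= negbK => /eqP ->.
by exists u, a, v.
Qed.

Lemma lcpP (t p : word) : reduced t -> reduced p ->
  exists al t0 p0, [/\ t = al ++ t0, p = al ++ p0 & reduced (winv t0 ++ p0)].
Proof.
elim: t p => [|a t IH] p rt rp; first by exists [::], [::], p.
case: p rp => [|b p] rp.
  by exists [::], (a :: t), [::]; split; rewrite // cats0 reduced_winv.
case: (eqVneq a b) => [e|ne].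
  subst b.
  have rt' : reduced t by exact: path_sorted rt.
  have rp' : reduced p by exact: path_sorted rp.
  have [al [t0 [p0 [-> -> h]]]] := IH p rt' rp'.
  by exists (a :: al), t0, p0.
exists [::], (a :: t), (b :: p); split=> //.
have h := reduced_cat_cons (winv t) (linv a) b p; rewrite -winv_cons reduced_winv in h.
by rewrite h rt rp /noncan linvK eq_sym ne.
Qed.

Lemma lcsP (q t : word) : reduced q -> reduced t ->
  exists q0 t1 de, [/\ q = q0 ++ de, t = t1 ++ de & reduced (q0 ++ winv t1)].
Proof.
move=> rq rt; have := @lcpP (winv q) (winv t).
rewrite !reduced_winv => /(_ rq rt) [al [t0 [p0 [e1 e2 h]]]].
exists (winv t0), (winv p0), (winv al).
by split; rewrite ?winvK // -winv_cat -?e1 -?e2 winvK.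
Qed.

End Words.

(** * Partial actions of words on the vertices *)

Section Automata.
Variable S : finType.
Notation letter := (S * bool)%type.
Notation word := (seq letter).

(** As [step] is a function of a vertex and a signed letter, reducedness of the labelling is built
    in. Edges are forgotten; only the partial action of words is kept. *)
Record automaton := Automaton {
  vtx : Type;
  step : vtx -> letter -> option vtx;
  stepV : forall x a y, step x a = Some y -> step y (linv a) = Some x }.

Variable A : automaton.
Implicit Types (x y z : vtx A) (u v w p q s t c : word).

Fixpoint act x w : option (vtx A) :=
  if w is a :: w' then if step x a is Some y then act y w' else None else Some x.

Definition walk x w y := act x w = Some y.

Lemma walk_nil x y : walk x [::] y <-> x = y.
Proof. by split=> [[]|->]. Qed.

Lemma walk_refl x : walk x [::] x. Proof. by []. Qed.

Lemma walk_cat x u v z : walk x (u ++ v) z <-> exists2 y, walk x u y & walk y v z.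
Proof.
elim: u x => [|a u IH] x; first by split=> [h|[y [<-] h]] //; exists x.
rewrite /walk /=; case: (step x a) => [y|]; first exact: IH.
by split=> // -[].
Qed.

Lemma walk_catI x u v y z : walk x u y -> walk y v z -> walk x (u ++ v) z.
Proof. by move=> h1 h2; apply/walk_cat; exists y. Qed.

Lemma walk_det x w y z : walk x w y -> walk x w z -> y = z.
Proof. by rewrite /walk => -> []. Qed.

Lemma walk_step x a y : walk x [:: a] y <-> step x a = Some y.
Proof. by rewrite /walk /=; case: (step x a) => //= b; split. Qed.

Lemma walk_cons x a w z : walk x (a :: w) z <-> exists2 y, step x a = Some y & walk y w z.
Proof.
rewrite -cat1s walk_cat; split=> -[y h1 h2]; exists y => //; exact/walk_step.
Qed.

Lemma walk_rcons x a w z : walk x (rcons w a) z <-> exists2 y, walk x w y & walk y [:: a] z.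
Proof. by rewrite -cats1 walk_cat. Qed.

Lemma walk_inv x w y : walk x w y -> walk y (winv w) x.
Proof.
elim: w x => [|l u IH] x; first by move/walk_nil=> ->.
move/walk_cons=> [c h1 h2]; rewrite winv_cons; apply/walk_rcons; exists c; first exact: IH.
by apply/walk_step/stepV.
Qed.

Lemma walk_invE x w y : walk y (winv w) x -> walk x w y.
Proof. by move/walk_inv; rewrite winvK. Qed.

Lemma walk_catl x u v y z : walk x u y -> walk x (u ++ v) z -> walk y v z.
Proof. by move=> h /walk_cat[y' h']; rewrite (walk_det h h'). Qed.

Lemma walk_catr x u v y z : walk y v z -> walk x (u ++ v) z -> walk x u y.
Proof. by move=> /walk_inv h /walk_cat[y' h' /walk_inv h'']; rewrite (walk_det h h''). Qed.

Lemma walk_invl x y z u v : walk x u y -> walk x v z -> walk y (winv u ++ v) z.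
Proof. by move=> /walk_inv h; apply: walk_catI. Qed.

Lemma walk_reduce x w y : walk x w y -> walk x (reduce w) y.
Proof.
elim: w x => //= a w IH x /walk_cons[z h1 /IH].
case e: (reduce w) => [|b r] /=; first by move/walk_nil => <-; apply/walk_step.
case: eqP => [eb|_] h2; last by apply/walk_cons; exists z.
by move: h2; rewrite eb => /walk_cons[z']; rewrite (stepV h1) => -[<-].
Qed.

(* A stand-in for lying in one orbit of label-preserving automorphisms: only the implication from
   the orbit relation to [eqv] is needed, to see that inequivalent vertices give rise to pieces. *)
Definition eqv x y := forall w,
  (act x w = None <-> act y w = None) /\ (walk x w x <-> walk y w y).

Lemma eqv_refl x : eqv x x. Proof. by []. Qed.

Lemma eqv_sym x y : eqv x y -> eqv y x.
Proof. by move=> h w; have [h1 h2] := h w; split; apply: iff_sym. Qed.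

Lemma eqv_trans x y z : eqv x y -> eqv y z -> eqv x z.
Proof.
move=> h1 h2 w; have [a b] := h1 w; have [c d] := h2 w.
by split; [apply: iff_trans a c | apply: iff_trans b d].
Qed.

Lemma eqv_walk x x' w y : eqv x x' -> walk x w y -> exists y', walk x' w y'.
Proof.
move=> h; have [[_ h1] _] := h w; rewrite /walk.
by case: (act x' w) h1 => [y'|] h1; [exists y'|rewrite h1].
Qed.

Lemma eqv_walks x x' u v y y' : eqv x x' -> walk x u y -> walk x v y ->
  walk x' u y' -> walk x' v y'.
Proof.
move=> h h1 /walk_inv h2 h1'.
have /(proj2 (h _))/walk_cat[y'' h3 h4] : walk x (u ++ winv v) x by apply: walk_catI h1 h2.
by apply: walk_invE; rewrite (walk_det h1' h3).
Qed.

Lemma eqv_move x x' w y y' : eqv x x' -> walk x w y -> walk x' w y' -> eqv y y'.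
Proof.
move=> h h1 h2 v; split.
  have [h3 _] := h (w ++ v);
    have e u1 u2 (a b : vtx A) : walk a u1 b -> act a (u1 ++ u2) = act b u2.
    move=> k; case eb: (act b u2) => [c|]; first exact: walk_catI k eb.
    case ea: (act a _) => [c|] //.
    by have := walk_catl k (ea : walk a (u1 ++ u2) c); rewrite /walk eb.
  by rewrite -(e _ _ _ _ h1) -(e _ _ _ _ h2).
have [_ h3] := h (w ++ v ++ winv w).
have e a b : walk a w b -> (walk b v b <-> walk a (w ++ v ++ winv w) a).
  move=> k; split=> [k'|].
    by apply: (walk_catI k); apply: (walk_catI k'); apply: walk_inv.
  by move/(walk_catl k); apply: walk_catr; move/walk_inv: k.
by rewrite (e _ _ h1) (e _ _ h2).
Qed.

Lemma eqv_moveV x x' w y y' : eqv y y' -> walk x w y -> walk x' w y' -> eqv x x'.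
Proof. by move=> h /walk_inv h1 /walk_inv h2; apply: eqv_move h h1 h2. Qed.

(* The last clause says that the vertices of the cycle are pairwise distinct. *)
Definition simple y c := [/\ c <> [::], reduced c, walk y c y &
  forall c1 c2 c3 z, c = c1 ++ c2 ++ c3 -> c3 <> [::] ->
    walk y c1 z -> walk z c2 z -> c2 = [::] ].

Definition geod x w := exists2 y, walk x w y & forall e, walk x e y -> size w <= size e.

(** The empty word counts as a piece everywhere, so that pieces are closed under subwords and a
    missing side is a degenerate piece. *)
Definition piece x w := reduced w /\
  (w = [::] \/ exists x' y', ~ eqv x x' /\ walk x' w y').

(** What a kind of side must satisfy to survive when a closed path is cut into subpaths and freely
    cancelled. *)
Definition side_pred (K : vtx A -> word -> Prop) :=
  [/\ forall x, K x [::], forall x w, K x w -> reduced w &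
      forall x y a b c, K x (a ++ b ++ c) -> walk x a y -> K y b].

Lemma geod_side : side_pred geod.
Proof.
split.
- by move=> x; exists x.
- move=> x w [y h1 h2]; apply/negP => /negP /nreducedP[u [a [v e]]].
  have := h2 (u ++ v); rewrite e !size_cat /= => h; suff: false by [].
  move: h1; rewrite e => /walk_cat[z k1 /walk_cons[z1 k2 /walk_cons[z2 k3 k4]]].
  move: k3; rewrite (stepV k2) => -[k3]; subst z2.
  have := h (walk_catI k1 k4); lia.
- move=> x y a b c [z h1 h2] ha; move/(walk_catl ha)/walk_cat: (h1) => [z' hb hc].
  exists z' => // e he; have := h2 (a ++ e ++ c); rewrite !size_cat => h.
  have := h (walk_catI ha (walk_catI he hc)); lia.
Qed.

Lemma piece_side : side_pred piece.
Proof.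
split.
- by move=> x; split=> //; left.
- by move=> x w [].
- move=> x y a b c [r h] ha; split; first exact: reduced_infix r.
  case: h => [|[x' [z [ne h]]]].
    by case: b {r} => [|l b]; [left | move/(congr1 size); rewrite !size_cat /=; lia].
  case/walk_cat: h => y' ha' /walk_cat[z' hb _].
  right; exists y', z'; split=> // e; apply: ne; exact: eqv_moveV e ha ha'.
Qed.

Lemma geod_inv x w y : geod x w -> walk x w y -> geod y (winv w).
Proof.
move=> [y' h1 h2] /(walk_det h1) e; subst y'; exists x; first exact: walk_inv.
by move=> e /walk_inv /h2; rewrite !size_winv.
Qed.

Lemma piece_inv x w y : piece x w -> walk x w y -> piece y (winv w).
Proof.
move=> [r h] hp; split; first by rewrite reduced_winv.
case: h => [->|[x' [y' [ne h]]]]; first by left.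
right; exists y', x'; split; last exact: walk_inv.
by move=> e; apply: ne; apply: eqv_moveV e hp h.
Qed.

Lemma pieceI x x' w y : reduced w -> ~ eqv x x' -> walk x' w y -> piece x w.
Proof. by move=> r n h; split=> //; right; exists x', y. Qed.

Lemma piece_reduce x x' w y : ~ eqv x x' -> walk x' w y -> piece x (reduce w).
Proof. by move=> n /walk_reduce h; apply: pieceI n h; apply: reduced_reduce. Qed.

(* [sides x ks W]: the path [W] from [x] splits into consecutive sides of the kinds [ks]. *)
Fixpoint sides x (ks : seq (vtx A -> word -> Prop)) W : Prop :=
  if ks is K :: ks' then
    exists w W' y, [/\ W = w ++ W', K x w, walk x w y & sides y ks' W']
  else W = [::].

Fixpoint side_preds (ks : seq (vtx A -> word -> Prop)) : Prop :=
  if ks is K :: ks' then side_pred K /\ side_preds ks' else True.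

Lemma sides_nil x ks : side_preds ks -> sides x ks [::].
Proof.
by elim: ks x => //= K ks IH x [[h _ _] /IH h']; exists [::], [::], x.
Qed.

Lemma cat_split u v (u' v' : word) : u ++ v = u' ++ v' ->
  (exists d, u' = u ++ d /\ v = d ++ v') \/ (exists d, u = u' ++ d /\ v' = d ++ v).
Proof.
elim: u u' => [|a u IH] u'; first by move=> /= ->; left; exists u'.
case: u' => [|b u'] /=; first by move=> <-; right; exists (a :: u).
by case=> -> /IH [[d [-> ->]]|[d [-> ->]]]; [left | right]; exists d.
Qed.

Lemma sides_prefix x ks W1 W2 : side_preds ks -> sides x ks (W1 ++ W2) -> sides x ks W1.
Proof.
elim: ks x W1 => [|K ks IH] x W1 /=; first by case: W1.
move=> [sK hks] [w [W' [y [e hw hp hs]]]].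
have [[d [e1 e2]]|[d [e1 e2]]] := cat_split e.
  have hp' : walk x (W1 ++ d) y by rewrite -e1.
  case/walk_cat: hp' => z hz _; exists W1, [::], z; split; rewrite ?cats0 //.
    by case: sK => _ _ /(_ x x [::] W1 d); apply; rewrite // -e1.
  exact: sides_nil.
exists w, d, y; split=> //; apply: IH => //; by rewrite -e2.
Qed.

Lemma sides_suffix x ks W1 W2 y : side_preds ks -> sides x ks (W1 ++ W2) ->
  walk x W1 y -> sides y ks W2.
Proof.
elim: ks x W1 y => [|K ks IH] x W1 y /=; first by case: W1.
move=> [sK hks] [w [W' [y' [e hw hp hs]]]] h1.
have [[d [e1 e2]]|[d [e1 e2]]] := cat_split e.
  rewrite e1 in hp; move/(walk_catl h1): (hp) => hd.
  exists d, W', y'; split=> //.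
  by case: sK => _ _ /(_ x y W1 d [::]); apply; rewrite // cats0 -e1.
rewrite e2 in hs; rewrite e1 in h1; move/(walk_catl hp): h1 => hd.
exists [::], W2, y; split=> //; last exact: (IH _ _ _ hks hs hd).
by case: sK => h _ _.
Qed.

(** Sides are reduced, so a cancelling pair never lies inside one side. It straddles a junction, and
    the shortened sides are of the same kinds. *)
Lemma sides_cancel x ks W1 a W2 : side_preds ks ->
  sides x ks (W1 ++ a :: linv a :: W2) -> sides x ks (W1 ++ W2).
Proof.
elim: ks x W1 => [|K ks IH] x W1 /=; first by case: W1.
move=> [sK hks] [w [W' [y [e hw hp hs]]]].
have [[d [e1 e2]]|[d [e1 e2]]] := cat_split e; last first.
  exists w, (d ++ W2), y; split=> //; first by rewrite e1 catA.
  by apply: IH => //; rewrite -e2.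
case: d e1 e2 => [|b d] e1.
  rewrite cats0 in e1; subst w => /= e2; exists W1, W2, y; split=> //.
  by rewrite -e2 in hs; apply: (IH _ [::] hks hs).
case=> eb; subst b; case: d e1 => [|b d] e1; last first.
  case=> eb; exfalso; move: eb e1 => <- e1.
  case: sK => _ /(_ x w hw); rewrite e1 => r _.
  have /= : reduced (a :: linv a :: d) by exact: reduced_catr r.
  by rewrite /noncan eqxx.
move=> /= e2; rewrite e1 in hp; case/walk_cat: (hp) => z hz /walk_step hz'.
exists W1, W2, z; split=> //.
  by case: sK => _ _ /(_ x x [::] W1 [:: a]); apply; rewrite // -e1.
rewrite -e2 -cat1s in hs; apply: (sides_suffix hks hs).
exact/walk_step/stepV.
Qed.

(** Remove a cancelling pair if there is one; otherwise pass to a proper closed subpath, which is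
    reduced and nonempty. The length drops until the path is simple, and its sides are parts of the
    original ones. *)
Lemma sides_extract x ks W : side_preds ks -> sides x ks W -> walk x W x ->
  reduce W <> [::] -> exists y c, simple y c /\ sides y ks c.
Proof.
move=> hks; have [n] := ubnP (size W); elim: n x W => // n IH x W hn hs hp ne.
case r: (reduced W); last first.
  move/negbT/nreducedP: r => [u [a [v e]]]; subst W.
  apply: (IH x (u ++ v)).
  - by move: hn; rewrite !size_cat /=; lia.
  - exact: sides_cancel hs.
  - case/walk_cat: hp => z h1 /walk_cons[z1 h2 /walk_cons[z2]].
    by rewrite (stepV h2) => -[<-]; apply: walk_catI.
  - by rewrite reduce_cancel in ne.
have W0 : W <> [::] by move=> e; apply: ne; rewrite e.
case: (classic (simple x W)) => [h|nsimple]; first by exists x, W.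
have [c1 [c2 [c3 [z [eW h3 h1 h2 hne]]]]] : exists c1 c2 c3 z,
    [/\ W = c1 ++ c2 ++ c3, c3 <> [::], walk x c1 z, walk z c2 z & c2 <> [::]].
  apply: NNPP => h; apply: nsimple; split=> // c1 c2 c3 z e1 e2 e3 e4.
  by apply: NNPP => e5; apply: h; exists c1, c2, c3, z.
apply: (IH z c2) => //.
- by move: hn; rewrite eW !size_cat; case: c3 h3 {eW} => //= *; lia.
- rewrite eW in hs; move/(sides_suffix hks): hs => /(_ _ h1); exact: sides_prefix.
- by rewrite reduce_id //; rewrite eW in r; apply: reduced_infix r.
Qed.

End Automata.

(** * Small cancellation *)

Section SmallCancellation.
Variable S : finType.
Notation letter := (S * bool)%type.
Notation word := (seq letter).

(** The interface to the labelled graph. By [sc_read] every cancelling pair is a closed path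
    somewhere, so free cancellation and relators can be treated alike. *)
Record scgraph := SCGraph {
  sca :> automaton S;
  screl : word -> Prop;
  sc_read : forall a : letter, exists x y : vtx sca, walk x [:: a] y;
  sc_fin : forall x : vtx sca, exists l : seq (vtx sca), forall w y, walk x w y -> List.In y l;
  sc_rel : forall r, screl r -> exists x : vtx sca, walk x r x;
  sc_simple : forall (y : vtx sca) c, simple y c -> screl c;
  sc_piece : forall (y z : vtx sca) c1 w c2, simple y (c1 ++ w ++ c2) -> walk y c1 z ->
    piece z w -> 6 * size w < size (c1 ++ w ++ c2) }.

Variable G : scgraph.
Implicit Types (x y z : vtx G) (u v w p q s t c : word).
Notation geqG := (Defs.geq (screl G)).

Lemma geod_half y z c1 w c2 : simple y (c1 ++ w ++ c2) -> walk y c1 z -> geod z w ->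
  2 * size w <= size (c1 ++ w ++ c2).
Proof.
move=> [_ _ hy _] h1 [z' h2 /(_ (winv c1 ++ winv c2))].
rewrite !size_cat !size_winv => h.
suff: size w <= size c1 + size c2 by lia.
apply: h; apply: (walk_catI (walk_inv h1)); apply: walk_inv.
by move: hy => /(walk_catl h1)/(walk_catl h2).
Qed.

Definition side (k : bool) := if k then @geod S G else @piece S G.
(** In sixths of a simple cycle. *)
Definition weight (k : bool) := if k then 3 else 1.

Lemma side_ok k : side_pred (side k).
Proof. by case: k; [exact: geod_side | exact: piece_side]. Qed.

Lemma sides_ok ks : side_preds (map side ks).
Proof. by elim: ks => //= k ks IH; split=> //; apply: side_ok. Qed.

(** The term [count negb ks] records the strict inequality that each piece contributes. *)
Lemma sides_bound ks y z c1 W c2 : simple y (c1 ++ W ++ c2) -> walk y c1 z ->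
  sides z (map side ks) W ->
  6 * size W + count negb ks <= sumn (map weight ks) * size (c1 ++ W ++ c2).
Proof.
elim: ks z c1 W => [|k ks IH] z c1 W hc h1 /=; first by move=> ->.
move=> [w [W' [z' [eW hk hw hs]]]]; subst W.
have hc' : simple y ((c1 ++ w) ++ W' ++ c2) by rewrite !catA in hc *.
have := IH _ _ _ hc' (walk_catI h1 hw) hs.
have hw' : 6 * size w + ~~ k <= weight k * size (c1 ++ w ++ W' ++ c2).
  have hc2 : simple y (c1 ++ w ++ W' ++ c2) by rewrite !catA in hc *.
  case: k hk => /= hk; last by have := sc_piece hc2 h1 hk; lia.
  by have := geod_half hc2 h1 hk; lia.
move: hw'; rewrite -!catA !size_cat; nia.
Qed.

Lemma sides_trivial ks x W : sides x (map side ks) W -> walk x W x ->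
  sumn (map weight ks) <= 6 -> has negb ks -> reduce W = [::].
Proof.
move=> hs hp hw; rewrite has_count => hn; apply: NNPP => ne.
have [y [c [hc hcs]]] := sides_extract (sides_ok ks) hs hp ne.
have hc' : simple y ([::] ++ c ++ [::]) by rewrite /= cats0.
have := sides_bound hc' (walk_refl y) hcs; rewrite /= cats0.
have : 0 < size c by case: hc; case: (c).
nia.
Qed.

(* One geodesic has at most half and three pieces have less than half of a cycle. *)
Lemma geod_piece3 x y z y' p s1 s2 s3 :
  geod x p -> piece y s1 -> piece x s2 -> piece y' s3 ->
  walk x p y -> walk y s1 z -> walk x s2 y' -> walk y' s3 z ->
  reduce (p ++ s1) = reduce (s2 ++ s3).
Proof.
move=> hp h1 h2 h3 pp p1 p2 p3.
apply/reduce_triv; rewrite winv_cat -catA.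
apply: (@sides_trivial [:: true; false; false; false] x) => //=.
  exists p, (s1 ++ winv s3 ++ winv s2), y; split=> //.
  exists s1, (winv s3 ++ winv s2), z; split=> //.
  exists (winv s3), (winv s2), y'; split=> //; [exact: piece_inv p3|exact: walk_inv|].
  exists (winv s2), [::], x; rewrite cats0; split=> //; [exact: piece_inv p2|exact: walk_inv].
apply: (walk_catI pp); apply: (walk_catI p1); apply: (walk_catI (walk_inv p3)).
exact: walk_inv.
Qed.

(** A subword must be geodesic from every vertex where it can be read; one that can be read nowhere
    is unconstrained. *)
Definition locgeod u := forall u1 p u2 x y, u = u1 ++ p ++ u2 -> walk x p y -> geod x p.

Lemma locgeod_geod u1 p u2 x y : locgeod (u1 ++ p ++ u2) -> walk x p y -> geod x p.
Proof. by move=> h; apply: h. Qed.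

Lemma locgeod_infix u1 p u2 : locgeod (u1 ++ p ++ u2) -> locgeod p.
Proof.
move=> h a q b x y e hp; apply: (h (u1 ++ a) q (b ++ u2) x y) => //.
by rewrite e -!catA.
Qed.

Lemma locgeod_catl u v : locgeod (u ++ v) -> locgeod u.
Proof. by move=> h; apply: (@locgeod_infix [::] u v). Qed.

Lemma locgeod_catr u v : locgeod (u ++ v) -> locgeod v.
Proof. by move=> h; apply: (@locgeod_infix u v [::]); rewrite cats0. Qed.

Lemma locgeod_rcons u a : locgeod (rcons u a) -> locgeod u.
Proof. by rewrite -cats1; apply: locgeod_catl. Qed.

Lemma locgeod_reduced u : locgeod u -> reduced u.
Proof.
move=> h; apply/negP => /negP /nreducedP[u1 [a [v e]]].
have [x [y hxy]] := sc_read G a.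
have hp : walk x ([:: a] ++ [:: linv a]) x.
  exact: walk_catI hxy (walk_inv hxy).
have [z hz /(_ [::])] := h u1 [:: a; linv a] v x x e hp.
by rewrite -(walk_det hp hz) => /(_ (walk_refl x)).
Qed.

Lemma nlocgeodP u : ~ locgeod u -> exists u1 p u2 x y e,
  [/\ u = u1 ++ p ++ u2, walk x p y, walk x e y & size e < size p].
Proof.
move=> h; apply: NNPP => k; apply: h => u1 p u2 x y eu hp; exists y => // e he.
rewrite leqNgt; apply/negP => lt; apply: k; exists u1, p, u2, x, y, e; split=> //.
Qed.

Lemma geq_ctx a b u v : geqG u v -> geqG (a ++ u ++ b) (a ++ v ++ b).
Proof.
elim=> {u v} [w|u v _ h|u v w _ h1 _ h2|u v c|u v r hr].
- exact: geq_refl.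
- exact: geq_sym.
- exact: geq_trans h1 h2.
- rewrite -!catA /= !catA -(catA (a ++ u)); exact: geq_free.
- rewrite -!catA !(catA a); exact: geq_rel.
Qed.

Lemma geq_cat u u' v v' : geqG u u' -> geqG v v' -> geqG (u ++ v) (u' ++ v').
Proof.
move=> h1 h2; apply: (geq_trans (w2 := u' ++ v)).
  exact: (geq_ctx [::] v h1).
by have := geq_ctx u' [::] h2; rewrite !cats0.
Qed.

Lemma geq_catl a u v : geqG u v -> geqG (a ++ u) (a ++ v).
Proof. exact/geq_cat/geq_refl. Qed.

Lemma geq_catr b u v : geqG u v -> geqG (u ++ b) (v ++ b).
Proof. by move=> h; apply: geq_cat h _; apply: geq_refl. Qed.

Lemma geq_invr u : geqG (u ++ winv u) [::].
Proof.
elim/last_ind: u => [|u a IH]; first exact: geq_refl.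
rewrite winv_rcons cat_rcons; apply: geq_trans IH; exact: geq_free.
Qed.

Lemma geq_invl u : geqG (winv u ++ u) [::].
Proof. by rewrite -{2}(winvK u); apply: geq_invr. Qed.

Lemma geq_cancell a u v : geqG (a ++ u) (a ++ v) -> geqG u v.
Proof.
move/(geq_catl (winv a)); rewrite !catA => h.
apply: geq_trans (geq_trans h _).
  by apply: geq_sym; apply: (geq_catr u (geq_invl a)).
exact: (geq_catr v (geq_invl a)).
Qed.

Lemma geq_cancelr b u v : geqG (u ++ b) (v ++ b) -> geqG u v.
Proof.
move/(geq_catr (winv b)); rewrite -!catA => h.
have e w : geqG (w ++ b ++ winv b) w.
  by rewrite -[X in geqG _ X]cats0; apply: geq_catl; apply: geq_invr.
exact: geq_trans (geq_sym (e u)) (geq_trans h (e v)).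
Qed.

Lemma geq_movel a u v : geqG (a ++ u) v -> geqG u (winv a ++ v).
Proof.
move=> h; apply: (@geq_cancell a); apply: geq_trans h _; rewrite catA; apply: geq_sym.
exact: (geq_catr v (geq_invr a)).
Qed.

Lemma geq_mover b u v : geqG (u ++ b) v -> geqG u (v ++ winv b).
Proof.
move=> h; apply: (@geq_cancelr b); apply: geq_trans h _; rewrite -catA; apply: geq_sym.
by rewrite -[X in geqG _ X]cats0; apply: geq_catl; apply: geq_invl.
Qed.

(** Cancelling pairs and closed subpaths are removed until only simple cycles remain, and these are
    relators. *)
Lemma loop_geq x w : walk x w x -> geqG w [::].
Proof.
have [n] := ubnP (size w); elim: n x w => // n IH x w hn hp.
case: (eqVneq w [::]) => [->|/eqP w0]; first exact: geq_refl.
case r: (reduced w); last first.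
  move/negbT/nreducedP: r => [u [a [v e]]]; subst w.
  apply: geq_trans (geq_free _ u v a) (IH x _ _ _).
    by move: hn; rewrite !size_cat /=; lia.
  case/walk_cat: hp => z h1 /walk_cons[z1 h2 /walk_cons[z2]].
  by rewrite (stepV h2) => -[<-]; apply: walk_catI.
case: (classic (simple x w)) => [/sc_simple h|ns].
  by have := geq_rel [::] [::] h; rewrite /= cats0.
have [c1 [c2 [c3 [z [eW h3 h1 h2 hne]]]]] : exists c1 c2 c3 z,
    [/\ w = c1 ++ c2 ++ c3, c3 <> [::], walk x c1 z, walk z c2 z & c2 <> [::]].
  apply: NNPP => h; apply: ns; split=> // c1 c2 c3 z e1 e2 e3 e4.
  by apply: NNPP => e5; apply: h; exists c1, c2, c3, z.
have l2 : geqG c2 [::].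
  apply: (IH z) => //; move: hn; rewrite eW !size_cat; case: c3 h3 {eW} => //= *; lia.
rewrite eW; apply: geq_trans (geq_ctx c1 c3 l2) (IH x _ _ _).
  by move: hn; rewrite eW !size_cat; case: c2 hne {eW h2 l2} => //= *; lia.
by apply: (walk_catI h1); move: hp; rewrite eW => /(walk_catl h1)/(walk_catl h2).
Qed.

Lemma walks_geq x y u v : walk x u y -> walk x v y -> geqG u v.
Proof.
move=> hu hv; apply: (@geq_cancelr (winv v)).
apply: geq_trans (geq_sym (geq_invr v)).
by apply: (@loop_geq x); apply: walk_catI hu (walk_inv hv).
Qed.

End SmallCancellation.

(** * Strips *)

Section Strips.
Variable S : finType.
Notation letter := (S * bool)%type.
Notation word := (seq letter).
Variable G : scgraph S.
Implicit Types (x y z : vtx G) (u v w p q s t c : word).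

(* [wstrip n u v st]: a strip of cost [n] with sides [u] and [v], read from left to right, is in
   state [st]. [Eq]: both sides have reached the same point. [Cell x y t p q]: both sides run in one
   copy of a component, which they entered at [x] and [y], where [t] is the label of a path from [x]
   to [y] shared with the previous copy, and have read [p] and [q] there. The cost counts cells and
   the lengths of these paths; strips of minimal cost are the ones without degenerate cells. *)
Inductive state := Eq | Cell of vtx G & vtx G & word & word & word.

Inductive wstrip : nat -> word -> word -> state -> Prop :=
| wstrip_nil : wstrip 0 [::] [::] Eq
| wstrip_both n u v a : wstrip n u v Eq -> wstrip n (rcons u a) (rcons v a) Eq
| wstrip_start n u v x : wstrip n u v Eq -> wstrip n.+1 u v (Cell x x [::] [::] [::])
| wstrip_top n u v x y t p q a x' : wstrip n u v (Cell x y t p q) -> walk x (rcons p a) x' ->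
    wstrip n (rcons u a) v (Cell x y t (rcons p a) q)
| wstrip_bot n u v x y t p q a y' : wstrip n u v (Cell x y t p q) -> walk y (rcons q a) y' ->
    wstrip n u (rcons v a) (Cell x y t p (rcons q a))
| wstrip_close n u v x y t p q z : wstrip n u v (Cell x y t p q) -> walk x p z -> walk y q z ->
    wstrip n u v Eq
| wstrip_shift n u v x y t p q x1 y1 t' x' y' : wstrip n u v (Cell x y t p q) ->
    walk x p x1 -> walk y q y1 -> walk x1 t' y1 -> reduced t' -> walk x' t' y' ->
    wstrip (n + (size t').+1) u v (Cell x' y' t' [::] [::]).

(* The current vertices of the two sides. *)
Definition cur st x1 y1 :=
  if st is Cell x y t p q then walk x p x1 /\ walk y q y1 else False.
Definition rung n u v x1 y1 := exists2 st, cur st x1 y1 & wstrip n u v st.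

Lemma wstrip_cell n u v x y t p q : wstrip n u v (Cell x y t p q) ->
  [/\ walk x t y, reduced t, exists x1, walk x p x1 & exists y1, walk y q y1].
Proof.
move e: (Cell x y t p q) => st h.
elim: h x y t p q e => //.
- move=> {}n {}u {}v x h _ _ _ _ _ _ [-> -> -> -> ->]; split=> //; by exists x.
- move=> {}n {}u {}v x y t p q a x' h IH hp _ _ _ _ _ [-> -> -> -> ->].
  by have [h1 h2 h3 h4] := IH _ _ _ _ _ erefl; split=> //; exists x'.
- move=> {}n {}u {}v x y t p q a x' h IH hp _ _ _ _ _ [-> -> -> -> ->].
  by have [h1 h2 h3 h4] := IH _ _ _ _ _ erefl; split=> //; exists x'.
- move=> {}n {}u {}v x y t p q x1 y1 t' x' y' h IH h1 h2 h3 h4 h5 _ _ _ _ _ [-> -> -> -> ->].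
  by split=> //; [exists x' | exists y'].
Qed.

Lemma wstrip_split n u v x y t p q : wstrip n u v (Cell x y t p q) ->
  exists u0 v0, [/\ u = u0 ++ p, v = v0 ++ q & wstrip n u0 v0 (Cell x y t [::] [::])].
Proof.
move e: (Cell x y t p q) => st h.
elim: h x y t p q e => //.
- move=> {}n {}u {}v x h _ _ _ _ _ _ [-> -> -> -> ->].
  by exists u, v; rewrite !cats0; split=> //; apply: wstrip_start.
- move=> {}n {}u {}v x y t p q a x' h IH hp _ _ _ _ _ [-> -> -> -> ->].
  by have [u0 [v0 [-> -> h3]]] := IH _ _ _ _ _ erefl; exists u0, v0; rewrite rcons_cat.
- move=> {}n {}u {}v x y t p q a x' h IH hp _ _ _ _ _ [-> -> -> -> ->].
  by have [u0 [v0 [-> -> h3]]] := IH _ _ _ _ _ erefl; exists u0, v0; rewrite rcons_cat.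
- move=> {}n {}u {}v x y t p q x1 y1 t' x' y' h IH h1 h2 h3 h4 h5 _ _ _ _ _ [-> -> -> -> ->].
  exists u, v; rewrite !cats0; split=> //; exact: wstrip_shift h h1 h2 h3 h4 h5.
Qed.

Lemma wstrip_origin n u v x y t : wstrip n u v (Cell x y t [::] [::]) ->
  [/\ t = [::], x = y & exists2 n', n = n'.+1 & wstrip n' u v Eq] \/
  (exists n' a b, [/\ n = n' + (size t).+1, rung n' u v a b & walk a t b]).
Proof.
move e: (Cell x y t [::] [::]) => st h; case: h e => //.
- by move=> {}n {}u {}v {}x h [-> -> ->]; left; split=> //; exists n.
- by move=> {}n {}u {}v x0 y0 t0 p q a _ _ _ [_ _ _]; case: p.
- by move=> {}n {}u {}v x0 y0 t0 p q a _ _ _ [_ _ _ _]; case: q.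
- move=> {}n {}u {}v x0 y0 t0 p q x1 y1 t' x' y' h h1 h2 h3 h4 h5 [-> -> ->].
  right; exists n, x1, y1; split=> //; exists (Cell x0 y0 t0 p q) => //.
Qed.

Lemma wstrip_word n u v m : wstrip n u v Eq -> wstrip n (u ++ m) (v ++ m) Eq.
Proof.
elim: m u v => [|a m IH] u v h; first by rewrite !cats0.
by rewrite -!cat_rcons; apply: IH; apply: wstrip_both.
Qed.

Lemma rung_start n u v x : wstrip n u v Eq -> rung n.+1 u v x x.
Proof. by move=> h; exists (Cell x x [::] [::] [::]); [split | apply: wstrip_start]. Qed.

Lemma rung_top n u v x y p x' : rung n u v x y -> walk x p x' -> rung n (u ++ p) v x' y.
Proof.
elim: p u x => [|a p IH] u x h; first by move/walk_nil => <-; rewrite cats0.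
move/walk_cons=> [z /walk_step hz hp]; rewrite -cat_rcons; apply: IH hp.
case: h => [[//|x0 y0 t q r]] /= [h1 h2] h3.
have h4 : walk x0 (rcons q a) z by apply/walk_rcons; exists x.
by exists (Cell x0 y0 t (rcons q a) r) => //; apply: wstrip_top h3 h4.
Qed.

Lemma rung_bot n u v x y q y' : rung n u v x y -> walk y q y' -> rung n u (v ++ q) x y'.
Proof.
elim: q v y => [|a q IH] v y h; first by move/walk_nil => <-; rewrite cats0.
move/walk_cons=> [z /walk_step hz hp]; rewrite -cat_rcons; apply: IH hp.
case: h => [[//|x0 y0 t p r]] /= [h1 h2] h3.
have h4 : walk y0 (rcons r a) z by apply/walk_rcons; exists y.
by exists (Cell x0 y0 t p (rcons r a)) => //; apply: wstrip_bot h3 h4.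
Qed.

Lemma rung_shift n u v x y t x' y' : rung n u v x y -> walk x t y -> reduced t -> walk x' t y' ->
  rung (n + (size t).+1) u v x' y'.
Proof.
case=> [[//|x0 y0 t0 p q]] /= [h1 h2] h3 ht rt ht'.
exists (Cell x' y' t [::] [::]); first by split.
exact: wstrip_shift h3 h1 h2 ht rt ht'.
Qed.

Lemma rung_close n u v x : rung n u v x x -> wstrip n u v Eq.
Proof. by case=> [[//|x0 y0 t0 p q]] /= [h1 h2] h3; apply: wstrip_close h3 h1 h2. Qed.

(** The whole current cell is moved to the equivalent place, back to its entrance, at no extra cost.
    Hence in a strip of minimal cost a shift never leads to an equivalent place. *)
Lemma rung_eqv n u v x y t x' y' : rung n u v x y -> eqv x x' -> walk x t y -> walk x' t y' ->
  rung n u v x' y'.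
Proof.
case=> [[//|x0 y0 t0 p q]] /= [h1 h2] h3 e ht ht'.
have [h0 rt0 _ _] := wstrip_cell h3.
have [x0' hx0'] := eqv_walk e (walk_inv h1).
have e0 : eqv x0 x0' := eqv_move e (walk_inv h1) hx0'.
have h1' : walk x0' p x' by apply: walk_invE.
have [y0' h0'] := eqv_walk e0 h0.
have h2' : walk y0' q y'.
  apply: (walk_catl h0'); apply: (eqv_walks e0 _ _ (walk_catI h1' ht')).
    exact: walk_catI h1 ht.
  exact: walk_catI h0 h2.
have [u0 [v0 [-> -> h5]]] := wstrip_split h3.
apply: (rung_bot _ h2'); apply: (rung_top _ h1').
case: (wstrip_origin h5) => [[et exy [n' -> h6]]|[n' [a [b [-> h6 h7]]]]].
  by move: h0'; rewrite et => /walk_nil <-; apply: rung_start.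
exact: rung_shift h6 h7 rt0 h0'.
Qed.

Lemma reduce_lcp (al t0 p0 : word) : reduce (winv (al ++ t0) ++ al ++ p0) = reduce (winv t0 ++ p0).
Proof.
rewrite winv_cat -catA; apply: reduce_congr; rewrite catA -reduce_catl reduce_invl //.
Qed.

Lemma reduce_lcs (q0 t1 de : word) : reduce ((q0 ++ de) ++ winv (t1 ++ de)) = reduce (q0 ++ winv
  t1).
Proof.
rewrite winv_cat -catA; apply: reduce_congr; rewrite catA -reduce_catl reduce_invr //.
Qed.

(** A contractible last cell is a tree: the top runs along the rung and then together with the
    bottom. The previous copy can thus be closed on the rung, and the cell disappears. *)
Lemma wstrip_inessential_close n u v x y t p q z : wstrip n u v (Cell x y t p q) ->
  walk x p z -> walk y q z -> reduced p -> reduced q -> reduce p = reduce (t ++ q) ->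
  exists2 m, m < n & wstrip m u v Eq.
Proof.
move=> h hp hq rp rq e; have [hxy rt _ _] := wstrip_cell h.
have [u0 [v0 [-> -> h5]]] := wstrip_split h.
case: (wstrip_origin h5) => [[et exy [n' -> h6]]|[n' [a [b [-> h6 h7]]]]].
  move: e; rewrite et /= !reduce_id // => <-.
  by exists n' => //; apply: wstrip_word.
have [al [t0 [p0 [et ep r0]]]] := lcpP rt rp; subst t p.
have eq' : q = winv t0 ++ p0.
  rewrite -(reduce_id rq) -(reduce_id r0) -(reduce_lcp al).
  by rewrite -(reduce_movel (esym e)).
case/walk_cat: h7 => a' ha hb; subst q; rewrite !catA.
exists n'; first by lia.
apply: wstrip_word; apply: (@rung_close _ _ _ a').
by apply: (rung_bot _ (walk_inv hb)); apply: (rung_top h6 ha).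
Qed.

(** A contractible cell between two rungs is a tree with four ends and a middle segment [m], which
    is common either to the two sides or to the two rungs. In both cases the cell can be omitted. *)
Lemma wstrip_inessential_shift n u v x y t p q x1 y1 t' x' y' : wstrip n u v (Cell x y t p q) ->
  walk x p x1 -> walk y q y1 -> walk x1 t' y1 -> walk x' t' y' -> reduced p -> reduced q ->
    reduced t' ->
  reduce (p ++ t') = reduce (t ++ q) ->
  exists2 m, m < n + (size t').+1 & rung m u v x' y'.
Proof.
move=> h hp hq ht' hx' rp rq rt' e; have [hxy rt _ _] := wstrip_cell h.
have [u0 [v0 [-> -> h5]]] := wstrip_split h.
have [al [t0 [p0 [et ep r0]]]] := lcpP rt rp.
have [q0 [t1 [de [eq et' r1]]]] := lcsP rq rt'.
have e' : winv t0 ++ p0 = q0 ++ winv t1.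
  rewrite -(reduce_id r0) -(reduce_id r1) -(reduce_lcp al) -(reduce_lcs _ _ de) -et -ep -eq -et'.
  rewrite (reduce_congr _ (reduce_mover e)) -!catA catA -reduce_catl reduce_invl //.
move: hx'; rewrite et' => /walk_cat[xi hxi hde].
have [[m [eq0 ep0]]|[m [et0 et1]]] := cat_split e'.
- (* the top and the bottom of the cell share the segment m *)
  have h6 : exists2 n', n' < n & wstrip n' (u0 ++ al) (v0 ++ winv t0) Eq.
    case: (wstrip_origin h5) => [[et2 exy [n' -> h6]]|[n' [a [b [-> h6 h7]]]]].
      exists n' => //; move: et; rewrite et2; case: (al) => //; case: (t0) => //.
      by rewrite !cats0.
    exists n'; first by lia.
    move: h7; rewrite et => /walk_cat[a' ha hb].
    apply: (@rung_close _ _ _ a').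
    by apply: (rung_bot _ (walk_inv hb)); apply: (rung_top h6 ha).
  case: h6 => n' hn' h6; exists n'.+1; first by lia.
  rewrite ep eq eq0 ep0 !catA; apply: (rung_bot _ hde).
  apply: (rung_top _ (walk_inv hxi)).
  by apply: rung_start; apply: wstrip_word.
(* the two rungs share the segment m *)
case: (wstrip_origin h5) => [[et2 exy [n' en h6]]|[n' [a [b [-> h6 h7]]]]].
  have [eal et00] : al = [::] /\ t0 = [::].
    by move: et; rewrite et2; case: (al) => //=; case: (t0).
  have [eq0 em] : q0 = [::] /\ m = [::].
    by move: et0; rewrite et00; case: (q0) => //=; case: (m).
  exists n'.+1; first by lia.
  rewrite em /= in et1; rewrite ep eq eq0 eal /= -et1.
  by apply: (rung_bot _ hde); apply: (rung_top _ (walk_inv hxi)); apply: rung_start.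
have et0' : t0 = winv m ++ winv q0 by rewrite -winv_cat -et0 winvK.
have et1' : t1 = winv p0 ++ winv m by rewrite -winv_cat -et1 winvK.
move: h7; rewrite et et0' => /walk_cat[a' ha] /walk_cat[b' hb hb'].
move: hxi; rewrite et1' => /walk_cat[x2 hx2 hx2'].
exists (n' + (size (winv m)).+1).
  by rewrite !size_cat; lia.
rewrite ep eq !catA; apply: (rung_bot _ hde); apply: (rung_top _ (walk_invE hx2)).
apply: (rung_shift _ hb _ hx2').
  by apply: (rung_bot _ (walk_invE hb')); apply: (rung_top h6 ha).
by move: rt; rewrite et et0' => /reduced_infix.
Qed.

End Strips.

Arguments Eq {S G}.

(** * Strips of minimal cost *)

Section GoodStrips.
Variable S : finType.
Notation letter := (S * bool)%type.
Notation word := (seq letter).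
Variable G : scgraph S.
Implicit Types (x y z : vtx G) (u v w p q s t c : word).
Notation state := (state G).
Notation wstrip := (@wstrip S G).

(* Completed cells are not contractible in their copy, consecutive copies differ, and the corners of
   a cell are reduced. *)
Inductive gstrip : word -> word -> state -> Prop :=
| gstrip_nil : gstrip [::] [::] Eq
| gstrip_both u v a : gstrip u v Eq -> gstrip (rcons u a) (rcons v a) Eq
| gstrip_start u v x : gstrip u v Eq -> gstrip u v (Cell x x [::] [::] [::])
| gstrip_top u v x y t p q a x' : gstrip u v (Cell x y t p q) -> walk x (rcons p a) x' ->
    reduced (winv t ++ rcons p a) -> gstrip (rcons u a) v (Cell x y t (rcons p a) q)
| gstrip_bot u v x y t p q a y' : gstrip u v (Cell x y t p q) -> walk y (rcons q a) y' ->
    reduced (t ++ rcons q a) -> gstrip u (rcons v a) (Cell x y t p (rcons q a))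
| gstrip_close u v x y t p q z : gstrip u v (Cell x y t p q) -> walk x p z -> walk y q z ->
    reduce p <> reduce (t ++ q) -> gstrip u v Eq
| gstrip_shift u v x y t p q x1 y1 t' x' y' : gstrip u v (Cell x y t p q) ->
    walk x p x1 -> walk y q y1 -> walk x1 t' y1 -> walk x' t' y' -> ~ eqv x1 x' ->
    reduced (p ++ t') -> reduced (t' ++ winv q) -> reduce (p ++ t') <> reduce (t ++ q) ->
    gstrip u v (Cell x' y' t' [::] [::]).

(** For an open cell only the current vertices are prescribed. A competing strip may have entered
    its copy elsewhere. *)
Definition minimal n u v st :=
  if st is Eq then forall m, wstrip m u v Eq -> n <= m
  else forall m x1 y1, cur st x1 y1 -> rung m u v x1 y1 -> n <= m.

Lemma wstrip_rung n u v x y t p q x1 y1 : wstrip n u v (Cell x y t p q) ->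
  walk x p x1 -> walk y q y1 -> rung n u v x1 y1.
Proof. by move=> h h1 h2; exists (Cell x y t p q). Qed.

Lemma reduced_late_exit t p a : reduced t -> reduced (winv t ++ p) -> reduced (rcons p a) ->
  (p = [::] -> forall t1, t <> a :: t1) -> reduced (winv t ++ rcons p a).
Proof.
move=> rt rp ra h; case: (eqVneq p [::]) => [ep|/eqP np].
  subst p; case: t rt rp h => [|b t] rt rp h; first by [].
  rewrite winv_cons reduced_cat_cons -winv_cons reduced_winv rt /= andbT /noncan linvK.
  by apply/eqP => e; apply: (h erefl t); rewrite e.
rewrite -cats1; apply: reduced_overlap np rp _; by rewrite cats1.
Qed.

Lemma gstrip_cell u v x y t p q : gstrip u v (Cell x y t p q) ->
  [/\ walk x t y, exists x1, walk x p x1, exists y1, walk y q y1, piece x t &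
    reduced (winv t ++ p) /\ reduced (t ++ q)].
Proof.
move e: (Cell x y t p q) => st h.
elim: h x y t p q e => //.
- move=> {}u {}v x h _ _ _ _ _ _ [-> -> -> -> ->].
  by split=> //; [exists x | exists x | have [k _ _] := piece_side G; apply: k].
- move=> {}u {}v x y t p q a x' h IH hp r _ _ _ _ _ [-> -> -> -> ->].
  by have [h1 h2 h3 h4 [h5 h6]] := IH _ _ _ _ _ erefl; split=> //; exists x'.
- move=> {}u {}v x y t p q a x' h IH hp r _ _ _ _ _ [-> -> -> -> ->].
  by have [h1 h2 h3 h4 [h5 h6]] := IH _ _ _ _ _ erefl; split=> //; exists x'.
- move=> {}u {}v x y t p q x1 y1 t' x' y' h IH h1 h2 h3 h4 ne r1 r2 _ _ _ _ _ _ [-> -> -> -> ->].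
  split=> //; [by exists x' | by exists y' | |].
    apply: (@pieceI _ _ x' x1 t' y1) => //; first exact: reduced_catr r1.
    by move/eqv_sym.
  by rewrite !cats0 reduced_winv; split; apply: reduced_catr r1.
Qed.

(** Every violated condition of [gstrip] allows a cheaper strip: at an unreduced corner a letter can
    be read in the neighbouring copy, which shortens the rung, and a contractible cell or an
    equivalent next copy saves a cell. *)
Theorem wstrip_gstrip n u v st : wstrip n u v st -> reduced u -> reduced v -> minimal n u v st ->
  gstrip u v st.
Proof.
elim=> {n u v st}.
- by move=> *; apply: gstrip_nil.
- move=> n u v a h IH ru rv hm; apply: gstrip_both; apply: IH.
  + by move: ru; rewrite -cats1 => /reduced_catl.
  + by move: rv; rewrite -cats1 => /reduced_catl.
  + by move=> m hm'; apply: hm; apply: wstrip_both.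
- move=> n u v x h IH ru rv hm; apply: gstrip_start; apply: IH => // m hm'.
  by have := hm m.+1 x x; rewrite ltnS; apply => //; apply: rung_start.
- move=> n u v x y t p q a x' h IH hp ru rv hm.
  have ru0 : reduced u by move: ru; rewrite -cats1 => /reduced_catl.
  have [x1 h1 h2] := (proj1 (walk_rcons x a p x') hp).
  have hg : gstrip u v (Cell x y t p q).
    apply: IH => // m x2 y2 /= [k1 k2] k3; apply: (hm m x' y2) => //.
    by rewrite -cats1; apply: (rung_top k3); rewrite (walk_det k1 h1).
  have [u0 [v0 [eu ev h0]]] := wstrip_split h.
  have [hxy _ [y1 hy1] [rt _] [r1 _]] := gstrip_cell hg.
  apply: (gstrip_top hg hp); apply: reduced_late_exit => //.
    by move: ru; rewrite eu -cats1 -catA cats1 => /reduced_catr.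
  move=> ep t1 et; subst p; rewrite cats0 in eu; subst u0 v t.
  case: (wstrip_origin h0) => [[//]|[n' [b [c [en h6 h7]]]]].
  move: h7 => /= /walk_cons[b' /walk_step hb hc].
  move/walk_nil: h1 => ?; subst x1.
  have ht1 : walk x' t1 y by apply: (walk_catl h2); rewrite cat1s.
  have rt1 : reduced t1 by move: rt; rewrite -cat1s => /reduced_catr.
  (* The letter [a] is read in the previous copy; the rung shrinks to [t1]. *)
  have := rung_bot (rung_shift (rung_top h6 hb) hc rt1 ht1) hy1.
  rewrite cats1 => /hm => /(_ (conj hp hy1)); rewrite en /=; lia.
- move=> n u v x y t p q a y' h IH hq ru rv hm.
  have rv0 : reduced v by move: rv; rewrite -cats1 => /reduced_catl.
  have [y1 h1 h2] := (proj1 (walk_rcons y a q y') hq).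
  have hg : gstrip u v (Cell x y t p q).
    apply: IH => // m x2 y2 /= [k1 k2] k3; apply: (hm m x2 y') => //.
    by rewrite -cats1; apply: (rung_bot k3); rewrite (walk_det k2 h1).
  have [u0 [v0 [eu ev h0]]] := wstrip_split h.
  have [hxy [x1 hx1] _ [rt _] [_ r2]] := gstrip_cell hg.
  apply: (gstrip_bot hg hq); rewrite -[t]winvK; apply: reduced_late_exit;
    rewrite ?reduced_winv ?winvK //.
    by move: rv; rewrite ev -cats1 -catA cats1 => /reduced_catr.
  move=> eq t1 et; subst q; rewrite cats0 in ev; subst v0 u.
  have {}et : t = rcons (winv t1) (linv a) by rewrite -winv_cons -et winvK.
  subst t; move/walk_nil: h1 => ?; subst y1.
  case: (wstrip_origin h0) => [[]|[n' [b [c [en h6 h7]]]]]; first by case: (winv t1).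
  move/walk_rcons: h7 => [c' hc /walk_inv hc']; rewrite /winv /= /rev /= linvK in hc'.
  have ht1 : walk x (winv t1) y'.
    move/walk_rcons: hxy => [c2 k1 /walk_inv]; rewrite /winv /= /rev /= linvK => k2.
    by rewrite (walk_det h2 k2).
  have rt1 : reduced (winv t1) by move: rt; rewrite -cats1 => /reduced_catl.
  have := rung_top (rung_shift (rung_bot h6 hc') hc rt1 ht1) hx1.
  rewrite cats1 => /hm => /(_ (conj hx1 hq)); rewrite en size_rcons /=; lia.
- move=> n u v x y t p q z h IH h1 h2 ru rv hm; have [u0 [v0 [eu ev h0]]] := wstrip_split h.
  apply: (gstrip_close _ h1 h2).
    apply: IH => // m x1 y1 [k1 k2] k3; apply: hm; apply: (@rung_close _ _ _ _ _ z).
    by rewrite -{1}(walk_det k1 h1) -(walk_det k2 h2).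
  move=> e; rewrite eu in ru; rewrite ev in rv.
  have [m hlt /hm] := wstrip_inessential_close h h1 h2 (reduced_catr ru) (reduced_catr rv) e.
  by rewrite leqNgt hlt.
- move=> n u v x y t p q x1 y1 t' x' y' h IH h1 h2 h3 rt' h4 ru rv hm.
  have hr : rung n u v x1 y1 by apply: wstrip_rung h h1 h2.
  have hg : gstrip u v (Cell x y t p q).
    apply: IH => // m x2 y2 [k1 k2] k3.
    have := rung_shift k3; rewrite (walk_det k1 h1) (walk_det k2 h2) => /(_ _ _ _ h3 rt' h4).
    by move/hm => /(_ (conj (walk_refl _) (walk_refl _))); rewrite leq_add2r.
  have {}hm m : rung m u v x' y' -> n + (size t').+1 <= m.
    by apply: hm; split; apply: walk_refl.
  have [u0 [v0 [eu ev h0]]] := wstrip_split h.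
  have [hxy _ _ [rt _] [rl1 rl2]] := gstrip_cell hg.
  have rp : reduced p by exact: reduced_catr rl1.
  have rq : reduced q by exact: reduced_catr rl2.
  have rr0 x2 y2 p1 q1 : walk x p1 x2 -> walk y q1 y2 -> rung n (u0 ++ p1) (v0 ++ q1) x2 y2.
    by move=> k1 k2; apply: (rung_bot _ k2); apply: (rung_top _ k1); apply: (wstrip_rung h0).
  apply: (gstrip_shift hg h1 h2 h3 h4).
  + move=> e; have := hm n (rung_eqv hr e h3 h4); lia.
  + apply: NNPP => /negP /(nreduced_junction rp rt')[p1 [a [t1 [ep et]]]]; subst p t' u v.
    move/walk_rcons: h1 => [x2 k1 k2].
    move/walk_cons: h3 => [x3 /walk_step k3 k4].
    have ex : x3 = x2 by apply: (walk_det k3); apply: (walk_inv k2).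
    subst x3; move/walk_cons: h4 => [x4 /walk_step /walk_inv k5 k6].
    rewrite /winv /= /rev /= linvK in k5.
    (* The copy is left before the last letter [a] of the top, which is then read in the next
       copy. *)
    have := rung_top (rung_shift (rr0 _ _ _ _ k1 h2) k4 _ k6) k5.
    rewrite -catA cats1 => k7.
    have /k7/hm : reduced t1 by move: rt'; rewrite -cat1s => /reduced_catr.
    rewrite /=; lia.
  + apply: NNPP => /negP; rewrite -reduced_winv winv_cat winvK => /(nreduced_junction rq).
    rewrite reduced_winv => /(_ rt')[q1 [a [t1 [eq et]]]].
    have {}et : t' = rcons (winv t1) a by rewrite -(winvK t') et winv_cons linvK.
    subst q t' u v.
    move/walk_rcons: h2 => [y2 k1 k2].
    move/walk_rcons: h3 => [y3 k3 k4].
    have ey : y3 = y2 by apply: (walk_det (walk_inv k4)); apply: (walk_inv k2).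
    subst y3; move/walk_rcons: h4 => [y4 k5 k6].
    have := rung_bot (rung_shift (rr0 _ _ _ _ h1 k1) k3 _ k5) k6.
    rewrite -catA cats1 => k7.
    have /k7/hm : reduced (winv t1) by move: rt'; rewrite -cats1 => /reduced_catl.
    rewrite size_rcons; lia.
  + move=> e.
    have [m hlt /hm] := wstrip_inessential_shift h h1 h2 h3 h4 rp rq rt' e.
    lia.
Qed.

Lemma wstrip_minimal n u v st : wstrip n u v st -> exists m st',
  [/\ wstrip m u v st', minimal m u v st' &
   if st is Eq then st' = Eq else forall x y, cur st x y -> cur st' x y].
Proof.
case: st => [|x y t p q] h.
  have [m [hm1 hm2]] := least_nat_ex (P := fun m => wstrip m u v Eq) h.
  by exists m, Eq.
have [hxy _ [x1 h1] [y1 h2]] := wstrip_cell h.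
have [m [[st hst hm1] hm2]] := least_nat_ex (P := fun m => rung m u v x1 y1) (wstrip_rung h h1 h2).
exists m, st; split=> //.
  case: st hst hm1 => [//|x0 y0 t0 p0 q0] /= [k1 k2] _ m' x2 y2 [k3 k4].
  by rewrite (walk_det k3 k1) (walk_det k4 k2); apply: hm2.
move=> x2 y2 /= [k1 k2]; rewrite (walk_det k1 h1) (walk_det k2 h2); exact: hst.
Qed.

Definition strip_eq u v := exists n, wstrip n u v Eq.
Definition strip_rung u v x y := exists n, rung n u v x y.

Lemma gstrip_of_eq u v : strip_eq u v -> reduced u -> reduced v -> gstrip u v Eq.
Proof.
move=> [n /wstrip_minimal[m [st [h hm e]]]] ru rv; rewrite -e in h hm *.
exact: wstrip_gstrip h ru rv hm.
Qed.

Lemma gstrip_of_rung u v x y : strip_rung u v x y -> reduced u -> reduced v ->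
  exists2 st, cur st x y & gstrip u v st.
Proof.
move=> [n [st hc /wstrip_minimal[m [st' [h hm e]]]]] ru rv.
exists st'; last exact: wstrip_gstrip h ru rv hm.
by case: st hc e => [//|x0 y0 t p q] hc e; apply: e.
Qed.

End GoodStrips.

(** * Composition of strips *)

Section Transitivity.
Variable S : finType.
Notation letter := (S * bool)%type.
Notation word := (seq letter).
Variable G : scgraph S.
Implicit Types (x y z : vtx G) (u v w p q r s t c : word).
Notation state := (state G).
Notation wstrip := (@wstrip S G).
Notation strip_eq := (@strip_eq S G).
Notation strip_rung := (@strip_rung S G).
Notation gstrip := (@gstrip S G).

Definition flip (st : state) : state :=
  if st is Cell x y t p q then Cell y x (winv t) q p else Eq.

Lemma flipK : involutive flip.
Proof. by case=> //= x y t p q; rewrite winvK. Qed.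

Lemma wstrip_sym n u v st : wstrip n u v st -> wstrip n v u (flip st).
Proof.
elim=> /= {n u v st}.
- exact: wstrip_nil.
- by move=> *; apply: wstrip_both.
- by move=> *; apply: wstrip_start.
- by move=> n u v x y t p q a x' _ h1 h2; apply: wstrip_bot h1 h2.
- by move=> n u v x y t p q a x' _ h1 h2; apply: wstrip_top h1 h2.
- by move=> n u v x y t p q z _ h1 h2 h3; apply: wstrip_close h1 h3 h2.
- move=> n u v x y t p q x1 y1 t' x' y' _ h h1 h2 h3 h4 h5.
  rewrite -(size_winv t').
  apply: (wstrip_shift h h2 h1 (walk_inv h3) _ (walk_inv h5)); by rewrite reduced_winv.
Qed.

Lemma gstrip_sym u v st : gstrip u v st -> gstrip v u (flip st).
Proof.
elim=> /= {u v st}.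
- exact: gstrip_nil.
- by move=> *; apply: gstrip_both.
- by move=> *; apply: gstrip_start.
- by move=> u v x y t p q a x' _ h1 h2 h3; apply: gstrip_bot h1 h2 h3.
- by move=> u v x y t p q a x' _ h1 h2 h3; apply: gstrip_top h1 h2 _; rewrite winvK.
- move=> u v x y t p q z _ h1 h2 h3 ne; apply: (gstrip_close h1 h3 h2) => /esym e.
  by apply: ne; rewrite (reduce_movel e) winvK.
- move=> u v x y t p q x1 y1 t' x' y' _ h h1 h2 h3 h4 ne r1 r2 nf.
  apply: (gstrip_shift h h2 h1 (walk_inv h3) (walk_inv h4)).
  + by move=> e; apply: ne; apply: eqv_moveV e h3 h4.
  + by rewrite -reduced_winv winv_cat winvK.
  + by rewrite -winv_cat reduced_winv.
  + move=> /esym e; apply: nf; rewrite (reduce_congl _ (reduce_movel e)) winvK.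
    rewrite -!catA; apply: reduce_congr; rewrite -[in RHS](cats0 q).
    by apply: reduce_congr; apply: reduce_invl.
Qed.

Lemma strip_eq_sym u v : strip_eq u v -> strip_eq v u.
Proof. by move=> [n /wstrip_sym h]; exists n. Qed.

Lemma strip_rung_sym u v x y : strip_rung u v x y -> strip_rung v u y x.
Proof.
move=> [n [[//|x0 y0 t p q] /= [h1 h2] /wstrip_sym h3]]; exists n.
by exists (Cell y0 x0 (winv t) q p).
Qed.

Lemma strip_eq_nil : strip_eq [::] [::]. Proof. by exists 0; apply: wstrip_nil. Qed.

Lemma strip_eq_both u v m : strip_eq u v -> strip_eq (u ++ m) (v ++ m).
Proof. by move=> [n h]; exists n; apply: wstrip_word. Qed.

Lemma strip_eq_refl u : strip_eq u u. Proof. exact: strip_eq_both u strip_eq_nil. Qed.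

Lemma strip_rung_start u v x : strip_eq u v -> strip_rung u v x x.
Proof. by move=> [n h]; exists n.+1; apply: rung_start. Qed.

Lemma strip_rung_top u v x y p x' : strip_rung u v x y -> walk x p x' -> strip_rung (u ++ p) v x' y.
Proof. by move=> [n h] hp; exists n; apply: (rung_top h). Qed.

Lemma strip_rung_bot u v x y q y' : strip_rung u v x y -> walk y q y' -> strip_rung u (v ++ q) x y'.
Proof. by move=> [n h] hp; exists n; apply: (rung_bot h). Qed.

Lemma strip_rung_shift u v x y s x' y' : strip_rung u v x y -> walk x s y -> walk x' s y' ->
  strip_rung u v x' y'.
Proof.
move=> [n h] /walk_reduce h1 /walk_reduce h2; exists (n + (size (reduce s)).+1).
by apply: (rung_shift h) h1 _ h2; apply: reduced_reduce.
Qed.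

Lemma strip_rung_close u v x : strip_rung u v x x -> strip_eq u v.
Proof. by move=> [n h]; exists n; apply: (rung_close h). Qed.

Lemma gstrip_words u v x y t p q : gstrip u v (Cell x y t p q) ->
  exists u0 v0, u = u0 ++ p /\ v = v0 ++ q.
Proof.
move e: (Cell x y t p q) => st h.
elim: h x y t p q e => //.
- by move=> {}u {}v x h _ ? ? ? p q []; do 3!move=> _; move=> -> ->; exists u, v; rewrite !cats0.
- move=> {}u {}v x y t p q a x' h IH hp rr ? ? ? p' q' []; do 3!move=> _; move=> -> ->.
  by have [u0 [v0 [-> ->]]] := IH _ _ _ _ _ erefl; exists u0, v0; rewrite rcons_cat.
- move=> {}u {}v x y t p q a x' h IH hp rr ? ? ? p' q' []; do 3!move=> _; move=> -> ->.
  by have [u0 [v0 [-> ->]]] := IH _ _ _ _ _ erefl; exists u0, v0; rewrite rcons_cat.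
- move=> {}u {}v x y t p q x1 y1 t' x' y' _ _ _ _ _ _ _ _ _ _ ? ? ? p' q' [].
  by do 3!move=> _; move=> -> ->; exists u, v; rewrite !cats0.
Qed.

(* In the following four definitions two strips share the side [v], and the current vertices of
   their cells are [x1], [y1] and [y2], [z]. Here the two cells lie in the same copy. *)
Definition merged u w x1 y1 y2 z := exists s s' z1,
  [/\ walk y1 s x1, walk y1 s' z1, walk y2 s' z & strip_rung u w x1 z1].

(* The cell with data [t], [p], [q] started inside the other current cell: its boundary along [v]
   is so far a single piece. *)
Definition nested u w t p q y2 z := exists u0 xb,
  [/\ u = u0 ++ p, walk xb (t ++ q) y2 & strip_rung u0 w xb z].

(* The boundary of the cell along [v] consists of two pieces, so the cell cannot be completed. *)
Definition doomed v x t q y1 y2 := exists si o m m' v0,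
  [/\ v = v0 ++ o, piece x si, walk x si m & walk m o y1] /\
  (walk m' o y2 /\ reduce (t ++ q) = reduce (si ++ o)).

Definition glued u v w (st1 st2 : state) : Prop :=
  match st1, st2 with
  | Eq, Eq => strip_eq u w
  | Cell x y t p q, Eq => exists x1 y1, [/\ walk x p x1, walk y q y1 & strip_rung u w x1 y1]
  | Eq, Cell x y t p q => exists x1 y1, [/\ walk x p x1, walk y q y1 & strip_rung u w x1 y1]
  | Cell x y t p q, Cell x' y' t' q' r => exists x1 y1 y2 z,
      [/\ walk x p x1, walk y q y1, walk x' q' y2 & walk y' r z] /\
      ((eqv y1 y2 /\ merged u w x1 y1 y2 z) \/
       (~ eqv y1 y2 /\
         [\/ nested u w t p q y2 z,
             nested w u (winv t') r q' y1 x1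
           | doomed v x t q y1 y2 /\ doomed v y' (winv t') q' y2 y1]))
  end.

Lemma merged_sym u w x1 y1 y2 z : eqv y1 y2 -> merged u w x1 y1 y2 z -> merged w u z y2 y1 x1.
Proof.
move=> e [s [s' [z1 [h1 h2 h3 h4]]]]; have [x2 h5] := eqv_walk e h1.
exists s', s, x2; split=> //; apply: strip_rung_sym.
by apply: (strip_rung_shift h4 (walk_invl h1 h2) (walk_invl h5 h3)).
Qed.

Lemma glued_sym u v w st1 st2 : glued u v w st1 st2 -> glued w v u (flip st2) (flip st1).
Proof.
case: st1 st2 => [|x y t p q] [|x' y' t' q' r] /=.
- exact: strip_eq_sym.
- by move=> [x1 [y1 [h1 h2 /strip_rung_sym h3]]]; exists y1, x1.
- by move=> [x1 [y1 [h1 h2 /strip_rung_sym h3]]]; exists y1, x1.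
move=> [x1 [y1 [y2 [z [[h1 h2 h3 h4] h]]]]]; exists z, y2, y1, x1; split=> //.
case: h => [[e h]|[ne h]]; [left|right]; split; try by [|apply: eqv_sym|move/eqv_sym].
  exact: merged_sym.
rewrite winvK; case: h => [h|h|[h h']]; [by apply: Or32 | by apply: Or31 | by apply: Or33].
Qed.

Lemma glued_symE u v w st1 st2 : glued w v u (flip st2) (flip st1) -> glued u v w st1 st2.
Proof. by move/glued_sym; rewrite !flipK. Qed.

Lemma nested_doomed u v w x t p q y1 y2 z : walk x (t ++ q) y1 -> ~ eqv y1 y2 ->
  nested u w t p q y2 z -> doomed v x t q y1 y2.
Proof.
move=> h ne [u0 [xb [_ h' _]]]; exists (reduce (t ++ q)), [::], y1, y2, v.
rewrite !cats0 reduceK; split=> //; split=> //; last exact: walk_reduce.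
by apply: (piece_reduce _ h') => e; apply: ne; apply: eqv_move e h h'.
Qed.

(** The geodesic [p] faces three pieces: [t3], [si], and the overlap [o], which is a piece because
    the two cells are in inequivalent places. *)
Lemma doomed_trivial v x t q y1 y2 p x1 t3 : doomed v x t q y1 y2 -> ~ eqv y1 y2 -> reduced v ->
  geod x p -> walk x p x1 -> walk x1 t3 y1 -> piece x1 t3 -> reduce (p ++ t3) = reduce (t ++ q).
Proof.
move=> [si [o [m [m' [v0 [[ev h1 h2 h3] [h4 e]]]]]]] ne rv hp h5 h6 h7.
rewrite e; apply: (geod_piece3 hp h7 h1 _ h5 h6 h2 h3).
apply: (@pieceI _ _ m m' o y2) => //; first by move: rv; rewrite ev => /reduced_catr.
by move=> e'; apply: ne; apply: eqv_move e' h3 h4.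
Qed.

Lemma nil_piece x : piece x [::].
Proof. by have [h _ _] := piece_side G; apply: h. Qed.

Lemma glued_top u v w x y t p q st2 a x' : glued u v w (Cell x y t p q) st2 ->
  walk x (rcons p a) x' -> glued (rcons u a) v w (Cell x y t (rcons p a) q) st2.
Proof.
case: st2 => [|x2 y2' t' q' r] /=.
  move=> [x1 [y1 [h1 h2 h3]]] h; exists x', y1; split=> //.
  by rewrite -cats1; apply: (strip_rung_top h3); move: h; rewrite -cats1 => /(walk_catl h1).
move=> [x1 [y1 [y2 [z [[h1 h2 h3 h4] h]]]]] ha; exists x', y1, y2, z; split=> //.
have ha' : walk x1 [:: a] x' by move: ha; rewrite -cats1 => /(walk_catl h1).
case: h => [[e [s [s' [z1 [k1 k2 k3 k4]]]]]|[ne h]]; [left|right]; split=> //.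
  exists (s ++ [:: a]), s', z1; split=> //; first exact: walk_catI k1 ha'.
  by rewrite -cats1; apply: strip_rung_top k4 ha'.
case: h => [[u0 [xb [k1 k2 k3]]]|[u0 [xb [k1 k2 k3]]]|h]; last exact: Or33.
  by apply: Or31; exists u0, xb; rewrite k1 rcons_cat.
by apply: Or32; exists u0, xb; split=> //; rewrite -cats1; apply: strip_rung_bot k3 ha'.
Qed.

Lemma glued_start u v w st2 x : gstrip v w st2 -> glued u v w Eq st2 ->
  glued u v w (Cell x x [::] [::] [::]) st2.
Proof.
case: st2 => [_ h|x2 y2' t' q' r] /=; first by exists x, x; split=> //; apply: strip_rung_start.
move=> /gstrip_cell[hxy _ _ _ _] [y2 [z [h1 h2 h3]]].
exists x, x, y2, z; split=> //.
have hs : walk y2 (winv q' ++ t' ++ r) z := walk_invl h1 (walk_catI hxy h2).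
case: (classic (eqv x y2)) => [e|ne]; [left|right]; split=> //.
  have [z1 hz] := eqv_walk (eqv_sym e) hs.
  exists [::], (winv q' ++ t' ++ r), z1; split=> //; exact: strip_rung_shift h3 hs hz.
by apply: Or31; exists u, y2; rewrite cats0.
Qed.

(** A completed cell is not contractible, so it was neither doomed nor nested in the other cell.
    Either the two cells are merged or the other one is nested in this one. *)
Lemma glued_close u v w x y t p q st2 b : gstrip u v (Cell x y t p q) -> gstrip v w st2 ->
  locgeod G u -> reduced v -> walk x p b -> walk y q b -> reduce p <> reduce (t ++ q) ->
  glued u v w (Cell x y t p q) st2 -> glued u v w Eq st2.
Proof.
move=> hg hg2 lu rv hp hq nf.
have [hxy _ _ _ _] := gstrip_cell hg.
have [u0' [v0' [eu ev]]] := gstrip_words hg.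
have gpp : geod x p by rewrite eu -[p]cats0 in lu; apply: locgeod_geod lu hp.
case: st2 hg2 => [_|x2 y2' t' q' r] /=.
  by move=> [x1 [y1 [h1 h2]]]; rewrite (walk_det h1 hp) (walk_det h2 hq) => /strip_rung_close.
move=> /gstrip_cell[hxy' _ _ _ _] [x1 [y1 [y2 [z [[h1 h2 h3 h4] h]]]]].
have ex1 := walk_det h1 hp; have ey1 := walk_det h2 hq; subst x1 y1.
exists y2, z; split=> //.
have dm : ~ eqv b y2 -> ~ doomed v x t q b y2.
  move=> ne d; apply: nf; rewrite -[p in LHS]cats0.
  exact: (doomed_trivial d ne rv gpp hp (walk_refl b) (nil_piece b)).
case: h => [[e [s [s' [z1 [k1 k2 k3 k4]]]]]|[ne h]].
  exact: strip_rung_shift k4 k2 k3.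
case: h => [hn|[u0 [xb [k1 k2 k3]]]|[h _]].
- by exfalso; apply: (dm ne); apply: (nested_doomed _ (walk_catI hxy hq) ne hn).
- apply: strip_rung_sym; rewrite k1; apply: (strip_rung_top _ h4).
  by apply: (strip_rung_shift k3 k2); apply: walk_catI (walk_inv hxy') h3.
- by exfalso; apply: (dm ne).
Qed.

Lemma glued_shift u v w x y t p q st2 x1 y1 t3 x3 y3 : gstrip u v (Cell x y t p q) ->
  gstrip v w st2 ->
  locgeod G u -> reduced v -> walk x p x1 -> walk y q y1 -> walk x1 t3 y1 -> walk x3 t3 y3 ->
  ~ eqv x1 x3 -> reduced t3 -> reduce (p ++ t3) <> reduce (t ++ q) ->
  glued u v w (Cell x y t p q) st2 -> glued u v w (Cell x3 y3 t3 [::] [::]) st2.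
Proof.
move=> hg hg2 lu rv hp hq ht hx3 n13 rt3 nf.
have [hxy _ _ _ _] := gstrip_cell hg.
have [u0' [v0' [eu ev]]] := gstrip_words hg.
have gpp : geod x p by rewrite eu -[p]cats0 in lu; apply: locgeod_geod lu hp.
case: st2 hg2 => [_|x2 y2' t' q' r] /=.
  move=> [a [b [h1 h2]]]; rewrite (walk_det h1 hp) (walk_det h2 hq) => h3.
  by exists x3, y3; split=> //; apply: strip_rung_shift h3 ht hx3.
move=> /gstrip_cell[hxy' _ _ _ _] [a [b [y2 [z [[h1 h2 h3 h4] h]]]]].
have ex1 := walk_det h1 hp; have ey1 := walk_det h2 hq; subst a b.
exists x3, y3, y2, z; split=> //.
have p31 : piece x3 t3 by apply: (pieceI rt3 _ ht) => /eqv_sym.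
have p13 : piece x1 t3 := pieceI rt3 n13 hx3.
have n13' : ~ eqv y1 y3 by move=> e; apply: n13; apply: eqv_moveV e ht hx3.
have dm : ~ eqv y1 y2 -> ~ doomed v x t q y1 y2.
  by move=> ne d; apply: nf; apply: (doomed_trivial d ne rv gpp hp ht p13).
case: h => [[e [s [s' [z1 [k1 k2 k3 k4]]]]]|[ne h]].
  (* The merged cells separate: the new cell starts inside the cell along [w], hence nested in
     it. *)
  right; split; first by move=> e'; apply: n13'; apply: eqv_trans e (eqv_sym e').
  have [xb hxb] := eqv_walk e (walk_inv ht).
  apply: Or31; exists u, xb; rewrite !cats0; split=> //; first exact: walk_invE.
  apply: (strip_rung_shift k4 (walk_catI ht k2)); exact: walk_catI (walk_invE hxb) k3.
case: h => [hn|[w0 [xb [k1 k2 k3]]]|[h _]].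
- by exfalso; apply: (dm ne); apply: (nested_doomed _ (walk_catI hxy hq) ne hn).
(* The other cell was nested in the one just left. If the new cell is in an equivalent place, the
   strips merge. *)
- case: (classic (eqv y3 y2)) => [e|ne']; [left|right]; split=> //.
    have hy2 : walk y2' (winv t' ++ q') y2 by apply: walk_catI (walk_inv hxy') h3.
    have [xb3 hb3] := eqv_walk (eqv_sym e) (walk_inv hy2).
    have [z1 hz1] := eqv_walk (eqv_sym e) (walk_invl hy2 h4).
    exists (winv t3), (winv (winv t' ++ q') ++ r), z1; split=> //; first exact: walk_inv.
      exact: walk_invl hy2 h4.
    apply: strip_rung_sym; rewrite k1; apply: (@strip_rung_top _ _ xb3);
      last exact: walk_catl hb3 hz1.
    apply: (strip_rung_shift k3 (walk_catI k2 (walk_inv ht))).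
    exact: walk_catI (walk_invE hb3) (walk_inv hx3).
  (* Otherwise both cells are doomed. Each has one piece from the copy just left, [t3] or the
     boundary read so far, and their overlap, still empty, will be the second. *)
  apply: Or33; split.
    by exists t3, [::], y3, y2, v; rewrite !cats0.
  exists (reduce (winv t' ++ q')), [::], y2, y3, v; rewrite !cats0 reduceK.
  have hy2 : walk y2' (winv t' ++ q') y2 by apply: walk_catI (walk_inv hxy') h3.
  split=> //; split=> //; last exact: walk_reduce.
  apply: (piece_reduce _ k2) => e; apply: ne; apply: eqv_sym; exact: eqv_move e hy2 k2.
- by exfalso; apply: (dm ne).
Qed.

Lemma doomed_rcons v x t q y1 y2 a y1' y2' : doomed v x t q y1 y2 ->
  walk y1 [:: a] y1' -> walk y2 [:: a] y2' -> doomed (rcons v a) x t (rcons q a) y1' y2'.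
Proof.
move=> [si [o [m [m' [v0 [[ev h1 h2 h3] [h4 e]]]]]]] k1 k2.
exists si, (rcons o a), m, m', v0; rewrite -!cats1 ev -catA; split; split=> //.
- exact: walk_catI h3 k1.
- exact: walk_catI h4 k2.
- by rewrite !catA; apply: reduce_congl.
Qed.

Lemma glued_joint u v w x y t p q x' y' t' q' r a y1' y2' :
  glued u v w (Cell x y t p q) (Cell x' y' t' q' r) ->
  walk y (rcons q a) y1' -> walk x' (rcons q' a) y2' ->
  glued u (rcons v a) w (Cell x y t p (rcons q a)) (Cell x' y' t' (rcons q' a) r).
Proof.
move=> /= [x1 [y1 [y2 [z [[h1 h2 h3 h4] h]]]]] k1 k2.
have k3 : walk y1 [:: a] y1' by move: k1; rewrite -cats1 => /(walk_catl h2).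
have k4 : walk y2 [:: a] y2' by move: k2; rewrite -cats1 => /(walk_catl h3).
exists x1, y1', y2', z; split=> //.
case: h => [[e [s [s' [z1 [l1 l2 l3 l4]]]]]|[ne h]]; [left|right]; split.
- exact: eqv_move e k3 k4.
- by exists (winv [:: a] ++ s), (winv [:: a] ++ s'), z1; split=> //;
    [exact: walk_invl k3 l1 | exact: walk_invl k3 l2 | exact: walk_invl k4 l3].
- by move=> e; apply: ne; apply: eqv_moveV e k3 k4.
- case: h => [[u0 [xb [l1 l2 l3]]]|[u0 [xb [l1 l2 l3]]]|[d1 d2]].
  + by apply: Or31; exists u0, xb; split=> //; rewrite -cats1 catA; apply: walk_catI l2 k4.
  + by apply: Or32; exists u0, xb; split=> //; rewrite -cats1 catA; apply: walk_catI l2 k3.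
  + by apply: Or33; split; [exact: doomed_rcons d1 k3 k4 | exact: doomed_rcons d2 k4 k3].
Qed.

Lemma glued_joint_top u v w x' y' t' q' r a y2' :
  glued u v w Eq (Cell x' y' t' q' r) -> walk x' (rcons q' a) y2' ->
  glued (rcons u a) (rcons v a) w Eq (Cell x' y' t' (rcons q' a) r).
Proof.
move=> /= [y2 [z [h1 h2 h3]]] k; exists y2', z; split=> //.
by rewrite -cats1; apply: (strip_rung_top h3); move: k; rewrite -cats1 => /(walk_catl h1).
Qed.

(** Induction on the second strip with the first one fixed. The hypotheses treat the moves that
    consume the shared word [v]: there the first strip has to move too, and the outer induction
    supplies them. *)
Lemma glued_bottom u v st1 : gstrip u v st1 -> locgeod G u -> reduced v ->
  (v = [::] -> glued u [::] [::] st1 Eq) ->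
  (forall v0 a w, v = rcons v0 a -> gstrip v0 w Eq -> locgeod G (rcons w a) ->
     glued u v (rcons w a) st1 Eq) ->
  (forall v0 a w x y t p q x', v = rcons v0 a -> gstrip v0 w (Cell x y t p q) -> locgeod G w ->
     walk x (rcons p a) x' -> glued u v w st1 (Cell x y t (rcons p a) q)) ->
  forall w st2, gstrip v w st2 -> locgeod G w -> glued u v w st1 st2.
Proof.
move=> hg lu rv h0 hb ht w st2 h; have hg' := gstrip_sym hg.
elim: h lu rv h0 hb ht hg hg' => {v w st2}.
- by move=> ? ? h0 *; apply: h0.
- by move=> v w a h _ _ _ _ hb _ _ _ lw; apply: hb h lw.
- move=> v w x h IH lu rv h0 hb ht hg hg' lw.
  apply: glued_symE; apply: (glued_start _ hg'); apply: (glued_sym (st2 := Eq)); exact: IH.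
- by move=> v w x y t p q a x' h _ hx _ lu rv h0 hb ht hg hg' lw; apply: ht hx.
- move=> v w x y t p q a x' h IH hx hr lu rv h0 hb ht hg hg' lw.
  apply: glued_symE; apply: glued_top hx.
  by apply: (glued_sym (st2 := Cell x y t p q)); apply: IH => //; apply: locgeod_rcons lw.
- move=> v w x y t p q z h IH h1 h2 ne lu rv h0 hb ht hg hg' lw.
  apply: glued_symE.
  apply: (glued_close (gstrip_sym h) hg' lw rv h2 h1).
    by move/esym => e; apply: ne; rewrite (reduce_movel e) winvK.
  by apply: (glued_sym (st2 := Cell x y t p q)); apply: IH.
- move=> v w x y t p q x1 y1 t' x' y' h IH h1 h2 h3 h4 ne r1 r2 nf lu rv h0 hb ht hg hg' lw.
  apply: glued_symE => /=.
  have hgs := gstrip_sym (gstrip_shift h h1 h2 h3 h4 ne r1 r2 nf).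
  apply: (glued_shift (gstrip_sym h) hg' lw rv h2 h1 (walk_inv h3) (walk_inv h4)).
  + by move=> e; apply: ne; apply: eqv_moveV e h3 h4.
  + by rewrite reduced_winv; apply: reduced_catr r1.
  + move=> /esym e; apply: nf; rewrite (reduce_congl _ (reduce_movel e)) winvK.
    rewrite -!catA; apply: reduce_congr; rewrite -[in RHS](cats0 q).
    by apply: reduce_congr; apply: reduce_invl.
  + by apply: (glued_sym (st2 := Cell x y t p q)); apply: IH.
Qed.

Theorem glued_gstrip u v w st1 st2 : gstrip u v st1 -> gstrip v w st2 -> locgeod G u ->
  reduced v -> locgeod G w ->
  glued u v w st1 st2.
Proof.
move=> h; elim: h w st2 => {u v st1}.
- move=> w st2 h2 lu rv lw.
  apply: (glued_bottom (gstrip_nil G) lu rv _ _ _ h2 lw) => [_|[]|[]] //; exact: strip_eq_nil.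
- move=> u v a h IH w st2 h2 lu rv lw.
  have lu0 := locgeod_rcons lu; have rv0 : reduced v by move: rv; rewrite -cats1 => /reduced_catl.
  apply: (glued_bottom (gstrip_both a h) lu rv _ _ _ h2 lw); first by case: (v).
    move=> v0 b w0 /rcons_inj[<- <-] h2' lw'.
    by have := IH _ _ h2' lu0 rv0 (locgeod_rcons lw'); rewrite /= -!cats1; apply: strip_eq_both.
  move=> v0 b w0 x y t p q x' /rcons_inj[<- <-] h2' lw' hx.
  by apply: glued_joint_top hx; exact: (IH _ _ h2' lu0 rv0 lw').
- move=> u v x h IH w st2 h2 lu rv lw; by apply: glued_start => //; apply: IH.
- move=> u v x y t p q a x' h IH hx hr w st2 h2 lu rv lw.
  by apply: glued_top hx; apply: IH => //; apply: locgeod_rcons lu.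
- move=> u v x y t p q a y' h IH hy hr w st2 h2 lu rv lw.
  have rv0 : reduced v by move: rv; rewrite -cats1 => /reduced_catl.
  apply: (glued_bottom (gstrip_bot h hy hr) lu rv _ _ _ h2 lw); first by case: (v).
    move=> v0 b w0 /rcons_inj[<- <-] h2' lw'.
    apply: glued_symE.
    apply: glued_joint_top hy; apply: (glued_sym (st1 := Cell x y t p q) (st2 := Eq)).
    exact: IH _ _ h2' lu rv0 (locgeod_rcons lw').
  move=> v0 b w0 x2 y2 t2 p2 q2 x' /rcons_inj[<- <-] h2' lw' hx.
  by apply: glued_joint hy hx; exact: (IH _ _ h2' lu rv0 lw').
- move=> u v x y t p q z h IH h1 h2 ne w st2 hg2 lu rv lw.
  by apply: (glued_close h hg2 lu rv h1 h2 ne); apply: IH.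
- move=> u v x y t p q x1 y1 t' x' y' h IH h1 h2 h3 h4 ne r1 r2 nf w st2 hg2 lu rv lw.
  apply: (glued_shift h hg2 lu rv h1 h2 h3 h4 ne (reduced_catr r1) nf); exact: IH.
Qed.

(** Both cells have the vertex [y] on the shared side, so only the merged case of [glued] is
    possible. *)
Lemma strip_rung_trans u v w x y z : locgeod G u -> locgeod G v -> locgeod G w ->
  strip_rung u v x y -> strip_rung v w y z -> strip_rung u w x z.
Proof.
move=> lu lv lw h1 h2;
  have [ru rv rw] := And3 (locgeod_reduced lu) (locgeod_reduced lv) (locgeod_reduced lw).
have [[//|x0 y0 t p q] /= [k1 k2] g1] := gstrip_of_rung h1 ru rv.
have [[//|x0' y0' t' p' q'] /= [k3 k4] g2] := gstrip_of_rung h2 rv rw.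
have [x1 [y1 [y2 [z' [[l1 l2 l3 l4] h]]]]] := glued_gstrip g1 g2 lu rv lw.
move: h; rewrite (walk_det l1 k1) (walk_det l2 k2) (walk_det l3 k3) (walk_det l4 k4).
case=> [[_ [s [s' [z1 [m1 m2 m3 m4]]]]]|[ne]]; last by case: ne; apply: eqv_refl.
by rewrite -(walk_det m2 m3).
Qed.

Lemma strip_eq_rung_trans u v w x y : locgeod G u -> locgeod G v -> locgeod G w ->
  strip_eq u v -> strip_rung v w x y -> strip_rung u w x y.
Proof. by move=> lu lv lw h1; apply: strip_rung_trans => //; apply: strip_rung_start. Qed.

Lemma strip_eq_trans u v w : locgeod G u -> locgeod G v -> locgeod G w -> strip_eq u v ->
  strip_eq v w -> strip_eq u w.
Proof.
move=> lu lv lw h1 h2.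
exact: glued_gstrip (gstrip_of_eq h1 (locgeod_reduced lu) (locgeod_reduced lv)) (gstrip_of_eq h2
  (locgeod_reduced lv) (locgeod_reduced lw))
  lu (locgeod_reduced lv) lw.
Qed.

End Transitivity.

(** * Equality in the group *)

Section WordProblem.
Variable S : finType.
Notation letter := (S * bool)%type.
Notation word := (seq letter).
Variable G : scgraph S.
Implicit Types (x y z : vtx G) (u v w p q r s t c e : word).
Notation geqG := (Defs.geq (screl G)).
Notation strip_eq := (@strip_eq S G).
Notation strip_rung := (@strip_rung S G).

Lemma wstrip_sound n u v (st : state G) : wstrip n u v st ->
  if st is Cell x y t p q then
    forall s x1 y1, walk x p x1 -> walk y q y1 -> walk x1 s y1 -> geqG (u ++ s) v
  else geqG u v.
Proof.
elim=> {n u v st}.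
- exact: geq_refl.
- by move=> n u v a _ IH; rewrite -!cats1; apply: geq_catr.
- move=> n u v x _ IH s x1 y1 /walk_nil <- /walk_nil <- hs.
  apply: geq_trans IH; rewrite -[X in geqG _ X]cats0; apply: geq_catl; exact: loop_geq hs.
- move=> n u v x y t p q a x' _ IH hx s x1 y1 h1 h2 h3; rewrite cat_rcons.
  case/walk_rcons: h1 => [x0 h1 h4]; apply: (IH _ x0 y1) => //.
  exact: walk_catI h4 h3.
- move=> n u v x y t p q a y' _ IH hy s x1 y1 h1 h2 h3; rewrite -cats1.
  case/walk_rcons: h2 => [y0 h2 h4].
  have -> : [:: a] = winv (winv [:: a]) by rewrite winvK.
  apply: geq_mover; rewrite -catA; apply: (IH _ x1 y0) => //.
  exact: walk_catI h3 (walk_inv h4).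
- move=> n u v x y t p q z _ IH h1 h2.
  by have := IH _ _ _ h1 h2 (walk_refl z); rewrite cats0.
- move=> n u v x y t p q x1 y1 t' x' y' _ IH h1 h2 h3 _ h4 s x2 y2 /walk_nil <- /walk_nil <- hs.
  apply: geq_trans (IH _ _ _ h1 h2 h3); apply: geq_catl; exact: walks_geq hs h4.
Qed.

Lemma locgeod_extend n u a x y : size u < n -> locgeod G u -> walk x [:: a] y ->
  exists u', [/\ locgeod G u', strip_rung u u' x y & size u' <= (size u).+1].
Proof.
elim: n u a x y => // n IH u a x y; rewrite ltnS => hn lu ha.
case: (classic (locgeod G (rcons u a))) => [la|/nlocgeodP].
  exists (rcons u a); rewrite size_rcons -cats1; split=> //; rewrite ?cats1 //.
  by rewrite -cats1; apply: strip_rung_bot ha; apply: strip_rung_start; apply: strip_eq_refl.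
move=> [u1 [p [u2 [z [b [e [eu hp he hs]]]]]]].
case/lastP: u2 eu => [|u2 a'] eu; last first.
  move: eu; rewrite -!rcons_cat => /rcons_inj[eu _].
  rewrite eu in lu; have [b' hb' /(_ e)] := locgeod_geod lu hp.
  by rewrite -(walk_det hp hb') => /(_ he); rewrite leqNgt hs.
rewrite cats0 in eu; case/lastP: p eu hp hs => [|p a'] eu hp hs; first by case: (e) hs.
move: eu; rewrite -rcons_cat => /rcons_inj[eu ea]; subst a' u.
case/walk_rcons: hp => [b0 hp hb0].
have iter e2 u0 b2 : locgeod G u0 -> size u0 + size e2 <= size (u1 ++ p) -> walk z e2 b2 ->
    exists u', [/\ locgeod G u', strip_rung u0 u' z b2 & size u' <= size u0 + size e2].
  elim/last_ind: e2 u0 b2 => [|e2 a2 IH2] u0 b2 l0 hsz.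
    by move/walk_nil <-; exists u0; split; rewrite ?addn0 //; apply: strip_rung_start;
      apply: strip_eq_refl.
  case/walk_rcons=> [b1 h1 h2]; rewrite size_rcons in hsz *.
  have [|u3 [l3 w3 s3]] := IH2 u0 b1 l0 _ h1; first by lia.
  have [|u4 [l4 w4 s4]] := IH u3 a2 b1 b2 _ l3 h2; first by lia.
  by exists u4; split=> //; [apply: strip_rung_trans w3 w4 | lia].
have l1 : locgeod G u1 by exact: locgeod_catl lu.
rewrite size_rcons size_cat in hs *.
have [|u' [l' w' s']] := iter e u1 b l1 _ he; first by rewrite size_cat; lia.
exists u'; split=> //; last by lia.
apply: (@strip_rung_shift _ _ _ _ b0 b [:: a]) => //.
apply: strip_rung_trans l1 l' _ w' => //.
by apply: strip_rung_top hp; apply: strip_rung_start; apply: strip_eq_refl.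
Qed.

(* Multiplication of [u0] by the letters of [w], one at a time, passing each time to some locally
   geodesic representative. *)
Inductive evol (u0 : word) : word -> word -> Prop :=
| evol0 : locgeod G u0 -> evol u0 [::] u0
| evolS w u a x y u' : evol u0 w u -> walk x [:: a] y -> locgeod G u' -> strip_rung u u' x y ->
    evol u0 (rcons w a) u'.

Lemma evol_locgeod u0 w u : evol u0 w u -> locgeod G u. Proof. by case. Qed.

Lemma evol_locgeod0 u0 w u : evol u0 w u -> locgeod G u0. Proof. by elim. Qed.

Lemma evol_nil u0 u : evol u0 [::] u -> u = u0.
Proof. by move e: [::] => w h; case: h e => // w0 u1 a x y u2 _ _ _ _; case: (w0). Qed.

Lemma evol_rcons u0 w a u' : evol u0 (rcons w a) u' ->
  exists u x y, [/\ evol u0 w u, walk x [:: a] y & strip_rung u u' x y].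
Proof.
move e: (rcons w a) => w' h; case: h e => [_|w1 u a1 x y u1 h1 h2 h3 h4]; first by case: (w).
by move/rcons_inj=> [-> ->]; exists u, x, y.
Qed.

Lemma evol_exists u0 w : locgeod G u0 -> exists u, evol u0 w u.
Proof.
move=> l0; elim/last_ind: w => [|w a [u h]]; first by exists u0; apply: evol0.
have [x [y hxy]] := sc_read G a.
have [u' [l' h' _]] := locgeod_extend (ltnSn (size u)) (evol_locgeod h) hxy.
by exists u'; apply: evolS h hxy l' h'.
Qed.

Lemma evol_cat u0 w1 w2 u : evol u0 (w1 ++ w2) u ->
  exists2 u1, evol u0 w1 u1 & evol u1 w2 u.
Proof.
elim/last_ind: w2 u => [|w2 a IH] u.
  by rewrite cats0 => h; exists u => //; apply: evol0; apply: evol_locgeod h.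
rewrite -rcons_cat => h; have l := evol_locgeod h.
have [u2 [x [y [h1 h2 h3]]]] := evol_rcons h.
by have [u1 h4 h5] := IH _ h1; exists u1 => //; apply: evolS h5 h2 l h3.
Qed.

Lemma evol_det u0 u0' w u u' : evol u0 w u -> evol u0' w u' -> strip_eq u0 u0' -> strip_eq u u'.
Proof.
elim/last_ind: w u u' => [|w a IH] u u'; first by move=> /evol_nil -> /evol_nil ->.
move=> h h' e; have [l l'] := (evol_locgeod h, evol_locgeod h').
have [u1 [x [y [h1 h2 h3]]]] := evol_rcons h.
have [u2 [x' [y' [h1' h2' h3']]]] := evol_rcons h'.
have e1 := IH _ _ h1 h1' e; have [l1 l2] := (evol_locgeod h1, evol_locgeod h1').
have h4 := strip_rung_shift h3' h2' h2.
have h5 : strip_rung u1 u' x y by apply: strip_eq_rung_trans e1 h4.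
by apply: strip_rung_close; apply: strip_rung_trans (strip_rung_sym h3) h5.
Qed.

(** The rungs for the successive letters of a path compose within one copy. For a closed path the
    resulting rung closes up, which is why relators and cancelling pairs act trivially. *)
Lemma evol_walk u0 w u x y : evol u0 w u -> walk x w y -> strip_rung u0 u x y.
Proof.
move=> h; have l0 := evol_locgeod0 h; elim/last_ind: w u y h => [|w a IH] u y h.
  by move/walk_nil <-; rewrite (evol_nil h); apply: strip_rung_start; apply: strip_eq_refl.
case/walk_rcons=> [b h1 h2]; have l := evol_locgeod h.
have [u1 [x' [y' [k1 k2 k3]]]] := evol_rcons h.
have l1 := evol_locgeod k1; apply: strip_rung_trans (IH _ _ k1 h1) _ => //.
exact: strip_rung_shift k3 k2 h2.
Qed.

Lemma evol_insert u0 a r b x u u' : evol u0 (a ++ r ++ b) u -> evol u0 (a ++ b) u' ->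
  walk x r x -> strip_eq u u'.
Proof.
move=> /evol_cat[u1 h1 /evol_cat[u2 h2 h3]] /evol_cat[u3 h4 h5] hr.
apply: evol_det h3 h5 _.
have [l1 l2 l3] := And3 (evol_locgeod h1) (evol_locgeod h2) (evol_locgeod h4).
apply: strip_eq_trans l2 l1 l3 _ _; first by apply: strip_eq_sym;
  apply: strip_rung_close (evol_walk h2 hr).
exact: evol_det h1 h4 (strip_eq_refl G u0).
Qed.

Lemma evol_geq u0 w w' u u' : geqG w w' -> evol u0 w u -> evol u0 w' u' -> strip_eq u u'.
Proof.
move=> h; elim: h u u' => {w w'} [w|w1 w2 _ IH|w1 w2 w3 _ IH1 _ IH2|a b c|a b r /sc_rel[x hx]] u
  u' h h'.
- exact: evol_det h h' (strip_eq_refl G u0).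
- by apply: strip_eq_sym; apply: IH.
- have [u2 h2] := evol_exists w2 (evol_locgeod0 h).
  by apply: strip_eq_trans (IH1 _ _ h h2) (IH2 _ _ h2 h');
     [exact: evol_locgeod h|exact: evol_locgeod h2|exact: evol_locgeod h'].
- have [x [y hxy]] := sc_read G c.
  apply: (evol_insert (r := [:: c; linv c]) h h' (x := x)).
  exact: walk_catI hxy (walk_inv hxy).
- exact: evol_insert h h' hx.
Qed.

Lemma evol_self w : locgeod G w -> evol [::] w w.
Proof.
elim/last_ind: w => [|w a IH] l; first exact: evol0.
have [x [y hxy]] := sc_read G a.
apply: (evolS (IH (locgeod_rcons l)) hxy l).
by rewrite -cats1; apply: strip_rung_bot hxy; apply: strip_rung_start; apply: strip_eq_refl.
Qed.

(** A locally geodesic word is its own outcome when the empty word is multiplied by its letters. *)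
Theorem geq_strip w w' : geqG w w' -> locgeod G w -> locgeod G w' -> strip_eq w w'.
Proof. by move=> h /evol_self h1 /evol_self h2; apply: evol_geq h h1 h2. Qed.

End WordProblem.

(** * Lengths and positions of cells *)

Section CellGeometry.
Variable S : finType.
Notation letter := (S * bool)%type.
Notation word := (seq letter).
Variable G : scgraph S.
Implicit Types (x y z : vtx G) (u v w p q r s t c e : word).
Notation geqG := (Defs.geq (screl G)).
Notation gstrip := (@gstrip S G).
Notation strip_eq := (@strip_eq S G).

Lemma sides1 k x y w : side k x w -> walk x w y -> sides x [:: side (G := G) k] w.
Proof. by move=> h hw; exists w, [::], y; rewrite cats0. Qed.

Lemma sides_cons k ks x y w W : side k x w -> walk x w y ->
  sides y (map (side (G := G)) ks) W -> sides x (map (side (G := G)) (k :: ks)) (w ++ W).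
Proof. by move=> h hw hs; exists w, W, y. Qed.

Lemma no_reduced_loop ks x y c1 c2 c3 : sides x (map (side (G := G)) ks) (c1 ++ c2 ++ c3) ->
  walk x c1 y -> walk y c2 y -> reduced c2 -> sumn (map weight ks) <= 6 -> has negb ks -> c2 = [::].
Proof.
move=> hs h1 h2 r hw hn; rewrite -(reduce_id r); apply: (sides_trivial (x := y) _ h2 hw hn).
exact: (sides_prefix (sides_ok G ks) (sides_suffix (sides_ok G ks) hs h1)).
Qed.

Lemma geod_infix x a b c y : geod x (a ++ b ++ c) -> walk x a y -> geod y b.
Proof. by have [_ _ h] := geod_side G; apply: h. Qed.

Lemma geod_prefix x b c : geod x (b ++ c) -> geod x b.
Proof. by move=> h; apply: (@geod_infix x [::] b c). Qed.

Lemma geod_suffix x a b y : geod x (a ++ b) -> walk x a y -> geod y b.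
Proof. by move=> h; apply: (@geod_infix x a b [::]); rewrite cats0. Qed.

Lemma geod_reduced x p : geod x p -> reduced p.
Proof. by have [_ h _] := geod_side G; apply: h. Qed.

(* The boundary is a simple cycle unless top and bottom touch, and there the cell can be cut. *)
Lemma cell_length x y x1 y1 t t' p q :
  walk x t y -> walk x p x1 -> walk y q y1 -> walk x1 t' y1 ->
  geod x p -> geod y q -> piece x t -> piece x1 t' ->
  reduced (winv t ++ p) -> reduced (t ++ q) -> reduced (p ++ t') -> reduced (t' ++ winv q) ->
  size p <= 3 * size q.
Proof.
have [n] := ubnP (size p + size q).
elim: n x y x1 y1 t t' p q => // n IH x y x1 y1 t t' p q hn ht hp hq ht' gpp gq pt pt' r1 r2 r3 r4.
case: (eqVneq p [::]) => [->//|/eqP pn].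
case: (eqVneq q [::]) => [eq|/eqP qn].
  exfalso; subst q; move/walk_nil: hq => ey; subst y1.
  have e := geod_piece3 gpp pt' pt (nil_piece y) hp ht' ht (walk_refl y).
  have r : reduced (winv t ++ p ++ t') by apply: reduced_overlap.
  have := reduce_id r; rewrite (reduce_congr _ e) cats0 reduce_invl => /esym/(congr1 size).
  by rewrite !size_cat; case: (p) pn => //=; lia.
have [k1|nk1] := classic (t' = [::] /\ exists p0 q0 a, p = rcons p0 a /\ q = rcons q0 a).
  case: k1 => et' [p0 [q0 [a [ep eq]]]]; subst t' p q; move/walk_nil: ht' => ex; subst y1.
  have [z hz hz'] := (proj1 (walk_rcons _ _ _ _) hp).
  have [z2 hz2 hz2'] := (proj1 (walk_rcons _ _ _ _) hq).
  have ez : z2 = z by apply: walk_det (walk_inv hz2') (walk_inv hz').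
  subst z2; rewrite !size_rcons -!cats1 in hn gpp gq r1 r2 r3 r4 *.
  suff : size p0 <= 3 * size q0 by lia.
  apply: (IH _ _ _ _ t [::] p0 q0 _ ht hz hz2 (walk_refl z)) => //.
  - by lia.
  - exact: geod_prefix gpp.
  - exact: geod_prefix gq.
  - exact: nil_piece.
  - by move: r1; rewrite catA => /reduced_catl.
  - by move: r2; rewrite catA => /reduced_catl.
  - by move: r3; rewrite -catA => /reduced_catl; rewrite cats0.
  - by move: r4; rewrite !cat0s winv_cat => /reduced_catr.
have [k2|nk2] := classic (t = [::] /\ exists p0 q0 a, p = a :: p0 /\ q = a :: q0).
  case: k2 => et [p0 [q0 [a [ep eq]]]]; subst t p q; move/walk_nil: ht => ex; subst y.
  have [z hz hz'] := (proj1 (walk_cons _ _ _ _) hp).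
  have [z2 hz2 hz2'] := (proj1 (walk_cons _ _ _ _) hq).
  move: hz2 hz2'; rewrite hz => -[<-] hz2'; move/walk_step: hz => hz.
  rewrite -(cat1s a p0) -(cat1s a q0) in hn gpp gq r1 r2 r3 r4 *.
  suff : size p0 <= 3 * size q0 by rewrite /=; lia.
  apply: (IH _ _ _ _ [::] t' p0 q0 _ (walk_refl z) hz' hz2' ht') => //.
  - by move: hn => /=; lia.
  - exact: geod_suffix gpp hz.
  - exact: geod_suffix gq hz.
  - exact: nil_piece.
  - exact: (reduced_catr (u := [:: a]) r1).
  - exact: (reduced_catr (u := [:: a]) r2).
  - by move: r3; rewrite -catA => /reduced_catr.
  - by move: r4; rewrite winv_cat catA => /reduced_catl.
have rp := geod_reduced gpp; have rq := geod_reduced gq.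
have j1 : reduced (p ++ t' ++ winv q).
  case: (eqVneq t' [::]) => [et'|/eqP nt']; last exact: reduced_overlap.
  subst t'; case: (boolP (reduced (p ++ [::] ++ winv q))) => // /(nreduced_junction rp).
  rewrite /= reduced_winv => /(_ rq)[p0 [a [q0 [ep eq]]]].
  case: nk1; split=> //; exists p0, (winv q0), a; split=> //.
  by rewrite -(winvK q) eq winv_cons linvK.
have j2 : reduced (winv q ++ winv t ++ p).
  case: (eqVneq t [::]) => [et|/eqP nt]; last first.
    apply: reduced_overlap => //; last by rewrite -winv_cat reduced_winv.
    by move=> e; apply: nt; rewrite -(winvK t) e.
  subst t; case: (boolP (reduced (winv q ++ winv [::] ++ p))) => //.
  move/nreduced_junction; rewrite reduced_winv => /(_ rq rp)[q0 [a [p0 [eq ep]]]].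
  case: nk2; split=> //; exists p0, (winv q0), (linv a); split=> //.
  by rewrite -(winvK q) eq winv_rcons.
have rW : reduced (winv t ++ p ++ t' ++ winv q) by apply: reduced_overlap.
have gq' := geod_inv gq hq; have pti := piece_inv pt ht.
have [hti hqi] := (walk_inv ht, walk_inv hq).
have hW : walk y (winv t ++ p ++ t' ++ winv q) y.
  by apply: walk_catI hti (walk_catI hp (walk_catI ht' hqi)).
case: (classic (simple y (winv t ++ p ++ t' ++ winv q))) => [hc|ns].
  (* With [p] at most half and each rung less than a sixth of the cycle, [q] is more than a
     sixth. *)
  have b1 := sc_piece (c1 := [::]) hc (walk_refl y) pti.
  have b2 := geod_half hc hti gpp.
  have hc3 : simple y ((winv t ++ p) ++ t' ++ winv q) by rewrite -catA.
  have b3 := sc_piece hc3 (walk_catI hti hp) pt'.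
  by move: b1 b2 b3; rewrite /= !size_cat !size_winv; clear; lia.
have [c1 [c2 [c3 [z [eW h3 h1 h2 hne]]]]] : exists c1 c2 c3 z,
    [/\ winv t ++ p ++ t' ++ winv q = c1 ++ c2 ++ c3, c3 <> [::], walk y c1 z,
        walk z c2 z & c2 <> [::]].
  apply: NNPP => h; apply: ns; split=> //.
    by move=> e; apply: pn; case: (p) e => // l p3; case: (winv t).
  by move=> c1 c2 c3 z e1 e2 e3 e4; apply: NNPP => e5; apply: h; exists c1, c2, c3, z.
have rc2 : reduced c2 by move: rW; rewrite eW => /reduced_infix.
have e1 : (winv t ++ p ++ t') ++ winv q = (c1 ++ c2) ++ c3 by rewrite -!catA.
(* Two pieces and a geodesic weigh five, so a closed subpath that avoids [p] or avoids [q] is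
   trivial. The closed subpath [c2] therefore starts on [p] and ends on [q], and the cell is cut
   there into two cells with an empty rung. *)
have s3 : sides y (map (side (G := G)) [:: false; true; false]) (winv t ++ p ++ t').
  by apply: (sides_cons (k := false) pti hti); apply: (sides_cons (k := true) gpp hp);
    apply: (sides1 (k := false) pt' ht').
case: (cat_split e1) => [[d [ec12 eq']]|[d [ec12 _]]]; last first.
  by case: hne; apply: (@no_reduced_loop [:: false; true; false] y z c1 c2 d) => //;
    rewrite catA -ec12.
have h31 : walk z c3 y by move: hW; rewrite eW => /(walk_catl h1)/(walk_catl h2).
have hd : walk y1 d z.
  have : walk y (c1 ++ c2) z by apply: walk_catI h1 h2.
  by rewrite ec12 => /(walk_catl (walk_catI hti (walk_catI hp ht'))).
have e2 : (winv t ++ p) ++ (t' ++ d) = c1 ++ c2 by rewrite ec12 -!catA.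
case: (cat_split e2) => [[d' [ec1 ec2]]|[d' [ec1 ec2]]].
  case: hne; apply: (@no_reduced_loop [:: false; true] x1 z d' c2 c3) => //.
    rewrite catA -ec2 -catA -eq'; apply: (sides_cons (k := false) pt' ht');
      exact: (sides1 (k := true) gq' hqi).
  by move: h1; rewrite ec1 => /(walk_catl (walk_catI hti hp)).
have comp31 c4 d4 : c1 = c4 -> winv t = c4 ++ d4 -> False.
  move=> <- et; apply: h3; have rr : reduced (c3 ++ c1).
    move: j2; rewrite eq' et -!catA => /reduced_catr; rewrite catA => /reduced_catl //.
  have : c3 ++ c1 = [::]; last by case: (c3).
  apply: (@no_reduced_loop [:: true; false] y1 z d (c3 ++ c1) d4) => //.
    rewrite -catA -et catA -eq'; apply: (sides_cons (k := true) gq' hqi);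
      exact: (sides1 (k := false) pti hti).
  exact: walk_catI h31 h1.
case: (cat_split ec1) => [[p1 [ec1' ep]]|[d4 [et _]]]; last first.
  by case: (comp31 c1 d4 erefl et).
case: (eqVneq p1 [::]) => [ep1|/eqP np1].
  by case: (comp31 c1 [::] erefl); rewrite ec1' ep1 !cats0.
have hp1 : walk x p1 z by move: h1; rewrite ec1' => /(walk_catl hti).
have hp2 : walk z d' x1 by move: hp; rewrite ep => /(walk_catl hp1).
have eq : q = winv c3 ++ winv d by rewrite -winv_cat -eq' winvK.
have [hq1 hq2] := (walk_inv h31, walk_inv hd).
have szq : size q = size c3 + size d by rewrite eq size_cat !size_winv.
have szp : size p = size p1 + size d' by rewrite ep size_cat.
have c3n : 0 < size c3 by case: (c3) h3.
have i1 : size p1 <= 3 * size (winv c3).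
  apply: (IH _ _ _ _ t [::] p1 (winv c3) _ ht hp1 hq1 (walk_refl z)) => //.
  - rewrite size_winv; suff : 0 < size d' + size d.
      by move: hn; rewrite szq szp; clear; lia.
    rewrite lt0n addn_eq0; apply/negP => /andP[/nilP ed' /nilP ed].
    apply: hne; rewrite ed' ed cats0 /= in ec2 h2; subst c2.
    have ez : z = x1 by apply/walk_nil; rewrite -ed'.
    apply: (@no_reduced_loop [:: false] z z [::] t' [::]) => //.
    by rewrite cats0 ez; apply: (sides1 (k := false) pt' ht').
  - by rewrite ep in gpp; apply: geod_prefix gpp.
  - by rewrite eq in gq; apply: geod_prefix gq.
  - exact: nil_piece.
  - by move: r1; rewrite ep catA => /reduced_catl.
  - by move: r2; rewrite eq catA => /reduced_catl.
  - by rewrite cats0; move: rp; rewrite ep => /reduced_catl.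
  - by rewrite winvK; move: rq; rewrite eq => /reduced_catl; rewrite reduced_winv.
have i2 : size d' <= 3 * size (winv d).
  apply: (IH _ _ _ _ [::] t' d' (winv d) _ (walk_refl z) hp2 hq2 ht') => //.
  - by rewrite size_winv; move: hn c3n; rewrite szq szp; clear; lia.
  - by rewrite ep in gpp; apply: geod_suffix gpp hp1.
  - by rewrite eq in gq; apply: geod_suffix gq hq1.
  - exact: nil_piece.
  - by move: rp; rewrite ep => /reduced_catr.
  - by move: rq; rewrite eq => /reduced_catr.
  - by move: r3; rewrite ep -catA => /reduced_catr.
  - by rewrite winvK; move: r4; rewrite eq' catA => /reduced_catl.
by move: i1 i2; rewrite !size_winv szq szp; clear; lia.
Qed.

Lemma locgeod_suffix_geod u0 p x x1 : locgeod G (u0 ++ p) -> walk x p x1 -> geod x p.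
Proof. by rewrite -[p in u0 ++ p]cats0; apply: locgeod_geod. Qed.

(** In an open cell one side may have advanced alone, so only the sides before it are compared. *)
Lemma gstrip_length u v st : gstrip u v st -> locgeod G u -> locgeod G v ->
  if st is Cell x y t p q then
    exists u0 v0, [/\ u = u0 ++ p, v = v0 ++ q & size u0 <= 3 * size v0]
  else is_true (size u <= 3 * size v).
Proof.
elim=> {u v st} //.
- by move=> u v a _ IH lu lv; rewrite !size_rcons;
  have := IH (locgeod_rcons lu) (locgeod_rcons lv); lia.
- by move=> u v x _ IH lu lv; exists u, v; rewrite !cats0; split=> //; apply: IH.
- move=> u v x y t p q a x' _ IH _ _ lu lv.
  by have [u0 [v0 [-> -> h]]] := IH (locgeod_rcons lu) lv; exists u0, v0; rewrite rcons_cat.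
- move=> u v x y t p q a y' _ IH _ _ lu lv.
  by have [u0 [v0 [-> -> h]]] := IH lu (locgeod_rcons lv); exists u0, v0; rewrite rcons_cat.
- move=> u v x y t p q z hg IH h1 h2 nf lu lv.
  have [u0 [v0 [eu ev h]]] := IH lu lv.
  have [hxy _ _ pt [r1 r2]] := gstrip_cell hg; rewrite eu in lu; rewrite ev in lv.
  have rp := reduced_catr r1; have rq := reduced_catr r2.
  have := cell_length hxy h1 h2 (walk_refl z) (locgeod_suffix_geod lu h1) (locgeod_suffix_geod lv
    h2) pt
    (nil_piece z) r1 r2.
  rewrite cats0 cat0s reduced_winv => /(_ rp rq) k; rewrite eu ev !size_cat; lia.
- move=> u v x y t p q x1 y1 t' x' y' hg IH h1 h2 h3 h4 ne r3 r4 nf lu lv.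
  have [u0 [v0 [eu ev h]]] := IH lu lv; exists u, v; rewrite !cats0; split=> //.
  have [hxy _ _ pt [r1 r2]] := gstrip_cell hg; rewrite eu in lu; rewrite ev in lv.
  have pt' : piece x1 t' := pieceI (reduced_catr r3) ne h4.
  have := cell_length hxy h1 h2 h3 (locgeod_suffix_geod lu h1) (locgeod_suffix_geod lv h2) pt pt'
    r1 r2 r3 r4.
  by rewrite eu ev !size_cat; lia.
Qed.

Lemma strip_eq_length u v : locgeod G u -> locgeod G v -> strip_eq u v -> size u <= 3 * size v.
Proof. by move=> lu lv h;
  apply: (gstrip_length (gstrip_of_eq h (locgeod_reduced lu) (locgeod_reduced lv))). Qed.

(* Not a piece: at least a sixth of some simple cycle. *)
Definition big_arc x p := exists y c1 c2, [/\ simple y (c1 ++ p ++ c2), walk y c1 x &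
  size (c1 ++ p ++ c2) <= 6 * size p].

Lemma big_arc_eqv x p x' y' : big_arc x p -> walk x' p y' -> eqv x x'.
Proof.
move=> [y [c1 [c2 [hc h1 hs]]]] h; apply: NNPP => ne.
have rp : reduced p by case: hc => _ /reduced_infix.
by have := sc_piece hc h1 (pieceI rp ne h); rewrite ltnNge hs.
Qed.

(** The boundary contains a simple cycle, and the sides other than [p] weigh five with strict
    inequality. More than a sixth of the cycle is left for [p]. *)
Lemma cell_big_arc x y x1 y1 t t' p q :
  walk x t y -> walk x p x1 -> walk y q y1 -> walk x1 t' y1 ->
  geod x p -> geod y q -> piece x t -> piece x1 t' -> reduce (p ++ t') <> reduce (t ++ q) ->
  exists al p' be z, [/\ p = al ++ p' ++ be, walk x al z & big_arc z p'].
Proof.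
move=> ht hp hq ht' gpp gq pt pt' nf.
(* This kind of side remembers the position inside [p], so the extracted cycle shows which part of
   [p] it uses. *)
pose K z w := w = [::] \/ exists al be, p = al ++ w ++ be /\ walk x al z.
have hK : side_pred K.
  split; first by left.
    by move=> z w [->//|[al [be [e _]]]]; move: (geod_reduced gpp); rewrite e => /reduced_infix.
  move=> z z' a b c [e|[al [be [e h]]]] hz.
    by left; case: b e => // l b; case: (a).
  right; exists (al ++ a), (c ++ be); split; last exact: walk_catI h hz.
  by rewrite e -!catA.
have hs : sides x (K :: map (side (G := G)) [:: false; true; false])
    (p ++ t' ++ winv q ++ winv t).
  exists p, (t' ++ winv q ++ winv t), x1; split=> //.
    by right; exists [::], [::]; rewrite cats0.
  apply: (sides_cons (k := false) pt' ht').
  apply: (sides_cons (k := true) (geod_inv gq hq) (walk_inv hq)).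
  exact: (sides1 (k := false) (piece_inv pt ht) (walk_inv ht)).
have hl : walk x (p ++ t' ++ winv q ++ winv t) x.
  exact: walk_catI hp (walk_catI ht' (walk_catI (walk_inv hq) (walk_inv ht))).
have hKs : side_preds (K :: map (side (G := G)) [:: false; true; false]).
  by split=> //; apply: sides_ok.
have [|z [c [hc [w [W [z' [ec hw hwz hW]]]]]]] := sides_extract hKs hs hl.
  by rewrite catA -winv_cat => /reduce_triv.
subst c.
have hc' : simple z (w ++ W ++ [::]) by rewrite cats0.
have b := sides_bound (ks := [:: false; true; false]) hc' hwz hW; rewrite /= cats0 size_cat in b.
case: hw => [ew|[al [be [e h]]]]; first by move: b; rewrite ew /=; lia.
exists al, w, be, z; split=> //; exists z, [::], W; split=> //.
by rewrite /= size_cat; lia.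
Qed.

Lemma gstrip_wstrip u v st : gstrip u v st -> exists n, wstrip n u v st.
Proof.
elim=> {u v st}.
- by exists 0; apply: wstrip_nil.
- by move=> u v a _ [n h]; exists n; apply: wstrip_both.
- by move=> u v x _ [n h]; exists n.+1; apply: wstrip_start.
- by move=> u v x y t p q a x' _ [n h] h1 _; exists n; apply: wstrip_top h h1.
- by move=> u v x y t p q a y' _ [n h] h1 _; exists n; apply: wstrip_bot h h1.
- by move=> u v x y t p q z _ [n h] h1 h2 _; exists n; apply: wstrip_close h h1 h2.
- move=> u v x y t p q x1 y1 t' x' y' _ [n h] h1 h2 h3 h4 _ /reduced_catr r _ _.
  by exists (n + (size t').+1); apply: wstrip_shift h h1 h2 h3 r h4.
Qed.

(* [v'] lies on the side [u], or in a copy of a component that meets [u] in a big arc. *)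
Definition covered u v' := exists u1 om, geqG v' (u1 ++ om) /\
  ((om = [::] /\ exists u2, u = u1 ++ u2) \/
   (exists p' u2 z z', [/\ u = u1 ++ p' ++ u2, big_arc z p' & walk z om z'])).

Lemma covered_cat u u' v' : covered u v' -> covered (u ++ u') v'.
Proof.
move=> [u1 [om [h1 h2]]]; exists u1, om; split=> //.
case: h2 => [[-> [u2 ->]]|[p' [u2 [z [z' [-> h2 h3]]]]]]; [left|right].
  by split=> //; exists (u2 ++ u'); rewrite catA.
by exists p', (u2 ++ u'), z, z'; split=> //; rewrite -!catA.
Qed.

(** The prefix [v'] ends in the current cell. Whether the cell meets [u] in a big arc is known only
    once the cell is completed. *)
Definition pending (st : state G) v v' :=
  if st is Cell x y t p q then
    exists v0 q' q'', [/\ v = v0 ++ q, q = q' ++ q'' & v' = v0 ++ q']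
  else False.

Lemma catr_inj u u' (w : word) : u ++ w = u' ++ w -> u = u'.
Proof.
move=> e; have es : size u = size u' by move/(congr1 size): (e); rewrite !size_cat; lia.
by move/eqP: e; rewrite eqseq_cat // => /andP[/eqP].
Qed.

Lemma pending_covered u v x y t p q x1 y1 t' v' : gstrip u v (Cell x y t p q) ->
  locgeod G u -> locgeod G v -> walk x p x1 -> walk y q y1 -> walk x1 t' y1 -> piece x1 t' ->
  reduce (p ++ t') <> reduce (t ++ q) -> pending (Cell x y t p q) v v' -> covered u v'.
Proof.
move=> hg lu lv h1 h2 h3 pt' nf [v0 [q' [q'' [ev eq ev']]]].
have [n /wstrip_split[u0 [v1 [eu ev1 hw]]]] := gstrip_wstrip hg.
have ? : v1 = v0 by apply: (@catr_inj _ _ q); rewrite -ev1.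
subst v1; have [hxy _ _ pt _] := gstrip_cell hg.
rewrite eu in lu; rewrite ev in lv.
have [al [p' [be [z [ep hal hb]]]]] := cell_big_arc hxy h1 h2 h3 (locgeod_suffix_geod lu h1)
  (locgeod_suffix_geod lv h2) pt pt' nf.
(* From the start of the big arc, back along [al], across the rung [t] and forward to the vertex on
   [v]. *)
exists (u0 ++ al), (winv al ++ t ++ q'); split.
  have hs := wstrip_sound hw _ _ _ (walk_refl x) (walk_refl y) hxy.
  rewrite ev' -catA (catA al) (catA u0); apply: geq_trans (geq_catr q' (geq_sym hs)) _.
  rewrite -!catA; apply: geq_catl; rewrite catA; apply: geq_sym.
  exact: (geq_catr (t ++ q') (geq_invr G al)).
right; rewrite eq in h2; case/walk_cat: h2 => y2 h2 _.
exists p', be, z, y2; split=> //; first by rewrite eu ep -!catA.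
exact: walk_invl hal (walk_catI hxy h2).
Qed.

Lemma gstrip_covered u v st v' v'' : gstrip u v st -> locgeod G u -> locgeod G v -> v = v' ++ v'' ->
  covered u v' \/ pending st v v'.
Proof.
move=> h; elim: h v' v'' => {u v st}.
- move=> [|//] v'' _ _ _; left; exists [::], [::]; split; first exact: geq_refl.
  by left; split=> //; exists [::].
- move=> u v a hg IH v' v'' lu lv.
  case/lastP: v'' => [|v'' b]; last first.
    rewrite -rcons_cat => /rcons_inj[ev _].
    have [h|[]] := IH v' v'' (locgeod_rcons lu) (locgeod_rcons lv) ev.
    by left; rewrite -cats1; apply: covered_cat.
  rewrite cats0 => <-; left; exists (rcons u a), [::]; rewrite cats0; split; last first.
    by left; split=> //; exists [::]; rewrite cats0.
  have [n /wstrip_sound hw] := gstrip_wstrip hg.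
  by apply: geq_sym; rewrite -!cats1; apply: geq_catr.
- move=> u v x hg IH v' v'' lu lv ev; have [h|[]] := IH v' v'' lu lv ev; by left.
- move=> u v x y t p q a x' hg IH _ _ v' v'' lu lv ev.
  have [h|h] := IH v' v'' (locgeod_rcons lu) lv ev; last by right.
  by left; rewrite -cats1; apply: covered_cat.
- move=> u v x y t p q a y' hg IH _ _ v' v'' lu lv.
  have [u0 [v0 [eu ev0]]] := gstrip_words hg.
  case/lastP: v'' => [|v'' b].
    rewrite cats0 => <-; right; exists v0, (rcons q a), [::].
    by rewrite cats0 ev0 rcons_cat.
  rewrite -rcons_cat => /rcons_inj[ev _].
  have [h|[v1 [q' [q'' [e1 e2 e3]]]]] := IH v' v'' lu (locgeod_rcons lv) ev; first by left.
  right; exists v1, q', (rcons q'' a); split=> //; first by rewrite e1 rcons_cat.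
  by rewrite {1}e2 rcons_cat.
- move=> u v x y t p q z hg IH h1 h2 nf v' v'' lu lv ev; left.
  have [//|h] := IH v' v'' lu lv ev.
  apply: (pending_covered (t' := [::]) hg lu lv h1 h2 (walk_refl z) (nil_piece z) _ h).
  by rewrite cats0.
- move=> u v x y t p q x1 y1 t' x' y' hg IH h1 h2 h3 h4 ne r3 r4 nf v' v'' lu lv ev; left.
  have [//|h] := IH v' v'' lu lv ev.
  exact: (pending_covered hg lu lv h1 h2 h3 (pieceI (reduced_catr r3) ne h4) nf h).
Qed.

Lemma strip_eq_covered u v v' v'' : locgeod G u -> locgeod G v -> strip_eq u v ->
  v = v' ++ v'' -> covered u v'.
Proof.
move=> lu lv h ev.
by have [//|[]] := gstrip_covered (gstrip_of_eq h (locgeod_reduced lu) (locgeod_reduced lv)) lu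
  lv ev.
Qed.

End CellGeometry.

(** * Rationality *)

Section TranslationLength.
Variable S : finType.
Notation letter := (S * bool)%type.
Notation word := (seq letter).
Variable G : scgraph S.
Implicit Types (u v w p q r s t c e g h : word).
Notation geqG := (Defs.geq (screl G)).
Notation wl := (wordlen (screl G)).

Lemma wordlen_attained w : exists2 w', geqG w w' & size w' = wl w.
Proof.
rewrite /wordlen; case: (constructive_indefinite_description _ _) => k /= [[w' [h1 h2]] _].
by exists w'.
Qed.

Lemma wordlen_le w w' : geqG w w' -> wl w <= size w'.
Proof.
rewrite /wordlen; case: (constructive_indefinite_description _ _) => k /= [_ h] h'.
by apply: h; exists w'.
Qed.

Lemma wordlen_geq w w' : geqG w w' -> wl w = wl w'.
Proof.
move=> h; apply/eqP; rewrite eqn_leq; apply/andP; split.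
  have [u h1 <-] := wordlen_attained w'; apply: wordlen_le; exact: geq_trans h h1.
have [u h1 <-] := wordlen_attained w; apply: wordlen_le; exact: geq_trans (geq_sym h) h1.
Qed.

Lemma wordlen_cat u v : wl (u ++ v) <= wl u + wl v.
Proof.
have [u' h1 <-] := wordlen_attained u; have [v' h2 <-] := wordlen_attained v.
by rewrite -size_cat; apply: wordlen_le; apply: geq_cat.
Qed.

Lemma wpowS w n : wpow w n.+1 = w ++ wpow w n. Proof. by []. Qed.

Lemma wpowD w m n : wpow w (m + n) = wpow w m ++ wpow w n.
Proof. by rewrite /wpow nseqD flatten_cat. Qed.

Lemma size_wpow w n : size (wpow w n) = n * size w.
Proof. by elim: n => // n IH; rewrite wpowS size_cat IH mulSn. Qed.

Lemma wpow_conj h s r n : geqG (h ++ s) (r ++ h) -> geqG (h ++ wpow s n) (wpow r n ++ h).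
Proof.
move=> e; elim: n => [|n IH]; first by rewrite cats0; apply: geq_refl.
rewrite !wpowS catA -[X in geqG _ X]catA; apply: geq_trans (geq_catr _ e) _.
by rewrite -catA; apply: geq_catl.
Qed.

Lemma wpowM w m n : wpow w (m * n) = wpow (wpow w n) m.
Proof. by elim: m => // m IH; rewrite mulSn wpowD wpowS IH. Qed.

Section Rationality.
Variables (w : word) (H : seq word) (B : nat).
Hypothesis w_long : forall n, n <= 3 * wl (wpow w n).

(* [u] equals [w ^ (a - b)] times [v] *)
Definition shifted a b u v := geqG (wpow w b ++ u) (wpow w a ++ v).

Lemma shifted_sym a b u v : shifted a b u v -> shifted b a v u. Proof. exact: geq_sym. Qed.

Lemma shifted_trans a b u v a' b' z : shifted a b u v -> shifted a' b' v z ->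
  shifted (a + a') (b + b') u z.
Proof.
rewrite /shifted => h1 h2; rewrite (addnC b) !wpowD -!catA.
apply: geq_trans (geq_catl _ h1) _; rewrite catA -wpowD addnC wpowD -catA.
exact: geq_catl.
Qed.

Lemma shifted_cat a b u v s : shifted a b u v -> shifted a b (u ++ s) (v ++ s).
Proof. by rewrite /shifted !catA; apply: geq_catr. Qed.

Lemma shifted_bound a b u v : shifted a b u v -> a <= b + 3 * (size u + size v).
Proof.
move=> h; case: (leqP a b) => [|lt]; first by lia.
have ea : a = b + (a - b) by lia.
have h' : geqG u (wpow w (a - b) ++ v).
  by apply: (@geq_cancell _ _ (wpow w b)); rewrite catA -wpowD -ea.
have := wordlen_le (geq_mover (geq_sym h')); rewrite size_cat size_winv => k.
have := w_long (a - b); lia.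
Qed.

(** A loop of length [L] in the quotient by [w], based at a point of [H] and winding [M] times. *)
Definition returns L M := exists h s, [/\ h \in H, size s = L & geqG (h ++ s) (wpow w M ++ h)].

(** Among the first [size H + 1] prefixes of [v] two agree modulo [w]. The loop between them has
    ratio at least [L / M], or does not wind forward; it is cut out, which shifts the later prefixes
    by a power of [w]. In the end a word of length at most [size H] remains. *)
Lemma walk_bound L M v g h a b :
  (forall L' M', L' <= size H -> 0 < M' -> returns L' M' -> L * M' <= L' * M) ->
  size g <= B -> size h <= B ->
  (forall v' v'', v = v' ++ v'' -> exists a b h', h' \in H /\ shifted a b (g ++ v') h') ->
  shifted a b (g ++ v) h -> L * a <= M * size v + L * b + L * (3 * (2 * B + size H)).
Proof.
move=> hmin hg hh; have [n] := ubnP (size v); elim: n v a b => // n IH v a b hn hv hp.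
case: (leqP (size v) (size H)) => hs.
  have := shifted_bound hp; rewrite size_cat => k.
  have : L * a <= L * (b + 3 * (2 * B + size H)) by rewrite leq_mul2l; apply/orP; right; lia.
  by rewrite mulnDr; lia.
have hst i : exists h', h' \in H /\ exists a b, shifted a b (g ++ take i v) h'.
  by have [a1 [b1 [h' [k1 k2]]]] := hv (take i v) (drop i v) (esym (cat_take_drop _ _));
    exists h'; split=> //; exists a1, b1.
pose f i := proj1_sig (constructive_indefinite_description _ (hst i)).
have [fH fpw] : (forall i, f i \in H) /\ (forall i, exists a b, shifted a b (g ++ take i v) (f i)).
  by split=> i; rewrite /f; case: (constructive_indefinite_description _ _) => x /= [].
have : ~~ uniq (map f (iota 0 (size H).+1)).
  apply/negP => /uniq_leq_size hu.
  have /hu : {subset map f (iota 0 (size H).+1) <= H} by move=> x /mapP[i _ ->].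
  by rewrite size_map size_iota ltnn.
case/(uniqPn [::]) => i [j []]; rewrite size_map size_iota => ij jH.
have iH : i < (size H).+1 by lia.
rewrite !(nth_map 0) ?size_iota // !nth_iota // !add0n => fij.
have [a1 [b1 k1]] := fpw i; have [a2 [b2 k2]] := fpw j; rewrite -fij in k2.
set s := take (j - i) (drop i v); set v3 := drop j v.
have ej : take j v = take i v ++ s by rewrite /s -takeD subnKC // ltnW.
have ev : v = take i v ++ s ++ v3 by rewrite catA -ej cat_take_drop.
have szs : size s = j - i by rewrite /s size_take size_drop; case: ltnP; lia.
have szv : size v = size (take i v ++ v3) + size s by rewrite {1}ev !size_cat; lia.
rewrite ej catA in k2.
have loop : L * (b1 + a2) <= L * (a1 + b2) + M * size s.
  case: (leqP (b1 + a2) (a1 + b2)) => hle.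
    by apply: leq_trans (leq_addr _ _); rewrite leq_mul2l hle orbT.
  have k3 : shifted (b1 + a2) (a1 + b2) (f i ++ s) (f i).
    by apply: shifted_trans (shifted_cat s (shifted_sym k1)) k2.
  have e3 : b1 + a2 = (a1 + b2) + ((b1 + a2) - (a1 + b2)) by lia.
  have : returns (size s) ((b1 + a2) - (a1 + b2)).
    exists (f i), s; split=> //; apply: (@geq_cancell _ _ (wpow w (a1 + b2))).
    by rewrite [X in geqG _ X]catA -wpowD -e3.
  move/hmin; rewrite szs => k4; have {}k4 : L * ((b1 + a2) - (a1 + b2)) <= (j - i) * M.
    by apply: k4; lia.
  by rewrite {1}e3 mulnDr; move: k4; clear; lia.
have hcut v4 a4 b4 h4 : shifted a4 b4 (g ++ take i v ++ s ++ v4) h4 ->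
    shifted (a1 + (b2 + a4)) (b1 + (a2 + b4)) (g ++ take i v ++ v4) h4.
  move=> k4; rewrite catA; apply: shifted_trans (shifted_cat v4 k1) _.
  apply: shifted_trans (shifted_cat v4 (shifted_sym k2)) _; by rewrite -!catA.
have h1 : size (take i v ++ v3) < n by lia.
have h2 : forall v' v'', take i v ++ v3 = v' ++ v'' ->
    exists a b h', h' \in H /\ shifted a b (g ++ v') h'.
  move=> v' v'' e; case: (cat_split e) => [[d [e1 e2]]|[d [e1 e2]]].
    have ev' : v = (take i v ++ s ++ d) ++ v'' by rewrite {1}ev e2 -!catA.
    have [a4 [b4 [h4 [k4 k5]]]] := hv _ _ ev'.
    by exists (a1 + (b2 + a4)), (b1 + (a2 + b4)), h4; rewrite e1; split=> //; apply: hcut.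
  by apply: (hv v' (d ++ s ++ v3)); rewrite {1}ev e1 -!catA.
have h3 : shifted a b (g ++ take i v ++ s ++ v3) h by rewrite -ev.
have := IH _ _ _ h1 h2 (hcut _ _ _ _ h3).
by move: loop; rewrite !mulnDr szv mulnDr; clear; lia.
Qed.

End Rationality.
Lemma size_le_sumn H h : h \in H -> size h <= sumn (map size H).
Proof.
by elim: H => //= g H IH; rewrite inE => /orP[/eqP ->|/IH]; lia.
Qed.

(* [L / M] is the least ratio of length to exponent among the loops of length at most [size H]. *)
Theorem linear_growth w (H : seq word) :
  (forall n, n <= 3 * wl (wpow w n)) ->
  (forall n, exists v, [/\ geqG (wpow w n) v, size v = wl (wpow w n) &
     forall v' v'', v = v' ++ v'' -> exists k h, h \in H /\ geqG v' (wpow w k ++ h)]) ->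
  exists L M C, 0 < M /\ forall n,
    L * n <= M * wl (wpow w n) + C /\ M * wl (wpow w n) <= L * n + C.
Proof.
move=> wlong hgeo; pose B := sumn (map size H).
have HB h : h \in H -> size h <= B by exact: size_le_sumn.
have lower L M : (forall L' M', L' <= size H -> 0 < M' -> returns w H L' M' -> L * M' <= L' * M) ->
    forall n, L * n <= M * wl (wpow w n) + L * (3 * (2 * B + size H)).
  move=> hmin n; have [v [hv sv hpre]] := hgeo n.
  have := walk_bound (g := [::]) (h := [::]) (a := n) (b := 0) (v := v) wlong hmin (leq0n _)
    (leq0n _).
  rewrite muln0 addn0 sv; apply.
    by move=> v' v'' /hpre[k [h [h1 h2]]]; exists k, 0, h.
  by rewrite /shifted /= cats0; apply: geq_sym.
case: (classic (exists L M, [/\ L <= size H, 0 < M & returns w H L M])); last first.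
  (* Without loops the minimality condition is void, and the ratio [1 / 0] would bound every [n]. *)
  move=> nex; have h := lower 1 0 _ (3 * (2 * B + size H)).+1; exfalso.
  suff : 1 * (3 * (2 * B + size H)).+1 <= 0 * wl (wpow w (3 * (2 * B + size H)).+1) +
      1 * (3 * (2 * B + size H)) by rewrite !mul1n mul0n add0n ltnn.
  by apply: h => L' M' h1 h2 h3; case: nex; exists L', M'.
(* Short loops wind at most [Mx] times. With [K] as a common multiple of the exponents, the ratios
   [L / M] are compared as natural numbers [L * (K %/ M)], so a least one exists. *)
pose Mx := 3 * (size H + 2 * B); pose K := Mx`!.
have Mbound L M : L <= size H -> returns w H L M -> M <= Mx.
  move=> hL [h [s [hh sL e]]].
  have := shifted_bound wlong (e : shifted w M 0 (h ++ s) h); rewrite size_cat sL.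
  by have := HB h hh; rewrite /Mx; clear -hL; lia.
have Kdiv M : 0 < M -> M <= Mx -> K = (K %/ M) * M.
  by move=> h1 h2; rewrite divnK // dvdn_fact // h1 h2.
move=> [L0 [M0 [hL0 hM0 hr0]]].
pose P k := exists L M, [/\ L <= size H, 0 < M, returns w H L M & k = L * (K %/ M)].
have [k [[L [M [hL hM hr ek]]] kmin]] : exists k, P k /\ forall m, P m -> k <= m.
  by apply: (@least_nat_ex _ (L0 * (K %/ M0))); exists L0, M0.
have hmin L' M' : L' <= size H -> 0 < M' -> returns w H L' M' -> L * M' <= L' * M.
  move=> h1 h2 h3; have : k <= L' * (K %/ M') by apply: kmin; exists L', M'.
  rewrite ek => h4; have eM := Kdiv M hM (Mbound _ _ hL hr).
  have eM' := Kdiv M' h2 (Mbound _ _ h1 h3).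
  have K0 : 0 < K by apply: fact_gt0.
  rewrite -(leq_pmul2l K0).
  have -> : K * (L * M') = (M * M') * (L * (K %/ M)) by rewrite {1}eM; clear; lia.
  have -> : K * (L' * M) = (M * M') * (L' * (K %/ M')) by rewrite {1}eM'; clear; lia.
  by rewrite leq_mul2l h4 orbT.
exists L, M, (L * (3 * (2 * B + size H)) + M * (2 * B + M * size w)); split=> // n; split.
  by have := lower L M hmin n; clear; lia.
case: hr => h [s [hh sL e]].
have hq : wl (wpow w (n %/ M * M)) <= 2 * B + n %/ M * L.
  rewrite wpowM; apply: leq_trans (wordlen_le (geq_mover (geq_sym (wpow_conj (n %/ M) e)))) _.
  by rewrite !size_cat size_winv size_wpow sL; have := HB h hh; clear; lia.
have hn : wl (wpow w n) <= 2 * B + n %/ M * L + M * size w.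
  rewrite {1}(divn_eq n M) wpowD; apply: leq_trans (wordlen_cat _ _) _.
  apply: leq_add hq _; apply: leq_trans (wordlen_le (geq_refl _ _)) _.
  by rewrite size_wpow leq_mul2r ltnW ?orbT // ltn_mod.
have hd : M * (n %/ M * L) <= L * n.
  rewrite mulnC -mulnA (mulnC L) mulnA mulnC leq_mul2l leq_trunc_div orbT //.
move: hn hd; rewrite -(leq_pmul2l hM) !mulnDr; clear; lia.
Qed.

Lemma conj_growth w0 w c n : geqG w0 (c ++ w ++ winv c) ->
  wl (wpow w0 n) <= wl (wpow w n) + 2 * size c /\ wl (wpow w n) <= wl (wpow w0 n) + 2 * size c.
Proof.
move=> h; have e : geqG (winv c ++ w0) (w ++ winv c).
  by apply: geq_sym; rewrite -[winv c in X in geqG _ X]/(winv c); apply: geq_movel; apply: geq_sym.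
have {}e := wpow_conj n e.
have h1 : geqG (wpow w0 n) (c ++ wpow w n ++ winv c).
  by have := geq_movel e; rewrite winvK.
have h2 := geq_mover (geq_sym e); rewrite winvK -catA in h2.
split.
  rewrite (wordlen_geq h1); apply: leq_trans (wordlen_cat _ _) _.
  have k1 := wordlen_le (geq_refl (screl G) c); have k2 := wordlen_cat (wpow w n) (winv c).
  have k3 := wordlen_le (geq_refl (screl G) (winv c)); rewrite size_winv in k3.
  by move: k1 k2 k3; clear; lia.
rewrite (wordlen_geq h2); apply: leq_trans (wordlen_cat _ _) _.
have k1 := wordlen_le (geq_refl (screl G) c); have k2 := wordlen_cat (wpow w0 n) c.
have k3 := wordlen_le (geq_refl (screl G) (winv c)); rewrite size_winv in k3.
by move: k1 k2 k3; clear; lia.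
Qed.

End TranslationLength.

Lemma cv_ratio (f : nat -> nat) L M C : 0 < M ->
  (forall n, L * n <= M * f n + C /\ M * f n <= L * n + C) ->
  Un_cv (fun n => Rdiv (INR (f n.+1)) (INR n.+1)) (Rdiv (IZR (Z.of_nat L)) (INR M)).
Proof.
move=> hM hf eps heps.
have [N hN] : exists N : nat, Rlt (INR C) (Rmult eps (INR N)).
  have [N hN] := INR_unbounded (Rdiv (INR C) eps).
  exists N; rewrite Rmult_comm; apply: (Rmult_lt_reg_r (Rinv eps)).
    exact: Rinv_0_lt_compat.
  rewrite Rmult_assoc Rinv_r; first by rewrite Rmult_1_r.
  by apply: Rgt_not_eq.
exists N => n hn; have [h1 h2] := hf n.+1.
have Mpos : Rlt 0 (INR M) by apply: lt_0_INR; apply/ltP.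
have npos : Rlt 0 (INR n.+1) by apply: lt_0_INR; apply/ltP.
have M1 : Rle 1 (INR M) by apply: (le_INR 1); apply/leP.
have hnN : Rle (INR N) (INR n.+1) by apply: le_INR; lia.
have h1' : Rle (INR L * INR n.+1) (INR M * INR (f n.+1) + INR C).
  by rewrite -!mult_INR -plus_INR; apply: le_INR; apply/leP.
have h2' : Rle (INR M * INR (f n.+1)) (INR L * INR n.+1 + INR C).
  by rewrite -!mult_INR -plus_INR; apply: le_INR; apply/leP.
rewrite /R_dist -INR_IZR_INZ.
set F := INR (f n.+1) in h1' h2' *; set X := INR n.+1 in npos hnN h1' h2' *.
set m := INR M in Mpos M1 h1' h2' *; set l := INR L in h1' h2' *.
have -> : Rminus (Rdiv F X) (Rdiv l m) = Rdiv (Rminus (Rmult m F) (Rmult l X)) (Rmult m X).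
  by field; split; apply: Rgt_not_eq.
have mX : Rlt 0 (Rmult m X) by apply: Rmult_lt_0_compat.
rewrite /Rdiv Rabs_mult (Rabs_right (Rinv _)); last first.
  by apply: Rle_ge; apply: Rlt_le; apply: Rinv_0_lt_compat.
apply: (Rmult_lt_reg_r (Rmult m X)) => //.
rewrite Rmult_assoc Rinv_l; last by apply: Rgt_not_eq.
rewrite Rmult_1_r; apply: (Rle_lt_trans _ (INR C)).
  by apply: Rabs_le; split; lra.
apply: (Rlt_le_trans _ _ _ hN).
have : Rle (Rmult eps (INR N)) (Rmult eps X) by apply: Rmult_le_compat_l => //; apply: Rlt_le.
have : Rle (Rmult eps X) (Rmult eps (Rmult m X)).
  apply: Rmult_le_compat_l; first exact: Rlt_le.
  by rewrite -{1}(Rmult_1_l X); apply: Rmult_le_compat_r => //; apply: Rlt_le.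
lra.
Qed.

(** * Locally geodesic axes *)

Section Axes.
Variable S : finType.
Notation letter := (S * bool)%type.
Notation word := (seq letter).
Variable G : scgraph S.
Implicit Types (x y z : vtx G) (u v p q r s t c e g h a b : word).
Notation geqG := (Defs.geq (screl G)).
Notation wl := (wordlen (screl G)).

Lemma shortest_locgeod u : (forall v, geqG u v -> size u <= size v) -> locgeod G u.
Proof.
move=> h; apply: NNPP => /nlocgeodP[u1 [p [u2 [x [y [e [eu hp he hs]]]]]]].
have k : geqG u (u1 ++ e ++ u2).
  by rewrite eu; apply: geq_catl; apply: geq_catr; apply: walks_geq hp he.
by have := h _ k; rewrite eu !size_cat; move: hs; clear; lia.
Qed.

Lemma geod_exists x p y : walk x p y -> exists e, [/\ geod x e, walk x e y & size e <= size p].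
Proof.
move=> hp; have [k [[e [he ek]] kmin]] := @least_nat_ex
  (fun k => exists e, walk x e y /\ size e = k) (size p) (ex_intro _ p (conj hp erefl)).
exists e; split=> //; last by rewrite ek; apply: kmin; exists p.
by exists y => // e' he'; rewrite ek; apply: kmin; exists e'.
Qed.

Lemma component_words x : exists Lam : seq word, forall om y, walk x om y ->
  exists2 la, la \in Lam & walk x la y.
Proof.
have [l hl] := sc_fin x.
suff [Lam h] : exists Lam : seq word, forall y, List.In y l -> forall om, walk x om y ->
    exists2 la, la \in Lam & walk x la y.
  by exists Lam => om y hy; apply: (h _ (hl _ _ hy) _ hy).
elim: l {hl} => [|y0 l [Lam IH]]; first by exists [::].
case: (classic (exists om, walk x om y0)) => [[om0 h0]|h0].
  exists (om0 :: Lam) => y /= [<-|hy] om h.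
    by exists om0 => //; rewrite mem_head.
  by have [la h1 h2] := IH y hy om h; exists la => //; rewrite inE h1 orbT.
exists Lam => y /= [<-|hy] om h; first by case: h0; exists om.
exact: IH hy om h.
Qed.

(** Up to a power of [w], [v] lies in a copy listed in [J]; the entry [(h, x)] stands for the copy
    whose vertex [x] is at the group element [h]. *)
Definition near w (J : seq (word * vtx G)) v := exists k h x om y,
  [/\ List.In (h, x) J, walk x om y & geqG v (wpow w k ++ h ++ om)].

(** The strip between [u] and a geodesic [v] for the same power serves twice: its sides are
    comparable, which bounds [n], and it covers the prefixes of [v], which keeps them in a set
    finite modulo [w]. *)
Lemma near_growth w J :
  (forall n, exists u, [/\ locgeod G u, geqG (wpow w n) u, n <= size u &
     forall v, covered G u v -> near w J v]) ->
  (forall n, n <= 3 * wl (wpow w n)) /\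
  exists L M C, 0 < M /\ forall n,
    L * n <= M * wl (wpow w n) + C /\ M * wl (wpow w n) <= L * n + C.
Proof.
move=> hJ.
have georep n : exists v, [/\ geqG (wpow w n) v, size v = wl (wpow w n) & locgeod G v].
  have [v h1 h2] := wordlen_attained G (wpow w n); exists v; split=> //.
  apply: shortest_locgeod => v' h'; rewrite h2; apply: wordlen_le; exact: geq_trans h1 h'.
have long n : n <= 3 * wl (wpow w n).
  have [u [lu gu nu _]] := hJ n; have [v [gv <- lv]] := georep n.
  by apply: leq_trans nu _;
    apply: strip_eq_length lu lv (geq_strip (geq_trans (geq_sym gu) gv) lu lv).
split=> //.
have [H hH] : exists H : seq word, forall h x om y, List.In (h, x) J -> walk x om y ->
    exists2 g, g \in H & geqG (h ++ om) g.
  elim: J {hJ} => [|[h0 x0] J [H IH]]; first by exists [::].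
  have [Lam hL] := component_words x0.
  exists ([seq h0 ++ la | la <- Lam] ++ H) => h x om y /= [[<- <-]|hx] hom.
    have [la h1 h2] := hL _ _ hom; exists (h0 ++ la).
      by rewrite mem_cat map_f.
    by apply: geq_catl; apply: walks_geq hom h2.
  have [g h1 h2] := IH _ _ _ _ hx hom; exists g => //.
  by rewrite mem_cat h1 orbT.
apply: (@linear_growth S G w H long) => n.
have [u [lu gu nu hu]] := hJ n; have [v [gv sv lv]] := georep n.
exists v; split=> // v' v'' ev.
have he : strip_eq G u v := geq_strip (geq_trans (geq_sym gu) gv) lu lv.
have [k [h [x [om [y [h1 h2 h3]]]]]] := hu _ (strip_eq_covered lu lv he ev).
have [g h4 h5] := hH _ _ _ _ h1 h2; exists k, g; split=> //.
by apply: geq_trans h3 _; apply: geq_catl.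
Qed.

Lemma big_arc_walk x p : big_arc x p -> exists y, walk x p y.
Proof.
move=> [y0 [c1 [c2 [[_ _ hy _] h1 _]]]]; move: hy => /(walk_catl h1)/walk_cat[y hy _].
by exists y.
Qed.

Lemma pigeonhole (T : Type) (f : nat -> T) l : (forall i, List.In (f i) l) ->
  exists i j, i < j /\ f i = f j.
Proof.
move=> hl; apply: NNPP => h.
have inj i j : f i = f j -> i = j.
  move=> e; case: (ltngtP i j) => // lt; case: h; [exists i, j | exists j, i] => //.
have nd := Injective_map_NoDup (f := f) inj (List.seq_NoDup (length l).+1 0).
have := List.NoDup_incl_length nd (l' := l).
rewrite List.length_map List.length_seq => /(_ _)/leP; rewrite ltnn => h'.
by suff: false by []; apply: h' => x /List.in_map_iff[i [<- _]].
Qed.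

Definition infinite w := infinite_order (screl G) w.

Lemma infinite_conj w0 w c : geqG w0 (c ++ w ++ winv c) -> infinite w0 -> infinite w.
Proof.
move=> h hi n n0 e; apply: (hi n n0).
have h1 : geqG (winv c ++ w0) (w ++ winv c).
  by apply: geq_sym; rewrite -[winv c in X in geqG _ X]/(winv c); apply: geq_movel; apply: geq_sym.
have := geq_movel (wpow_conj n h1); rewrite winvK => h2; apply: geq_trans h2 _.
apply: geq_trans (geq_catl _ (geq_catr _ e)) _; exact: geq_invr.
Qed.

(* In a finite component, a word whose translates all look alike has a power that is a loop. *)
Lemma infinite_neqv w z y : infinite w -> walk z w y -> ~ eqv z y.
Proof.
move=> hi hw e.
have hk k : exists x, walk z (wpow w k) x /\ eqv z x.
  elim: k => [|k [x [h1 h2]]]; first by exists z.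
  have [x' hx'] := eqv_walk h2 hw; exists x'; split.
    by rewrite -addn1 wpowD /wpow /= cats0; apply: walk_catI h1 hx'.
  by apply: eqv_trans e _; apply: eqv_move h2 hw hx'.
pose f k := proj1_sig (constructive_indefinite_description _ (hk k)).
have hf k : walk z (wpow w k) (f k).
  by rewrite /f; case: (constructive_indefinite_description _ _) => x [].
have [l hl] := sc_fin z.
have [i [j [lt eij]]] := pigeonhole (fun k => hl _ _ (hf k)).
apply: (hi (j - i)); first by rewrite subn_gt0.
apply: (@loop_geq _ _ (f i)); apply: (walk_catl (hf i)).
by rewrite -wpowD subnKC ?eij // ltnW.
Qed.

Lemma words_upto n : exists W : seq word, forall p, size p <= n -> p \in W.
Proof.
elim: n => [|n [W hW]]; first by exists [:: [::]] => -[].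
exists ([::] :: [seq l :: p | l <- enum {: letter}, p <- W]) => -[|l p] hp //.
rewrite inE; apply/orP; right; apply/allpairsP; exists (l, p); split=> //=.
  by rewrite mem_enum.
exact: hW.
Qed.

(** The label of a big arc determines its place up to equivalence; [x0] is a dummy for words that
    label none. *)
Lemma big_arc_place x0 p : exists x, forall y, big_arc y p -> eqv y x.
Proof.
case: (classic (exists x, big_arc x p)) => [[x hx]|nx].
  by exists x => y hy; have [z hz] := big_arc_walk hx; apply: big_arc_eqv hy hz.
by exists x0 => y hy; case: nx; exists y.
Qed.

End Axes.

(** * Chains of overlapping translates of a component *)

Section Chains.
Variable S : finType.
Notation letter := (S * bool)%type.
Notation word := (seq letter).
Variable G : scgraph S.
Notation geqG := (Defs.geq (screl G)).

(** The second alternative for an axis: [w ++ a] is read inside a component although the geodesic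
    [e] is shorter. As [a] can be read from [z] too, the component overlaps its translate by [w]
    along [a]. *)
Variables (w a e : word) (z b b' : vtx G).
Hypothesis w_inf : infinite G w.
Hypothesis w_gp : geod z w.
Hypothesis wa_red : reduced (w ++ a).
Hypothesis wa_walk : walk z (w ++ a) b.
Hypothesis a_walk : walk z a b'.
Hypothesis e_gp : geod z e.
Hypothesis e_walk : walk z e b.
Hypothesis e_short : size e < size (w ++ a).
Implicit Types (x y : vtx G) (u v p q r s t c h eta : word).

(* [run k x u y]: [u] can be read from [x] to [y] in a chain of copies of the component of [z],
   where the next copy is the translate by [w] of the previous one, passing [k] times to the next
   copy; the vertex [z.(w ++ eta)] of a copy is the vertex [z.eta] of the next one. *)
Inductive run : nat -> vtx G -> word -> vtx G -> Prop :=
| run_nil x : run 0 x [::] x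
| run_letter k x u y l y' : run k x u y -> walk y [:: l] y' -> run k x (rcons u l) y'
| run_switch k x u eta y y' : run k x u y -> walk z (w ++ eta) y -> walk z eta y' ->
    run k.+1 x u y'.

Lemma run_walk x p y : walk x p y -> run 0 x p y.
Proof.
elim/last_ind: p y => [|p l IH] y; first by move/walk_nil <-; apply: run_nil.
by case/walk_rcons=> x1 /IH h1 h2; apply: run_letter h1 h2.
Qed.

Lemma run0_walk x p y : run 0 x p y -> walk x p y.
Proof.
move e0: 0 => k h; elim: h e0 => {k x p y} //.
by move=> k x u y l y' _ IH h ek; apply/walk_rcons; exists y => //; apply: IH.
Qed.

Lemma run_cat k l x y y' u v : run k x u y -> run l y v y' -> run (k + l) x (u ++ v) y'.
Proof.
move=> h1 h2; elim: h2 h1 => {l y v y'}.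
- by move=> y h1; rewrite addn0 cats0.
- by move=> l y v y1 c y' _ IH h h1; rewrite -rcons_cat; apply: run_letter h; apply: IH.
- by move=> l y v eta y1 y' _ IH h h' h1; rewrite addnS; apply: run_switch h h'; apply: IH.
Qed.

Lemma run_split k x u v y : run k x (u ++ v) y ->
  exists k1 k2 m, [/\ k = k1 + k2, run k1 x u m & run k2 m v y].
Proof.
move e0: (u ++ v) => p h; elim: h u v e0 => {k x p y}.
- by move=> x [|//] [|//] _; exists 0, 0, x; split=> //; apply: run_nil.
- move=> k x p y l y' h IH hl u v; case/lastP: v => [|v l'].
    rewrite cats0 => ->; exists k, 0, y'; rewrite addn0; split=> //; last exact: run_nil.
    exact: run_letter h hl.
  rewrite -rcons_cat => /rcons_inj[ep el]; subst l'.
  have [k1 [k2 [m [-> h1 h2]]]] := IH _ _ ep; exists k1, k2, m; split=> //.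
  exact: run_letter h2 hl.
- move=> k x p eta y y' h IH h1 h2 u v ep.
  have [k1 [k2 [m [-> h3 h4]]]] := IH _ _ ep; exists k1, k2.+1, m; rewrite addnS; split=> //.
  exact: run_switch h4 h1 h2.
Qed.

Lemma run_first k x p y : run k.+1 x p y -> exists o eta r m m',
  [/\ p = o ++ r, walk x o m, walk z (w ++ eta) m, walk z eta m' & run k m' r y].
Proof.
move e0: k.+1 => k' h; elim: h k e0 => {k' x p y} //.
- move=> k' x p y l y' h IH hl k ek.
  have [o [eta [r [m [m' [-> h1 h2 h3 h4]]]]]] := IH _ ek.
  exists o, eta, (rcons r l), m, m'; rewrite rcons_cat; split=> //; exact: run_letter h4 hl.
- move=> k' x p eta y y' h IH h1 h2 k [ek]; subst k'.
  case: k h IH => [|k] h IH.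
    by exists p, eta, [::], y, y'; rewrite cats0; split=> //; [exact: run0_walk|exact: run_nil].
  have [o [eta' [r [m [m' [-> k1 k2 k3 k4]]]]]] := IH _ erefl.
  exists o, eta', r, m, m'; split=> //; exact: run_switch k4 h1 h2.
Qed.

Lemma run_sound k x u y al be : run k x u y -> walk z al x -> walk z be y ->
  geqG (al ++ u) (wpow w k ++ be).
Proof.
move=> h; elim: h al be => {k x u y}.
- by move=> x al be h1 h2; rewrite cats0; apply: walks_geq h1 h2.
- move=> k x u y l y' _ IH hl al be h1 h2; rewrite -cats1 catA.
  have h3 : walk z (be ++ winv [:: l]) y by apply: walk_catI h2 (walk_inv hl).
  apply: geq_trans (geq_catr _ (IH _ _ h1 h3)) _; rewrite -!catA.
  by rewrite -[X in geqG _ (_ ++ X)]cats0; do 2!apply: geq_catl; apply: geq_invl.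
- move=> k x u eta y y' _ IH h1 h2 al be h3 h4.
  apply: geq_trans (IH _ _ h3 h1) _; rewrite -addn1 wpowD -catA; apply: geq_catl.
  by rewrite /wpow /= cats0; apply: geq_catl; apply: walks_geq h2 h4.
Qed.

Lemma run_component k x u y al : run k x u y -> walk z al x -> exists be, walk z be y.
Proof.
move=> h; elim: h al => {k x u y}.
- by move=> x al h; exists al.
- move=> k x u y l y' _ IH hl al h1; have [be h2] := IH _ h1.
  by exists (be ++ [:: l]); apply: walk_catI h2 hl.
- by move=> k x u eta y y' _ _ _ h2 al _; exists eta.
Qed.

Lemma next_copy_neqv m m' eta : walk z (w ++ eta) m -> walk z eta m' -> ~ eqv m m'.
Proof.
move=> /walk_cat[zw h1 h2] h3 ev; apply: (infinite_neqv w_inf h1).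
by apply: eqv_sym; apply: eqv_moveV ev h2 h3.
Qed.

(* A word crossing a whole copy cannot be a piece: otherwise [w ++ a] and the geodesic [e] would
   bound a cycle covered by three pieces and a geodesic. *)
Lemma crossing_not_piece eta1 eta2 m0 m1 m2 m3 p :
  walk z (w ++ eta1) m0 -> walk z eta1 m1 -> walk m1 p m2 ->
  walk z (w ++ eta2) m2 -> walk z eta2 m3 -> ~ piece m1 p.
Proof.
move=> h0 h1 hp h2 h3 pp.
have [zw hw hw2] := (proj1 (walk_cat _ _ _ _) h2).
have hw1 := walk_catl hw h0.
have nzw : ~ eqv z zw := infinite_neqv w_inf hw.
have p2 : piece zw (reduce eta2) by apply: piece_reduce h3; move/eqv_sym.
have p1 : piece z (reduce eta1) by apply: piece_reduce hw1.
have e1 := geod_piece3 w_gp p2 p1 pp hw (walk_reduce hw2) (walk_reduce h1) hp.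
have hb := walk_catl hw wa_walk.
have h4 : walk b (winv a ++ eta2) m2 := walk_invl hb hw2.
have h4' : walk b' (winv a ++ eta2) m3 := walk_invl a_walk h3.
have p3 : piece b (reduce (winv a ++ eta2)).
  by apply: piece_reduce h4' => ev; apply: nzw; apply: eqv_sym; apply: eqv_moveV ev hb a_walk.
have e2 := geod_piece3 e_gp p3 p1 pp e_walk (walk_reduce h4) (walk_reduce h1) hp.
(* Both identities have the right side [eta1 p]; comparing them gives [e = w a], against the
   lengths. *)
move: e2; rewrite -e1 !reduce_catr catA => /reduce_cancelr e3.
have := reduce_mover e3; rewrite winvK !reduce_id //; last exact: geod_reduced e_gp.
by move=> ee; move: e_short; rewrite ee ltnn.
Qed.

(** The empty word is a piece, so it cannot cross a copy: at least one letter is read before each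
    switch. *)
Lemma run_size k m m' eta u y : walk z (w ++ eta) m -> walk z eta m' -> run k m' u y ->
  k <= size u.
Proof.
elim: k m m' eta u => // k IH m m' eta u h1 h2 /run_first.
move=> [o [eta' [r [m2 [m2' [eu ho h3 h4 h5]]]]]].
have := IH _ _ _ _ h3 h4 h5; rewrite eu size_cat; case: (eqVneq o [::]) => [eo|no].
  subst o; case: (crossing_not_piece h1 h2 ho h3 h4); exact: nil_piece.
have {no} : 0 < size o by rewrite lt0n size_eq0.
by clear; lia.
Qed.

Lemma full_copy_place eta1 eta2 m0 m1 m2 m3 p x y :
  walk z (w ++ eta1) m0 -> walk z eta1 m1 -> walk m1 p m2 ->
  walk z (w ++ eta2) m2 -> walk z eta2 m3 -> reduced p -> walk x p y -> eqv m1 x.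
Proof.
move=> h0 h1 hp h2 h3 rp hx; apply: NNPP => ne.
by apply: (crossing_not_piece h0 h1 hp h2 h3); apply: pieceI rp ne hx.
Qed.

(** With three switches [u] would cross two consecutive copies completely. Each crossing determines
    the place of the path from [x'], so a switch between the two would join equivalent vertices. *)
Lemma run_le2 k x u y x' y' : run k x u y -> walk x' u y' -> reduced u -> k <= 2.
Proof.
case: k => [|[|[|k]]] //.
move=> /run_first[o1 [eta1 [r1 [m1 [m1' [eu h1 h2 h3]]]]]].
move=> /run_first[o2 [eta2 [r2 [m2 [m2' [er h4 h5 h6]]]]]].
move=> /run_first[o3 [eta3 [r3 [m3 [m3' [er2 h7 h8 h9 _]]]]]].
subst r2 r1 u => /walk_cat[x1 _ /walk_cat[x2 k2 /walk_cat[x3 k3 _]]] rr.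
have ro2 : reduced o2 by exact: reduced_infix rr.
have ro3 : reduced o3 by move: rr; rewrite catA => /reduced_infix.
have e1 := full_copy_place h2 h3 h4 h5 h6 ro2 k2.
have e2 := full_copy_place h5 h6 h7 h8 h9 ro3 k3.
have e3 := eqv_move e1 h4 k2.
by case: (next_copy_neqv h5 h6); apply: eqv_trans e3 (eqv_sym e2).
Qed.

Lemma run_rcons k x u l y : run k x (rcons u l) y -> exists k1 k2 m m',
  [/\ k = k1 + k2, run k1 x u m, walk m [:: l] m' & run k2 m' [::] y].
Proof.
move e0: (rcons u l) => p h; elim: h u l e0 => {k x p y}.
- by move=> x [].
- move=> k x p y l y' h _ hl u l' /rcons_inj[-> ->].
  by exists k, 0, y, y'; rewrite addn0; split=> //; apply: run_nil.
- move=> k x p eta y y' h IH h1 h2 u l ep.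
  have [k1 [k2 [m [m' [-> h3 h4 h5]]]]] := IH _ _ ep.
  by exists k1, k2.+1, m, m'; rewrite addnS; split=> //; apply: run_switch h5 h1 h2.
Qed.

(** Between the two letters there is at most one switch, as two would let the empty word cross a
    copy. That switch can be made before [l] instead, because [l] is read in both copies. *)
Lemma run_cancel k x l y : run k x [:: l; linv l] y -> run k x [::] y.
Proof.
move=> /(run_rcons (u := [:: l]))[k1 [k4 [m3 [m4 [-> /(run_rcons (u := [::])) h1 h2 h3]]]]].
have [k2 [k3 [m1 [m2 [-> h4 h5 h6]]]]] := h1.
suff h : run k3 m1 [::] m4 by apply: (run_cat (run_cat h4 h) h3).
have h7 := walk_inv h5; rewrite /winv /= /rev /= in h7.
case: k3 h6 {h1} => [|[|k3]] h6.
- have em := proj1 (walk_nil _ _) (run0_walk h6); subst m3.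
  by rewrite (walk_det h2 h7); apply: run_nil.
- have [o1 [eta [r [m [m' [eo k5 k6 k7 k8]]]]]] := run_first h6.
  case: o1 eo k5 => //= er /walk_nil em; subst r m.
  have em := proj1 (walk_nil _ _) (run0_walk k8); subst m'.
  apply: (run_switch (eta := eta ++ [:: linv l]) (run_nil m1)).
    by rewrite catA; apply: walk_catI k6 h7.
  exact: walk_catI k7 h2.
- have [o1 [eta [r [m [m' [eo k5 k6 k7 k8]]]]]] := run_first h6.
  case: o1 eo k5 => //= er _; subst r.
  have [o2 [eta2 [r [m5 [m5' [eo k9 k10 k11 k12]]]]]] := run_first k8.
  case: o2 eo k9 => //= er k9.
  case: (crossing_not_piece k6 k7 k9 k10 k11); exact: nil_piece.
Qed.

Section ShortestRun.
Variables (n : nat) (u : word).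
Hypothesis u_run : run n z u z.
Hypothesis u_min : forall v, run n z v z -> size u <= size v.

Lemma shortest_infix u1 p u2 : u = u1 ++ p ++ u2 -> exists k1 k2 k3 x y,
  [/\ n = k1 + (k2 + k3), run k1 z u1 x, run k2 x p y, run k3 y u2 z &
      forall q, run k2 x q y -> size p <= size q].
Proof.
move=> eu; move: (u_run); rewrite eu => /run_split[k1 [k' [x [en h1]]]].
move=> /run_split[k2 [k3 [y [ek h2 h3]]]]; subst k'; exists k1, k2, k3, x, y; split=> // q hq.
have := u_min (v := u1 ++ q ++ u2); rewrite en => /(_ (run_cat h1 (run_cat hq h3))).
by rewrite eu !size_cat; clear; lia.
Qed.

Lemma shortest_run_reduced : reduced u.
Proof.
apply/negP => /negP /nreducedP[u1 [l [u2 eu]]].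
have [k1 [k2 [k3 [x [y [_ _ h2 _ h]]]]]] := shortest_infix (p := [:: l; linv l]) eu.
by have := h _ (run_cancel h2).
Qed.

(** A subword [p] that is also read inside one component passes at most two switches. If a part of
    the run along [p] is in the place of that reading, the geodesic [E] can replace [p] in the run,
    against minimality. Otherwise [p] consists of at most two pieces, which a different geodesic
    cannot accompany. With two switches the middle part is always in place. *)
Lemma shortest_run_locgeod : locgeod G u.
Proof.
apply: NNPP => /nlocgeodP[u1 [p [u2 [x [y [e0 [eu hp he0 hs0]]]]]]].
have [E [gE hE hsE]] := geod_exists he0.
have {hs0 hsE} hs : size E < size p by lia.
have rp : reduced p by move: shortest_run_reduced; rewrite eu => /reduced_infix.
have [k1 [k2 [k3 [x1 [x2 [_ _ h2 _ hmin]]]]]] := shortest_infix eu.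
have {}hmin : ~ run k2 x1 E x2 by move/hmin; rewrite leqNgt hs.
have nE : reduce E <> reduce p.
  by rewrite !reduce_id //; [move=> e1; move: hs; rewrite e1 ltnn | exact: geod_reduced gE].
have hk := run_le2 h2 hp rp; case: k2 h2 hmin hk => [|[|[|//]]] h2 hmin _.
- have h3 := run0_walk h2.
  case: (classic (eqv x x1)) => [ev|ne].
    by apply: hmin; apply: run_walk; apply: eqv_walks ev hp hE h3.
  apply: nE; rewrite -[E]cats0 -[p]cats0.
  exact: geod_piece3 gE (nil_piece _) (pieceI rp ne h3) (nil_piece _) hE (walk_refl _) hp
    (walk_refl _).
- have [o [eta [r [m [m' [ep h3 h4 h5 /run0_walk h6]]]]]] := run_first h2; subst p.
  have [x3 ho hr] := proj1 (walk_cat _ _ _ _) hp.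
  case: (classic (eqv x x1)) => [ev|ne].
    have [y1 hy1] := eqv_walk ev hp; have hE1 := eqv_walks ev hp hE hy1.
    have hr1 := walk_catl h3 hy1.
    apply: hmin; apply: (run_switch (eta := eta ++ r) (run_walk hE1)).
      by rewrite catA; apply: walk_catI h4 hr1.
    exact: walk_catI h5 h6.
  case: (classic (eqv x3 m')) => [ev|ne'].
    have [x4 hx4] := eqv_walk ev (walk_inv ho).
    have ev4 : eqv x x4 := eqv_move ev (walk_inv ho) hx4.
    have hE4 : walk x4 E x2 by apply: (eqv_walks ev4 hp hE); apply: walk_catI (walk_invE hx4) h6.
    apply: hmin; rewrite -[E]cat0s; apply: (run_cat (k := 1) (l := 0) _ (run_walk hE4)).
    apply: (run_switch (eta := eta ++ winv o) (run_nil x1)).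
      by rewrite catA; apply: walk_catI h4 (walk_inv h3).
    exact: walk_catI h5 hx4.
  apply: nE; rewrite -[E]cats0.
  exact: geod_piece3 gE (nil_piece _) (pieceI (reduced_catl rp) ne h3) (pieceI (reduced_catr rp)
    ne' h6)
    hE (walk_refl _) ho hr.
- have [o [eta [r [m [m' [ep h3 h4 h5 h6]]]]]] := run_first h2; subst p.
  have [o2 [eta2 [r2 [m2 [m2' [er h7 h8 h9 /run0_walk h10]]]]]] := run_first h6; subst r.
  have [x3 ho hr] := proj1 (walk_cat _ _ _ _) hp.
  have [x4 ho2 hr2] := proj1 (walk_cat _ _ _ _) hr.
  have ev := full_copy_place h4 h5 h7 h8 h9 (reduced_infix rp) ho2.
  have [x5 hx5] := eqv_walk (eqv_sym ev) (walk_inv ho).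
  have ev5 : eqv x x5 := eqv_move (eqv_sym ev) (walk_inv ho) hx5.
  have ev4 : eqv x4 m2 := eqv_move (eqv_sym ev) ho2 h7.
  have [x6 hx6] := eqv_walk ev4 hr2.
  have hE5 : walk x5 E x6.
    by apply: (eqv_walks ev5 hp hE); apply: walk_catI (walk_invE hx5) (walk_catI h7 hx6).
  apply: hmin; apply: (run_switch (eta := eta2 ++ r2) (y := x6)).
  + rewrite -[E]cat0s; apply: (run_cat (k := 1) (l := 0) _ (run_walk hE5)).
    apply: (run_switch (eta := eta ++ winv o) (run_nil x1)).
      by rewrite catA; apply: walk_catI h4 (walk_inv h3).
    exact: walk_catI h5 hx5.
  + by rewrite catA; apply: walk_catI h8 hx6.
  + exact: walk_catI h9 h10.
Qed.

End ShortestRun.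

Lemma run_wpow n : run n z (wpow w n) z.
Proof.
have [zw hw _] := proj1 (walk_cat _ _ _ _) wa_walk.
elim: n => [|n IH]; first exact: run_nil.
rewrite wpowS -add1n; apply: run_cat IH.
apply: (run_switch (eta := [::]) (run_walk hw)); by rewrite ?cats0.
Qed.

Lemma geod_run_le B k x u y : (forall x y o al, walk z al x -> walk x o y -> geod x o ->
  size o <= B) ->
  run k x u y -> (exists al, walk z al x) -> locgeod G u -> size u <= k.+1 * B.
Proof.
move=> hB; elim: k x u => [|k IH] x u.
  by move=> /run0_walk h [al hal] lu; rewrite mul1n; apply: (hB _ _ _ _ hal h);
    apply: (lu [::] u [::] x y); rewrite ?cats0.
move=> /run_first[o [eta [r [m [m' [-> h1 h2 h3 h4]]]]]] [al hal] lu.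
rewrite size_cat mulSn; apply: leq_add.
  apply: (hB x m o al hal h1); exact: (@locgeod_geod _ _ [::] o r x m).
by apply: (IH m') => //; [exists eta | apply: locgeod_catr lu].
Qed.

Lemma chain_growth :
  (forall n, n <= 3 * wordlen (screl G) (wpow w n)) /\
  exists L M C, 0 < M /\ forall n,
    L * n <= M * wordlen (screl G) (wpow w n) + C /\
    M * wordlen (screl G) (wpow w n) <= L * n + C.
Proof.
have [Lam hLam] := component_words z.
(* Two vertices of the component are joined by a path through [z], hence the factor 2. *)
pose B := 2 * sumn (map size Lam).
have hB x y o al : walk z al x -> walk x o y -> geod x o -> size o <= B.
  move=> hal ho [y' ho' hmin]; rewrite -(walk_det ho ho') in hmin.
  have [l1 i1 w1] := hLam _ _ hal; have [l2 i2 w2] := hLam _ _ (walk_catI hal ho).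
  apply: leq_trans (hmin _ (walk_invl w1 w2)) _.
  by rewrite size_cat size_winv /B mul2n -addnn; apply: leq_add; apply: size_le_sumn.
(* A big arc on the run passes at most two switches, so it consists of at most three segments of
   length at most [B]. *)
have [W hW] := words_upto S (3 * B).
pose X p := proj1_sig (constructive_indefinite_description _ (big_arc_place z p)).
have hX p : forall y, big_arc y p -> eqv y (X p).
  by rewrite /X; case: (constructive_indefinite_description _ _).
pose J := [seq (h, X p) | h <- Lam, p <- W].
have inJ h p : h \in Lam -> p \in W -> List.In (h, X p) J.
  rewrite /J; elim: (Lam) => //= h0 La IH; rewrite inE => /orP[/eqP <-|h1] h2.
    apply: List.in_or_app; left; elim: (W) h2 => //= p0 W0 IH2.
    by rewrite inE => /orP[/eqP <-|/IH2]; [left | right].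
  by apply: List.in_or_app; right; apply: IH.
apply: (near_growth (J := J)) => n.
have [k [[u [hu ek]] kmin]] := @least_nat_ex (fun k => exists u, run n z u z /\ size u = k) _
  (ex_intro _ _ (conj (run_wpow n) erefl)).
have umin v : run n z v z -> size u <= size v by rewrite ek => hv; apply: kmin; exists v.
have lu := shortest_run_locgeod hu umin; exists u; split=> //.
- by have := run_sound hu (walk_refl z) (walk_refl z); rewrite cats0 /= => h; apply: geq_sym.
- have [zw hw _] := proj1 (walk_cat _ _ _ _) wa_walk.
  by apply: (@run_size n zw z [::] u z) => //; rewrite ?cats0.
move=> v [u1 [om [hv hom]]].
suff [u2 [p [x [y [eu hbig hp hpW]]]]] : exists u2 p x y, [/\ u = u1 ++ u2,
    (exists k x1 x2, run k x1 p x2) /\ (om = [::] \/ big_arc x p), walk x om y & p \in W].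
  have [k1 [k2 [x1 [_ h1 _]]]] := run_split (u := u1) (v := u2) (eq_ind _ (fun u => run n z u z)
    hu _ eu).
  have [be hbe] := run_component h1 (walk_refl z).
  have [la hla1 hla2] := hLam _ _ hbe.
  have hs : geqG (u1 ++ om) (wpow w k1 ++ la ++ om).
    by rewrite catA; apply: geq_catr; apply: (run_sound h1 (walk_refl z) hla2).
  have [y' hy'] : exists y', walk (X p) om y'.
    case: hbig => _ [->|hb]; first by exists (X p).
    exact: eqv_walk (hX _ _ hb) hp.
  exists k1, la, (X p), om, y'; split=> //; [exact: inJ | exact: geq_trans hv hs].
case: hom => [[-> [u2 eu]]|[p [u2 [x [y [eu hb hy]]]]]].
  exists u2, [::], z, z; split=> //; last by apply: hW.
  by split; [exists 0, z, z; apply: run_nil | left].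
exists (p ++ u2), p, x, y; split=> //.
  split; last by right.
  by have [k1 [k2 [k3 [x1 [x2 [_ _ h2 _ _]]]]]] := shortest_infix hu umin eu; exists k2, x1, x2.
apply: hW.
have [k1 [k2 [k3 [x1 [x2 [_ h1 h2 _ _]]]]]] := shortest_infix hu umin eu.
have [x' hx'] := big_arc_walk hb.
have lp : locgeod G p by rewrite eu in lu; apply: locgeod_infix lu.
have hk := run_le2 h2 hx' (locgeod_reduced lp).
apply: leq_trans (geod_run_le hB h2 (run_component h1 (walk_refl z)) lp) _.
by rewrite leq_mul2r; apply/orP; right; lia.
Qed.

End Chains.

(** * Periodic words and shortest conjugates *)

Section Periodic.
Variable S : finType.
Notation letter := (S * bool)%type.
Notation word := (seq letter).
Variable G : scgraph S.
Notation geqG := (Defs.geq (screl G)).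
Notation wl := (wordlen (screl G)).

Definition growth w := (forall n, n <= 3 * wl (wpow w n)) /\
  exists L M C, 0 < M /\ forall n,
    L * n <= M * wl (wpow w n) + C /\ M * wl (wpow w n) <= L * n + C.

Section Segments.
Variables (l0 : letter) (w : word).
Hypothesis w_pos : 0 < size w.
Implicit Types (x y z : vtx G) (u v p q r s t c e h : word).

Definition seg i n : word := [seq nth l0 w (j %% size w) | j <- iota i n].

Lemma size_seg i n : size (seg i n) = n.
Proof. by rewrite size_map size_iota. Qed.

Lemma seg_cat i m n : seg i (m + n) = seg i m ++ seg (i + m) n.
Proof. by rewrite /seg iotaD map_cat. Qed.

Lemma seg_shift i n : seg (size w + i) n = seg i n.
Proof. by rewrite /seg iotaDl -map_comp; apply: eq_map => j /=; rewrite modnDl. Qed.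

Lemma seg_shifts k i n : seg (k * size w + i) n = seg i n.
Proof. by elim: k => // k IH; rewrite mulSn -addnA seg_shift. Qed.

Lemma seg_period : seg 0 (size w) = w.
Proof.
transitivity (map (nth l0 w) (iota 0 (size w))); last by rewrite map_nth_iota0 ?take_size.
by apply/eq_in_map => j; rewrite mem_iota add0n => /andP[_ h]; rewrite modn_small.
Qed.

Lemma wpow_seg n : wpow w n = seg 0 (n * size w).
Proof.
elim: n => // n IH; rewrite wpowS mulSn seg_cat seg_period IH; congr (_ ++ _).
by have := seg_shift 0 (n * size w); rewrite addn0 => ->.
Qed.

Lemma seg_split i n u v : seg i n = u ++ v -> u = seg i (size u) /\ v = seg (i + size u) (size v).
Proof.
move=> e; have en : n = size u + size v by rewrite -size_cat -e size_seg.
move/eqP: e; rewrite en seg_cat eqseq_cat ?size_seg // => /andP[/eqP e1 /eqP e2].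
by rewrite e1 e2.
Qed.

Lemma seg_conj i : geqG w (seg 0 i ++ seg i (size w) ++ winv (seg 0 i)).
Proof.
have -> : seg 0 i ++ seg i (size w) ++ winv (seg 0 i) = w ++ seg 0 i ++ winv (seg 0 i).
  have h1 := seg_cat 0 i (size w); have h2 := seg_cat 0 (size w) i.
  have h3 := seg_shift 0 i; rewrite addn0 in h3.
  by rewrite add0n in h1; rewrite seg_period add0n h3 addnC h1 in h2; rewrite !catA h2.
apply: geq_sym; rewrite -[X in geqG _ X]cats0; apply: geq_catl; exact: geq_invr.
Qed.

Lemma locgeod_powers_growth : (forall n, locgeod G (wpow w n)) -> growth w.
Proof.
move=> hlg.
have [z0 _] := sc_read G l0.
(* Of two big arcs starting at the same position, the shorter label is a prefix of the longer one,
   so they have the same place. Places are thus indexed by positions modulo [size w] alone. *)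
have place (r : nat) : exists x, forall y n, big_arc y (seg r n) -> eqv y x.
  case: (classic (exists x n, big_arc x (seg r n))) => [[x [n hx]]|nx]; last first.
    by exists z0 => y n hy; case: nx; exists y, n.
  exists x => y m hy; have [[x' wx] [y' wy]] := (big_arc_walk hx, big_arc_walk hy).
  case/orP: (leq_total n m) => hnm.
    move: wy; rewrite -(subnKC hnm) seg_cat => /walk_cat[y2 wy _].
    by apply: eqv_sym; apply: big_arc_eqv hx wy.
  move: wx; rewrite -(subnKC hnm) seg_cat => /walk_cat[x2 wx _].
  exact: big_arc_eqv hy wx.
pose X (r : nat) := proj1_sig (constructive_indefinite_description _ (place r)).
have hX (r : nat) : forall y n, big_arc y (seg r n) -> eqv y (X r).
  by rewrite /X; case: (constructive_indefinite_description _ _).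
pose J := [seq (seg 0 r, X r) | r : nat <- iota 0 (size w)].
have inJ (r : nat) : r < size w -> List.In (seg 0 r, X r) J.
  rewrite /J => hr; have : r \in iota 0 (size w) by rewrite mem_iota.
  elim: (iota _ _) => //= k s IH; rewrite inE => /orP[/eqP <-|/IH]; by [left | right].
apply: (near_growth (J := J)) => n; exists (wpow w n); split=> //; first exact: geq_refl.
  by rewrite size_wpow leq_pmulr.
move=> v [u1 [om [hv hom]]].
have prefix u2 : wpow w n = u1 ++ u2 ->
    u1 = wpow w (size u1 %/ size w) ++ seg 0 (size u1 %% size w) /\
    u2 = seg (size u1 %% size w) (size u2).
  rewrite wpow_seg => /seg_split[e1 e2]; split.
    rewrite {1}e1 {1}(divn_eq (size u1) (size w)) seg_cat -wpow_seg add0n.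
    by rewrite -[X in seg X _]addn0 seg_shifts.
  by rewrite {1}e2 add0n {1}(divn_eq (size u1) (size w)) seg_shifts.
have hr : size u1 %% size w < size w by rewrite ltn_mod.
exists (size u1 %/ size w), (seg 0 (size u1 %% size w)), (X (size u1 %% size w)), om.
case: hom => [[eo [u2 /prefix[e1 _]]]|[p [u2 [x [y [eu hb hy]]]]]].
  exists (X (size u1 %% size w)); subst om; split=> //; first exact: inJ.
  by rewrite catA -e1.
have [e1 e2] := prefix _ eu; have [e3 _] := seg_split (esym e2).
rewrite e3 in hb; have [y' hy'] := eqv_walk (hX _ _ _ hb) hy.
exists y'; split=> //; first exact: inJ.
by rewrite catA -e1.
Qed.

Hypothesis w_inf : infinite G w.
Hypothesis w_cmin : forall w2 c2, geqG w (c2 ++ w2 ++ winv c2) -> size w <= size w2.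

(** A shortcut for a segment within one period would give a shorter conjugate of [w]. *)
Lemma short_seg_geod i n x y : n <= size w -> walk x (seg i n) y -> geod x (seg i n).
Proof.
move=> hn hx; exists y => // e he; rewrite size_seg.
have := w_cmin (w2 := e ++ seg (i + n) (size w - n)) (c2 := seg 0 i).
rewrite size_cat size_seg => h; suff : size w <= size e + (size w - n) by move: hn; clear; lia.
apply: h; apply: geq_trans (seg_conj i) _; apply: geq_catl; apply: geq_catr.
rewrite -{1}(subnKC hn) seg_cat; apply: geq_catr; exact: walks_geq hx he.
Qed.

(** If [size w] is at least two, a cancelling pair fits in one period and contradicts
    [short_seg_geod]; if it is one, a letter would be its own inverse. *)
Lemma seg_reduced i n : reduced (seg i n).
Proof.
apply/negP => /negP /nreducedP[u [a [v e]]].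
have [_ e2] := seg_split e; have /seg_split[e3 _] : seg (i + size u) (size (a :: linv a :: v)) =
  [:: a; linv a] ++ v by rewrite -e2.
case: (ltngtP (size w) 1) => hw.
- by move: w_pos hw; clear; lia.
- have [x [y hxy]] := sc_read G a.
  have hx : walk x [:: a; linv a] x by exact: walk_catI hxy (walk_inv hxy).
  rewrite e3 in hx; have := geod_reduced (short_seg_geod hw hx).
  by rewrite -e3 /= /noncan eqxx.
- move: e3; rewrite /seg /= hw !modn1 => -[-> /eqP]; apply/negP; exact: linv_neq.
Qed.

Lemma cyclic_growth : exists c w', geqG w (c ++ w' ++ winv c) /\ growth w'.
Proof.
case: (classic (forall n, locgeod G (wpow w n))) => [hlg|].
  exists [::], w; split; last exact: locgeod_powers_growth.
  by rewrite cats0; apply: geq_refl.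
move=> /not_all_ex_not[N /nlocgeodP[u1 [p [u2 [z [b [e0 [eu hp he0 hs]]]]]]]].
have [i [n ep]] : exists i n, p = seg i n.
  move: eu; rewrite wpow_seg => /seg_split[_ /esym/seg_split[e1 _]].
  by exists (0 + size u1), (size p).
have [e [ge he hse]] := geod_exists he0.
have {hs hse} hs : size e < size p by lia.
have hn : size w < n.
  rewrite ltnNge; apply/negP => hn; rewrite ep in hp hs.
  have [b' hb' /(_ e)] := short_seg_geod hn hp; rewrite -(walk_det hp hb') => /(_ he).
  by rewrite leqNgt hs.
have en : n = size w + (n - size w) by lia.
have ep2 : p = seg i (size w) ++ seg i (n - size w).
  by rewrite ep {1}en seg_cat addnC seg_shift.
(* By periodicity the part of [p] after its first period is also a prefix of [p]. It is therefore
   readable from [z], and it is the overlap [a] of the chain for the rotated word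
   [seg i (size w)]. *)
have [b' hb'] : exists b', walk z (seg i (n - size w)) b'.
  move: hp; rewrite ep -{1}(subnK (ltnW hn)) seg_cat => /walk_cat[b' h _].
  by exists b'.
exists (seg 0 i), (seg i (size w)); split; first exact: seg_conj.
rewrite ep2 in hp hs.
have hi : infinite G (seg i (size w)) := infinite_conj (seg_conj i) w_inf.
have [zw hzw _] := proj1 (walk_cat _ _ _ _) hp.
apply: (chain_growth hi (short_seg_geod (leqnn _) hzw) _ hp hb' ge he hs).
by rewrite -ep2 ep; apply: seg_reduced.
Qed.

End Segments.

Lemma growth_rational w0 : infinite G w0 ->
  exists L M C, 0 < M /\ forall n,
    [/\ L * n <= M * wl (wpow w0 n) + C, M * wl (wpow w0 n) <= L * n + C &
        n <= 3 * wl (wpow w0 n) + C].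
Proof.
move=> hi.
have [k [[w [c [hc ek]]] kmin]] : exists k,
    (exists w c, geqG w0 (c ++ w ++ winv c) /\ size w = k) /\
    forall m, (exists w c, geqG w0 (c ++ w ++ winv c) /\ size w = m) -> k <= m.
  apply: (@least_nat_ex _ (size w0)); exists w0, [::]; split=> //.
  by rewrite cats0; apply: geq_refl.
have hiw := infinite_conj hc hi.
case: w hc ek hiw => [|l0 w'] hc ek hiw; first by case: (hiw 1 erefl); apply: geq_refl.
set w := l0 :: w' in hc ek hiw.
have cmin w2 c2 : geqG w (c2 ++ w2 ++ winv c2) -> size w <= size w2.
  move=> h; rewrite ek; apply: kmin; exists w2, (c ++ c2); split=> //.
  apply: geq_trans hc _; rewrite winv_cat -!catA; apply: geq_catl.
  by have := geq_catr (winv c) h; rewrite -!catA.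
have [c' [w2 [h2 [hlong [L [M [C [M0 hg]]]]]]]] := cyclic_growth l0 (w := w) isT hiw cmin.
have h3 : geqG w0 ((c ++ c') ++ w2 ++ winv (c ++ c')).
  apply: geq_trans hc _; rewrite winv_cat -!catA; apply: geq_catl.
  by have := geq_catr (winv c) h2; rewrite -!catA.
exists L, M, (C + (M + 3) * (2 * size (c ++ c'))); split=> // n.
have [k1 k2] := conj_growth n h3; have k3 := hlong n; have [k4 k5] := hg n.
set D := 2 * size (c ++ c') in k1 k2 *.
have m1 : M * wl (wpow w0 n) <= M * wl (wpow w2 n) + M * D.
  by rewrite -mulnDr leq_mul2l k1 orbT.
have m2 : M * wl (wpow w2 n) <= M * wl (wpow w0 n) + M * D.
  by rewrite -mulnDr leq_mul2l k2 orbT.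
rewrite mulnDl; split.
- by move: k4 m2; clear; lia.
- by move: k5 m1; clear; lia.
- by move: k3 k2; clear; lia.
Qed.

End Periodic.

(** * Labelled graphs as partial actions *)

Section LabelledGraphs.
Variable S : finType.
Notation letter := (S * bool)%type.
Notation word := (seq letter).
Variable Gam : lgraph S.
Hypothesis Gam_red : reduced_labelling Gam.
Hypothesis Gam_fin : finite_components Gam.
Hypothesis Gam_gr : Gr'16 Gam.

Definition gstep (v : vert Gam) (a : letter) v' :=
  exists oe : oedge Gam, [/\ ostart oe = v, olab oe = a & oend oe = v'].

Lemma gstep_det v a v1 v2 : gstep v a v1 -> gstep v a v2 -> v1 = v2.
Proof.
case: Gam_red => h1 h2 [[e o] /= [k1 k2 k3]] [[e' o'] /= [k4 k5 k6]]; subst.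
case: k5; rewrite /olab /= => le lo; subst o'.
move: k4; rewrite /ostart /oend /=; case: o => k4.
  by rewrite (h1 e' e k4 le).
by rewrite (h2 e' e k4 le).
Qed.

Lemma gstep_inv v a v' : gstep v a v' -> gstep v' (linv a) v.
Proof.
move=> [[e o] [h1 h2 h3]]; exists (e, ~~ o); move: h1 h2 h3.
by rewrite /ostart /oend /olab /linv /=; case: o => /= -> <- ->.
Qed.

Definition absent (s : S) := ~ exists e : edge Gam, lab e = s.

(* One extra component, a single edge, for every generator that does not label an edge: then every
   letter can be read somewhere, and no cycle or piece of a cycle is created. *)
Definition gvertex := (vert Gam + S * bool)%type.

Definition gact (x : gvertex) (a : letter) : option gvertex :=
  match x with
  | inl v =>
      match excluded_middle_informative (exists v', gstep v a v') with
      | left h => Some (inl (proj1_sig (constructive_indefinite_description _ h)))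
      | right _ => None
      end
  | inr (s, o) =>
      if excluded_middle_informative (absent s /\ a = (s, ~~ o)) then Some (inr (s, ~~ o))
      else None
  end.

Lemma gact_inl v a x : gact (inl v) a = Some x <-> exists2 v', x = inl v' & gstep v a v'.
Proof.
rewrite /=; case: excluded_middle_informative => [h|n]; last first.
  by split=> // -[v' _ h]; case: n; exists v'.
case: (constructive_indefinite_description _ _) => v' /= h'; split.
  by case=> <-; exists v'.
by case=> v2 -> /(gstep_det h') ->.
Qed.

Lemma gact_inr s o a x : gact (inr (s, o)) a = Some x <->
  [/\ absent s, a = (s, ~~ o) & x = inr (s, ~~ o)].
Proof.
rewrite /=; case: excluded_middle_informative => [[h1 h2]|n].
  by split=> [[<-]|[_ _ ->]].
by split=> // -[h1 h2 _]; case: n.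
Qed.

Lemma gactV x a y : gact x a = Some y -> gact y (linv a) = Some x.
Proof.
case: x => [v|[s o]].
  by move/gact_inl=> [v' -> h]; apply/gact_inl; exists v => //; apply: gstep_inv.
by move/gact_inr=> [h -> ->]; apply/gact_inr; split=> //; rewrite /linv ?negbK.
Qed.

Definition gautomaton : automaton S := Automaton gactV.

Lemma walk_is_path v w (x : vtx gautomaton) : walk (inl v : vtx gautomaton) w x <->
  exists p, [/\ is_path v p, path_word p = w & x = inl (path_end v p)].
Proof.
elim: w v x => [|a w IH] v x.
  split; first by move/walk_nil <-; exists [::].
  by case=> [[|oe p]] [] // _ _ ->.
split.
  move=> /walk_cons[y /gact_inl[v' -> [oe [h1 h2 h3]]] /IH[p [k1 k2 k3]]].
  by exists (oe :: p); rewrite /path_word /= h1 h2 -k2 h3; split=> //; rewrite k3 /path_end /= h3.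
case=> [[|oe p]] [] // [h1 h2] [h3 h4] ->; apply/walk_cons; exists (inl (oend oe)).
  by apply/gact_inl; exists (oend oe) => //; exists oe.
by apply/IH; exists p.
Qed.

Lemma walk_inr s o w x : walk (inr (s, o) : vtx gautomaton) w x ->
  exists o', x = inr (s, o').
Proof.
elim: w o => [|a w IH] o; first by move/walk_nil <-; exists o.
by move=> /walk_cons[y /gact_inr[_ _ ->] /IH].
Qed.

Lemma gread (a : letter) : exists x y : vtx gautomaton, walk x [:: a] y.
Proof.
case: a => s o; case: (classic (absent s)) => [h|/NNPP[e he]].
  exists (inr (s, ~~ o)), (inr (s, o)); apply/walk_step/gact_inr; rewrite negbK; by split.
exists (inl (ostart (e, o))), (inl (oend (e, o))); apply/walk_step/gact_inl.
by exists (oend (e, o)) => //; exists (e, o); rewrite /olab /= he.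
Qed.

Lemma In_map (T U : Type) (f : T -> U) x l : List.In x l -> List.In (f x) (map f l).
Proof. by elim: l => //= y l IH [->|/IH]; [left|right]. Qed.

Lemma gfin (x : vtx gautomaton) : exists l : seq (vtx gautomaton),
  forall w y, walk x w y -> List.In y l.
Proof.
case: x => [v|[s o]].
  have [l hl] := Gam_fin v; exists (map inl l) => w y /walk_is_path[p [h1 _ ->]].
  by apply: In_map; apply: hl; exists p.
exists [:: inr (s, true); inr (s, false)] => w y /walk_inr[o' ->].
by case: o'; [left | right; left].
Qed.

Lemma grel r : relator Gam r -> exists x : vtx gautomaton, walk x r x.
Proof.
move=> [v [p [[h1 [_ [h2 _]]] ->]]]; exists (inl v); apply/walk_is_path; exists p.
by rewrite h2.
Qed.

Lemma dup_split (T U : Type) (f : T -> U) (p : seq T) : ~ List.NoDup (map f p) ->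
  exists p1 x p2 y p3, p = p1 ++ x :: p2 ++ y :: p3 /\ f x = f y.
Proof.
elim: p => [|x p IH] h; first by case: h; apply: List.NoDup_nil.
case: (classic (List.In (f x) (map f p))) => [hin|nin].
  suff [p2 [y [p3 [-> e]]]] : exists p2 y p3, p = p2 ++ y :: p3 /\ f x = f y.
    by exists [::], x, p2, y, p3.
  elim: p hin {IH h} => //= y p IH [<-|/IH[p2 [z [p3 [-> e]]]]]; first by exists [::], y, p.
  by exists (y :: p2), z, p3.
have [|p1 [z [p2 [y [p3 [-> e]]]]]] := IH.
  by move=> nd; apply: h; apply: List.NoDup_cons.
by exists (x :: p1), z, p2, y, p3.
Qed.

Lemma is_path_cat (v : vert Gam) p q : is_path v (p ++ q) <-> is_path v p /\ is_path (path_end v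
  p) q.
Proof.
elim: p v => [|oe p IH] v /=; first by split=> // -[].
split=> [[h1 /IH[h2 h3]]|[[h1 h2] h3]]; first by [].
by split=> //; apply/IH.
Qed.

Lemma path_walk (v : vert Gam) p : is_path v p ->
  walk (inl v : vtx gautomaton) (path_word p) (inl (path_end v p)).
Proof. by move=> h; apply/walk_is_path; exists p. Qed.

Lemma gsimple_path (y : vtx gautomaton) c : simple y c ->
  exists v p, [/\ y = inl v, simple_cycle v p & c = path_word p].
Proof.
move=> [c0 rc hy hs]; case: y hy hs => [v|[s o]] hy hs; last first.
  exfalso; case: c c0 rc hy {hs} => [//|a [|b c]] _.
    by move=> _ /walk_cons[y /gact_inr[_ _ ->] /walk_nil []]; case: o.
  move=> /= /andP[hab _] /walk_cons[y /gact_inr[_ ea ->]] /walk_cons[y' /gact_inr[_ eb _] _].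
  by move: hab; rewrite ea eb /noncan /linv /= eqxx.
case/walk_is_path: (hy) => p [hp ec [ev]].
have loop p1 p2 p3 : p = p1 ++ p2 ++ p3 -> p3 <> [::] ->
    path_end (path_end v p1) p2 = path_end v p1 -> p2 = [::].
  move=> ep n3 el; move: (hp); rewrite ep => /is_path_cat[h1 /is_path_cat[h2 h3]].
  have := hs (path_word p1) (path_word p2) (path_word p3) (inl (path_end v p1)).
  rewrite -ec ep /path_word !map_cat => /(_ erefl) k.
  have {}k : map (@olab S Gam) p2 = [::].
    apply: k; first by case: (p3) n3.
      exact: path_walk.
    by have := path_walk h2; rewrite el.
  by case: (p2) k.
have nds : List.NoDup (map (@ostart S Gam) p).
  apply: NNPP => hnd; have [p1 [x [p2 [y [p3 [ep exy]]]]]] := dup_split hnd.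
  have : x :: p2 = [::].
    apply: (loop p1 (x :: p2) (y :: p3)) => //.
    move: (hp); rewrite ep -cat_cons => /is_path_cat[_ /is_path_cat[h1 [h2 _]]].
    by rewrite -h2 -exy; case: h1.
  by [].
exists v, p; split=> //; split=> //; split; first by rewrite -ec in c0; case: (p) c0.
split=> //; split=> //.
apply: NNPP => hnd; have [p1 [x [p2 [y [p3 [ep exy]]]]]] := dup_split hnd.
move: (hp); rewrite ep -cat_cons => /is_path_cat[_ /is_path_cat[[h1 h2] [h3 _]]].
(* An edge used twice in the same direction repeats a vertex. Used in opposite directions, it
   encloses a closed subpath, which must be empty, and leaves a cancelling pair. *)
have [eo|no] := eqVneq x.2 y.2.
  have : x :: p2 = [::].
    apply: (loop p1 (x :: p2) (y :: p3)) => //.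
    by rewrite -h3 -h1 /ostart eo exy.
  by [].
have exy' : ostart y = oend x.
  by move: no; rewrite /ostart /oend exy; case: (x.2); case: (y.2).
have e2 : p2 = [::].
  apply: (loop (rcons p1 x) p2 (y :: p3)) => //; first by rewrite cat_rcons.
  have -> : path_end v (rcons p1 x) = oend x by rewrite /path_end map_rcons last_rcons.
  exact: etrans (esym h3) exy'.
have : reduced (path_word p1 ++ [:: olab x; olab y] ++ path_word p3).
  by move: rc; rewrite -ec ep e2 /path_word !map_cat.
move/reduced_infix => /=; rewrite andbT /noncan /olab /linv /= exy.
by move: no; case: (x.2); case: (y.2) => //; rewrite eqxx.
Qed.

Lemma gsimple (y : vtx gautomaton) c : simple y c -> relator Gam c.
Proof. by move=> /gsimple_path[v [p [_ h ->]]]; exists v, p. Qed.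

Lemma aut_eqv fv fe v : is_lab_aut fv fe ->
  eqv (inl v : vtx gautomaton) (inl (fv v)).
Proof.
move=> [[gv gvK gvK'] [[ge geK geK'] hf]].
have hst x a y : gstep x a y -> gstep (fv x) a (fv y).
  move=> [[e o] [h1 h2 h3]]; exists (fe e, o); have [k1 [k2 k3]] := hf e.
  by move: h1 h2 h3; rewrite /ostart /oend /olab /= k1 k2 k3; case: o => -> <- ->.
have hstV x a y : gstep (fv x) a y -> exists2 y', y = fv y' & gstep x a y'.
  move=> [[e o] [h1 h2 h3]]; have [k1 [k2 k3]] := hf (ge e); rewrite geK' in k1 k2 k3.
  have inj := can_inj gvK.
  move: h1 h2 h3; rewrite /ostart /oend /olab /= k1 k2 k3; case: o => /inj <- <- <-.
    by exists (tgt (ge e)) => //; exists (ge e, true).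
  by exists (src (ge e)) => //; exists (ge e, false).
have hw w x y : walk (inl x : vtx gautomaton) w (inl y) ->
  walk (inl (fv x) : vtx gautomaton) w (inl (fv y)).
  elim: w x => [|a w IH] x; first by move/walk_nil => [->].
  move=> /walk_cons[z /gact_inl[z' -> h1] /IH h2]; apply/walk_cons; exists (inl (fv z')) => //.
  by apply/gact_inl; exists (fv z') => //; apply: hst.
have hwV w x y : walk (inl (fv x) : vtx gautomaton) w y ->
    exists2 y', y = inl (fv y') & walk (inl x : vtx gautomaton) w (inl y').
  elim: w x => [|a w IH] x; first by move/walk_nil => <-; exists x.
  move=> /walk_cons[z /gact_inl[z' -> /hstV[z2 -> h1]] /IH[y' -> h2]]; exists y' => //.
  by apply/walk_cons; exists (inl z2) => //; apply/gact_inl; exists z2.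
move=> w; split; last first.
  split=> [/hw //|/hwV[y' [e] h]].
  by rewrite -(can_inj gvK e) in h.
split.
  case e: (act (inl (fv v) : vtx gautomaton) w) => [y|//] n.
  by have [y' _] := hwV _ _ _ e; rewrite /walk n.
case e: (act (inl v : vtx gautomaton) w) => [y|//] n.
have [p [_ _ ey]] := (proj1 (walk_is_path _ _ _) e); subst y.
by have := hw _ _ _ e; rewrite /walk n.
Qed.

Lemma gpiece (y z : vtx gautomaton) c1 w c2 : simple y (c1 ++ w ++ c2) -> walk y c1 z ->
  piece z w -> 6 * size w < size (c1 ++ w ++ c2).
Proof.
move=> hc h1 [_ [ew|[x [x' [ne hx]]]]].
  by subst w; case: hc => nz _ _ _; rewrite muln0; case: (c1 ++ [::] ++ c2) nz.
have [v [p [ey hsc ec]]] := gsimple_path hc; subst y.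
case/walk_is_path: h1 => [q1 [k1 k2 ez]].
have [hp _] := hsc.
have [p1 [p2 [p3 [ep e1 e2 e3]]]] : exists p1 p2 p3,
    [/\ p = p1 ++ p2 ++ p3, path_word p1 = c1, path_word p2 = w & path_word p3 = c2].
  exists (take (size c1) p), (take (size w) (drop (size c1) p)),
    (drop (size w) (drop (size c1) p)); rewrite !cat_take_drop; split=> //;
  by rewrite /path_word ?map_take ?map_drop -/(path_word p) -ec ?take_size_cat ?drop_size_cat //
    ?take_size_cat ?drop_size_cat.
move: (hp); rewrite ep => /is_path_cat[m1 /is_path_cat[m2 _]].
have ez' : z = inl (path_end v p1).
  have := path_walk m1; rewrite e1 => k3.
  have := proj2 (walk_is_path v c1 z) (ex_intro _ q1 (And3 k1 k2 ez)).
  by move/(walk_det k3).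
(* The extra components carry only letters absent from the graph, so no nonempty subword of a cycle
   is read there. *)
case: x hx ne => [v2|[s o]] hx ne; last first.
  case: w hc ec e2 hx => [|a w] hc ec e2 hx.
    by case: hc => nz _ _ _; rewrite muln0; case: (c1 ++ [::] ++ c2) nz.
  case/walk_cons: hx => [y' /gact_inr[ab ea _] _].
  case: p2 ep e2 m2 => [//|oe p2] _ [e4 _] _; case: ab; exists oe.1.
  by move: e4; rewrite ea /olab => -[].
case/walk_is_path: hx => [q2 [n1 n2 _]].
have <- : size p2 = size w by rewrite -e2 size_map.
have -> : size (c1 ++ w ++ c2) = size p by rewrite ec size_map.
apply: (Gam_gr (v := v) (p := p) (v1 := path_end v p1) (p1 := p2) (v2 := v2) (p2 := q2) hsc).
  split=> //; split=> //; split; first by rewrite e2 n2.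
  move=> [fv [fe [haut [efv _]]]]; apply: ne; rewrite ez' -efv; exact: aut_eqv haut.
split.
  have [_ [_ [_ [_ nd]]]] := hsc.
  by move: nd; rewrite ep !map_cat => /List.NoDup_app_remove_l/List.NoDup_app_remove_r.
move=> oe hoe; rewrite ep !map_cat; apply: List.in_or_app; right; apply: List.in_or_app; left.
exact: In_map.
Qed.

Definition graph_scgraph : scgraph S :=
  SCGraph gread gfin grel gsimple gpiece.

End LabelledGraphs.

(** * Rationality and the uniform lower bound *)

Theorem theorem5p4 (S : finType) (G : lgraph S) :
  reduced_labelling G -> finite_components G -> Gr'16 G ->
  (forall w : seq (S * bool), infinite_order (relator G) w ->
     exists (a : Z) (b : nat), (0 < b)%N /\
       Un_cv (tl_seq (relator G) w) (Rdiv (IZR a) (INR b))) /\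
  (exists eps : R, Rlt 0 eps /\
     forall w : seq (S * bool), infinite_order (relator G) w ->
       forall l : R, Un_cv (tl_seq (relator G) w) l -> Rle eps l).
Proof.
move=> hred hfin hgr; pose Ga := graph_scgraph hred hfin hgr.
split.
  move=> w /(@growth_rational S Ga)[L [M [C [M0 h]]]].
  exists (Z.of_nat L), M; split=> //.
  apply: (@cv_ratio (fun n => wordlen (relator G) (wpow w n)) L M C M0) => n.
  by have [h1 h2 _] := h n.
(* In the bound [n <= 3 * wordlen + C] only [C] depends on the element; it vanishes in the limit. *)
exists (Rdiv 1 3); split; first lra.
move=> w /(@growth_rational S Ga)[L [M [C [M0 h]]]] l hl.
apply: Rnot_lt_le => hlt; set d := Rminus (Rdiv 1 3) l.
have d0 : Rlt 0 d by rewrite /d; lra.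
have [N1 hN1] := hl (Rdiv d 2) ltac:(lra).
have [N2 hN2] := INR_unbounded (Rdiv (INR C) d).
pose n := (N1 + N2)%N.
have := hN1 n ltac:(rewrite /n; lia); rewrite /R_dist /tl_seq.
have [_ _ h3] := h n.+1.
set f := wordlen _ _ in h3 *.
have h3' : Rle (INR n.+1) (Rplus (Rmult 3 (INR f)) (INR C)).
  have -> : Rplus (Rmult 3 (INR f)) (INR C) = INR (3 * f + C) by rewrite plus_INR mult_INR /=; lra.
  by apply: le_INR; apply/leP.
have npos : Rlt 0 (INR n.+1) by apply: lt_0_INR; apply/ltP.
have hC : Rlt (INR C) (Rmult d (INR n.+1)).
  have hn : Rle (INR N2) (INR n.+1) by apply: le_INR; rewrite /n; lia.
  have k := Rmult_lt_compat_r _ _ _ d0 hN2.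
  have e : Rmult (Rdiv (INR C) d) d = INR C by field; apply: Rgt_not_eq.
  rewrite e in k; apply: (Rlt_le_trans _ _ _ k); rewrite Rmult_comm.
  by apply: Rmult_le_compat_l => //; apply: Rlt_le.
set X := INR n.+1 in h3' npos hC *; set F := INR f in h3' *.
move=> /Rabs_def2[k _].
have k2 : Rlt (Rdiv F X) (Rminus (Rdiv 1 3) (Rdiv d 2)) by rewrite /d in k *; lra.
have k3 := Rmult_lt_compat_r _ _ _ npos k2.
have e : Rmult (Rdiv F X) X = F by field; apply: Rgt_not_eq.
rewrite e in k3; nra.
Qed.
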